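(* Let $\lambda>0$ and suppose the following assumption holds: there exists a power spectral density $\bar\Phi$ (an integrable function on $\mathbb T$ with values in the $m\times m$ Hermitian positive semidefinite matrices) which is positive definite on some open interval of $\mathbb T$ and satisfies $\int_{\mathbb T}[\bar\Phi]_{jh}e^{i\theta k}=[R_k]_{jh}$ for all $(j,h)\in E$ and $k=0,\dots,n$. Then the problem $$\min\ \tilde J_\lambda(\mathbf p,\mathbf Q)\quad\text{s.t. } \mathbf p\in\overline{\mathfrak B_+^o},\ \mathbf Q\in\overline{\mathfrak B_+^m}(E)$$ admits a unique solution $(\hat{\mathbf p},\hat{\mathbf Q})$, and it lies in $\mathfrak B_+^o\times\mathfrak B_+^m(E)$. Moreover, the rational spectral density $\hat\Phi=\hat{\mathbf p}\hat{\mathbf Q}^{-1}$ is bounded and coercive on $\mathbb T$ and satisfies $$\int_{\mathbb T}e^{i\theta k}[\hat\Phi]_{jh}=[R_k]_{jh},\quad k=0,\dots,n,\ (j,h)\in E,$$ $$\int_{\mathbb T}e^{i\theta k}\log\det\hat\Phi=c_k+\varepsilon_k,\quad k=1,\dots,n,\qquad\text{where } \varepsilon_k=\lambda\int_{\mathbb T}e^{i\theta k}\hat{\mathbf p}^{-2}.$$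
   Context: Let $m,n$ be positive integers, $V=\{1,\dots,m\}$, and $E\subseteq V\times V$ a symmetric set containing $(j,j)$ for all $j\in V$. Let $\mathbb T=[0,2\pi)$ and write $\int_{\mathbb T}f$ for $\int_0^{2\pi}f(\theta)\,\frac{d\theta}{2\pi}$. For a matrix $X$, $[X]_{jh}$ is its $(j,h)$ entry (same notation for matrix-valued functions). $\mathfrak B_+^m(E)$ is the set of matrix trigonometric polynomials $\mathbf Q(e^{i\theta})=Q_0+\frac12\sum_{k=1}^n\big(Q_ke^{-i\theta k}+Q_k^Te^{i\theta k}\big)$ with $Q_0\in\mathbb R^{m\times m}$ symmetric, $Q_1,\dots,Q_n\in\mathbb R^{m\times m}$, $[Q_k]_{jh}=0$ for all $k$ and all $(j,h)\notin E$, and $\mathbf Q(e^{i\theta})$ positive definite for every $\theta\in\mathbb T$. $\overline{\mathfrak B_+^m}(E)$ denotes the closure of $\mathfrak B_+^m(E)$ (in the finite-dimensional coefficient space) from which the points $\mathbf Q$ with $\det\mathbf Q(e^{i\theta})=0$ for all $\theta\in\mathbb T$ are removed. $\mathfrak B_+^o$ is the set of scalar trigonometric polynomials $\mathbf p(e^{i\theta})=1+\frac12\sum_{k=1}^n p_k(e^{-i\theta k}+e^{i\theta k})$, $p_k\in\mathbb R$, with $\mathbf p(e^{i\theta})>0$ for all $\theta$; $\overline{\mathfrak B_+^o}$ is its closure. Set $p_0=1$. Data: real $m\times m$ matrices $R_0,\dots,R_n$ ($R_0$ symmetric) and real numbers $c_0,\dots,c_n$. The dual function (with values in the extended reals) is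 $$J(\mathbf p,\mathbf Q)=\int_{\mathbb T}\Big(\mathbf p\log\det(\mathbf p\mathbf Q^{-1})-m\mathbf p\Big)+\sum_{k=0}^n\mathrm{tr}(Q_k^TR_k)-\sum_{k=0}^np_kc_k,$$ $g_\lambda(\mathbf p)=\lambda\int_{\mathbb T}\mathbf p^{-1}$, and $\tilde J_\lambda(\mathbf p,\mathbf Q)=J(\mathbf p,\mathbf Q)+g_\lambda(\mathbf p)$. *)

(* Defs.v *)
(* MathComp + MathComp-Analysis (R : realType), complex numbers R[i]
   from mathcomp-real-closed. *)
From HB Require Import structures.
From mathcomp Require Import all_boot all_order all_algebra.
From mathcomp Require Import all_classical all_reals all_analysis.
From mathcomp Require Import complex.
Set Implicit Arguments. Unset Strict Implicit. Unset Printing Implicit Defensive.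
Import Order.TTheory GRing.Theory Num.Theory.
Local Open Scope ring_scope.
Local Open Scope complex_scope.

(* e^{i t} *)
Definition expi {R : realType} (t : R) : R[i] := (cos t) +i* (sin t).

(* the torus T = [0, 2 pi) as a set of reals *)
Definition Tset {R : realType} : set R := `[0%R, (2 * pi)%R[%classic.

(* normalized integral  \int_T f = \int_0^{2pi} f(t) dt/(2pi), extended-real valued *)
Definition intT {R : realType} (f : R -> \bar R) : \bar R :=
  ((((2 * pi)^-1 : R)%:E) * \int[@lebesgue_measure R]_(t in Tset) f t)%E.

(* integral over T of a complex valued function, as the pair (real part, imaginary part) *)
Definition intTC {R : realType} (f : R -> R[i]) : \bar R * \bar R :=
  (intT (fun t => (complex.Re (f t))%:E), intT (fun t => (complex.Im (f t))%:E)).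

(* integrability on T of a complex-valued function (real and imaginary parts) *)
Definition integrableTC {R : realType} (f : R -> R[i]) : Prop :=
  (@lebesgue_measure R).-integrable Tset (fun t => (complex.Re (f t))%:E) /\
  (@lebesgue_measure R).-integrable Tset (fun t => (complex.Im (f t))%:E).

(* complex conjugate transpose *)
Definition adjC {R : realType} {m k : nat} (A : 'M[R[i]]_(m, k)) : 'M[R[i]]_(k, m) :=
  (map_mx (fun z => z^*) A)^T.

(* Hermitian positive semidefinite / positive definite complex matrices *)
Definition psdC {R : realType} {m : nat} (A : 'M[R[i]]_m) : Prop :=
  adjC A = A /\ forall v : 'cV[R[i]]_m, 0 <= (adjC v *m A *m v) 0 0.
Definition posdefC {R : realType} {m : nat} (A : 'M[R[i]]_m) : Prop :=
  adjC A = A /\ forall v : 'cV[R[i]]_m, v != 0 -> 0 < (adjC v *m A *m v) 0 0.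

(* embedding of real matrices into complex matrices *)
Definition toCmx {R : realType} {m : nat} (A : 'M[R]_m) : 'M[R[i]]_m :=
  map_mx (fun x => x%:C) A.

(* Q(e^{i t}) = Q_0 + 1/2 sum_{k=1}^n (Q_k e^{-i t k} + Q_k^T e^{i t k}) *)
Definition Qeval {R : realType} {n m : nat} (Q : 'I_n.+1 -> 'M[R]_m) (t : R)
  : 'M[R[i]]_m :=
  toCmx (Q ord0) + (2^-1 : R[i]) *:
    \sum_(k < n.+1 | (0 < k)%N)
       (expi (- (k%:R * t)) *: toCmx (Q k) + expi (k%:R * t) *: toCmx (Q k)^T).

(* p(e^{i t}) = 1 + 1/2 sum_{k=1}^n p_k (e^{-i t k} + e^{i t k}) (a real number) *)
Definition pevalC {R : realType} {n : nat} (p : 'I_n.+1 -> R) (t : R) : R[i] :=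
  1 + (2^-1 : R[i]) *
    \sum_(k < n.+1 | (0 < k)%N) (p k)%:C * (expi (- (k%:R * t)) + expi (k%:R * t)).
Definition peval {R : realType} {n : nat} (p : 'I_n.+1 -> R) (t : R) : R :=
  complex.Re (pevalC p t).

(* B_+^m(E) ; the coefficient Q_k is Q k, k = 0..n *)
Definition Bm {R : realType} {n m : nat} (E : rel 'I_m) (Q : 'I_n.+1 -> 'M[R]_m)
  : Prop :=
  [/\ (Q ord0)^T = Q ord0,
      (forall (k : 'I_n.+1) (j h : 'I_m), ~~ E j h -> Q k j h = 0) &
      (forall t : R, 0 <= t < 2 * pi -> posdefC (Qeval Q t))].

(* closure of B_+^m(E) in the coefficient space, minus the Q with
   det Q(e^{i t}) = 0 for all t in T *)
Definition Bm_cl {R : realType} {n m : nat} (E : rel 'I_m) (Q : 'I_n.+1 -> 'M[R]_m)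
  : Prop :=
  (forall e : R, 0 < e -> exists Q' : 'I_n.+1 -> 'M[R]_m,
      Bm E Q' /\ forall (k : 'I_n.+1) (j h : 'I_m), `|Q' k j h - Q k j h| < e) /\
  ~ (forall t : R, 0 <= t < 2 * pi -> \det (Qeval Q t) = 0).

(* B_+^o ; the coefficient p_k is p k, with p_0 = 1 *)
Definition Bo {R : realType} {n : nat} (p : 'I_n.+1 -> R) : Prop :=
  p ord0 = 1 /\ forall t : R, 0 <= t < 2 * pi -> 0 < peval p t.

(* closure of B_+^o in the coefficient space *)
Definition Bo_cl {R : realType} {n : nat} (p : 'I_n.+1 -> R) : Prop :=
  forall e : R, 0 < e -> exists p' : 'I_n.+1 -> R,
      Bo p' /\ forall k : 'I_n.+1, `|p' k - p k| < e.

(* the dual function J(p, Q) (extended-real valued) *)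
Definition Jdual {R : realType} {n m : nat} (Rk : 'I_n.+1 -> 'M[R]_m)
  (c : 'I_n.+1 -> R) (p : 'I_n.+1 -> R) (Q : 'I_n.+1 -> 'M[R]_m) : \bar R :=
  (intT (fun t => (peval p t * ln (complex.Re (\det ((peval p t)%:C *: invmx (Qeval Q t))))
                    - m%:R * peval p t)%:E)
   + (\sum_(k < n.+1) \tr ((Q k)^T *m Rk k))%:E
   - (\sum_(k < n.+1) p k * c k)%:E)%E.

(* g_lambda(p) = lambda \int_T p^{-1} *)
Definition glam {R : realType} {n : nat} (lam : R) (p : 'I_n.+1 -> R) : \bar R :=
  (lam%:E * intT (fun t => ((peval p t)^-1)%:E))%E.

Definition Jtilde {R : realType} {n m : nat} (Rk : 'I_n.+1 -> 'M[R]_m)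
  (c : 'I_n.+1 -> R) (lam : R) (p : 'I_n.+1 -> R) (Q : 'I_n.+1 -> 'M[R]_m) : \bar R :=
  (Jdual Rk c p Q + glam lam p)%E.

(* the spectral density p Q^{-1} *)
Definition Phihat {R : realType} {n m : nat} (p : 'I_n.+1 -> R)
  (Q : 'I_n.+1 -> 'M[R]_m) (t : R) : 'M[R[i]]_m :=
  (peval p t)%:C *: invmx (Qeval Q t).

(* Main.v *)
(* On the interior the dual functional J is convex, and its tangent G at an interior
   point (ph, Qh) is given by a pointwise Fenchel inequality for log det and a tangent
   inequality for 1/x. Because Phibar is positive definite on an interval, the pairing
   <Q, R> = \int tr(Q Phibar) is positive on nonzero psd Q, so it dominates |Q| and J is
   coercive: J attains its minimum on each slice {p >= s, Q >= s I}, s > 0. There p and Q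
   stay bounded away from 0 uniformly in s: p because \int 1/p blows up when a Lipschitz p
   approaches 0, and Q because first-order optimality along Q + s I bounds
   \int p tr (Q + s I)^-1. Hence for small s the minimizer is interior to its slice, the
   gradient vanishes, and this is the system of moment equations. These make G constant on
   the feasible set; G is a lower bound for J on the whole closure, and equality forces
   p = ph and Q = Qh almost everywhere, hence everywhere. *)

Require Import Defs.
From HB Require Import structures.
From mathcomp Require Import all_boot all_order all_algebra.
From mathcomp Require Import all_classical all_reals all_analysis.
From mathcomp Require Import complex.
From mathcomp Require Import measurable_realfun zify ring lra spectral.
Set Implicit Arguments. Unset Strict Implicit. Unset Printing Implicit Defensive.
Import Order.TTheory GRing.Theory Num.Theory numFieldNormedType.Exports.
Local Open Scope ring_scope.
Local Open Scope complex_scope.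

(** * Hermitian matrices *)

(** No derivative of the functional is ever computed. [Gaff], affine in [(p, Q)], lies below [Jreal]
    and meets it at its base point, and this alone is exploited at four kinds of base points: a
    constant pair (coercivity), each point of a slice (lower semicontinuity), a competitor displaced
    from a minimizer (first-order inequalities), and the final minimizer (optimality on the
    closure). The price is that a first-order inequality carries the gradient at the displaced
    point; it is paid by Lipschitz estimates or, for the displacement [s I], by a loss of [s] in the
    lower bound. On a slice with s > 0 all integrands are continuous. On the closure [1/p] and
    [ln det] may be singular and an integral may be [+oo]; signs are then known almost everywhere,
    since a nonzero polynomial in e^{it} has finitely many zeros on the torus, so the default values
    of [ln], [invmx] and inversion at 0 matter only on a null set. As the coefficients are real, t
    -> 2 pi - t conjugates the density, hence the moments are real and a real gradient controls the
    complex moment equations. *)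

Definition qf {R : realType} {m : nat} (A : 'M[R[i]]_m) (v : 'cV[R[i]]_m) : R :=
  complex.Re ((adjC v *m A *m v) 0 0).

Definition sqn {R : realType} {m : nat} (v : 'cV[R[i]]_m) : R := qf 1%:M v.

Section HermitianMatrices.
Variable R : realType.
Implicit Types m k l : nat.

Lemma adjCE m k (A : 'M[R[i]]_(m, k)) i j : adjC A i j = (A j i)^*.
Proof. by rewrite !mxE. Qed.

Lemma adjC_mul m k l (A : 'M[R[i]]_(m, k)) (B : 'M[R[i]]_(k, l)) :
  adjC (A *m B) = adjC B *m adjC A.
Proof. by rewrite /adjC map_mxM trmx_mul. Qed.

Lemma adjCK m k (A : 'M[R[i]]_(m, k)) : adjC (adjC A) = A.
Proof. by apply/matrixP => i j; rewrite !adjCE conjcK. Qed.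

Lemma adjCB m k (A B : 'M[R[i]]_(m, k)) : adjC (A - B) = adjC A - adjC B.
Proof. by apply/matrixP => i j; rewrite !mxE rmorphB. Qed.

Lemma adjCZ m k (a : R) (A : 'M[R[i]]_(m, k)) : adjC (a%:C *: A) = a%:C *: adjC A.
Proof. by apply/matrixP => i j; rewrite !mxE rmorphM /= oppr0. Qed.

Lemma adjC_scalar m (a : R) : adjC (a%:C%:M : 'M[R[i]]_m) = a%:C%:M.
Proof. by apply/matrixP => i j; rewrite !mxE rmorphMn /= oppr0 eq_sym. Qed.

Lemma adjC1 m : adjC (1%:M : 'M[R[i]]_m) = 1%:M.
Proof. exact: adjC_scalar. Qed.

Lemma adjC_diag m (d : 'rV[R]_m) :
  adjC (diag_mx (map_mx (real_complex R) d)) = diag_mx (map_mx (real_complex R) d).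
Proof.
apply/matrixP => i j; rewrite !mxE rmorphMn /= oppr0 eq_sym.
by case: eqP => [->|].
Qed.

Lemma cReD (x y : R[i]) : complex.Re (x + y) = complex.Re x + complex.Re y.
Proof. by case: x => ? ?; case: y. Qed.
Lemma cReN (x : R[i]) : complex.Re (- x) = - complex.Re x.
Proof. by case: x. Qed.
Lemma cReB (x y : R[i]) : complex.Re (x - y) = complex.Re x - complex.Re y.
Proof. by rewrite cReD cReN. Qed.
Lemma cReZ (a : R) (x : R[i]) : complex.Re (a%:C * x) = a * complex.Re x.
Proof. by case: x => ? ? /=; rewrite mul0r subr0. Qed.
Lemma cImD (x y : R[i]) : complex.Im (x + y) = complex.Im x + complex.Im y.
Proof. by case: x => ? ?; case: y. Qed.
Lemma cRe_sum I (r : seq I) (P : pred I) (F : I -> R[i]) :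
  complex.Re (\sum_(i <- r | P i) F i) = \sum_(i <- r | P i) complex.Re (F i).
Proof. by apply: (big_morph _ cReD). Qed.
Lemma cReM (x y : R[i]) : complex.Re (x * y) =
  complex.Re x * complex.Re y - complex.Im x * complex.Im y.
Proof. by case: x => ? ?; case: y. Qed.
Lemma cImM (x y : R[i]) : complex.Im (x * y) =
  complex.Re x * complex.Im y + complex.Im x * complex.Re y.
Proof. by case: x => ? ?; case: y. Qed.

Lemma Im0_real (z : R[i]) : complex.Im z = 0 -> z = (complex.Re z)%:C.
Proof. by case: z => a b /= ->. Qed.

Lemma qfD m (A B : 'M[R[i]]_m) v : qf (A + B) v = qf A v + qf B v.
Proof. by rewrite /qf mulmxDr mulmxDl mxE cReD. Qed.

Lemma qfN m (A : 'M[R[i]]_m) v : qf (- A) v = - qf A v.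
Proof. by rewrite /qf mulmxN mulNmx mxE cReN. Qed.

Lemma qfZ m (a : R) (A : 'M[R[i]]_m) v : qf (a%:C *: A) v = a * qf A v.
Proof. by rewrite /qf -scalemxAr -scalemxAl mxE cReZ. Qed.

Lemma qf_scalar m (a : R) (v : 'cV[R[i]]_m) : qf (a%:C%:M) v = a * sqn v.
Proof. by rewrite -[_%:M]mulmx1 mul_scalar_mx qfZ. Qed.

(** The 1x1 matrix is its own adjoint. This is the bridge from the order on [R[i]] in [psdC] and
    [posdefC] to real inequalities on [qf]. *)
Lemma herm_form_real m (A : 'M[R[i]]_m) v : adjC A = A ->
  (adjC v *m A *m v) 0 0 = (qf A v)%:C.
Proof.
move=> hA; apply: Im0_real.
have e : adjC (adjC v *m A *m v) = adjC v *m A *m v.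
  by rewrite !adjC_mul adjCK hA mulmxA.
have := congr1 (fun M : 'M[R[i]]_1 => complex.Im (M 0 0)) e; rewrite adjCE.
case: ((adjC v *m A *m v) 0 0) => a b /= h; lra.
Qed.

Lemma psdCE m (A : 'M[R[i]]_m) : psdC A <-> adjC A = A /\ forall v, 0 <= qf A v.
Proof.
split=> -[hA h]; split=> // v; first by have := h v; rewrite herm_form_real// ler0c.
by rewrite herm_form_real// ler0c.
Qed.

Lemma posdefCE m (A : 'M[R[i]]_m) :
  posdefC A <-> adjC A = A /\ forall v, v != 0 -> 0 < qf A v.
Proof.
split=> -[hA h]; split=> // v v0; have := h v v0;
  by rewrite herm_form_real// -ltcR.
Qed.

Lemma posdefC_psdC m (A : 'M[R[i]]_m) : posdefC A -> psdC A.
Proof.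
move=> /posdefCE[hA h]; apply/psdCE; split=> // v.
have [->|v0] := eqVneq v 0; last exact/ltW/h.
by rewrite /qf mulmx0 mxE.
Qed.

Lemma sqnE m (v : 'cV[R[i]]_m) :
  sqn v = \sum_i ((complex.Re (v i 0)) ^+ 2 + (complex.Im (v i 0)) ^+ 2).
Proof.
rewrite /sqn /qf mulmx1 mxE cRe_sum; apply: eq_bigr => i _.
by rewrite adjCE; case: (v i 0) => a b /=; ring.
Qed.

Lemma sqn_gt0 m (v : 'cV[R[i]]_m) : v != 0 -> 0 < sqn v.
Proof.
move=> v0; have [i vi] : exists i, v i 0 != 0.
  apply/existsP; apply: contra_neqT v0; rewrite negb_exists => /forallP h.
  by apply/matrixP => i j; rewrite !mxE ord1; apply/eqP; have := h i; rewrite negbK.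
rewrite sqnE (bigD1 i)//=; apply: ltr_wpDr.
  by apply: sumr_ge0 => j _; rewrite addr_ge0// sqr_ge0.
have : 0 < `|v i 0| ^+ 2 by rewrite exprn_gt0// normr_gt0.
by rewrite -add_Re2_Im2 -ltcR.
Qed.

Lemma sqn_ge0 m (v : 'cV[R[i]]_m) : 0 <= sqn v.
Proof. by rewrite sqnE sumr_ge0// => i _; rewrite addr_ge0 ?sqr_ge0. Qed.

(** Spectral theorem for normal matrices; being hermitian makes the eigenvalues real, so the
    diagonal is kept as a real row. *)
Lemma spectral_herm m (A : 'M[R[i]]_m) : adjC A = A ->
  exists (U : 'M[R[i]]_m) (d : 'rV[R]_m),
    [/\ U *m adjC U = 1%:M, adjC U *m U = 1%:M &
        A = adjC U *m diag_mx (map_mx (real_complex R) d) *m U].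
Proof.
move=> hA.
have conjE (z : R[i]) : Num.conj z = z^* by [].
have adE k l (B : 'M[R[i]]_(k, l)) : map_mx Num.conj (B^T) = adjC B.
  by apply/matrixP => i j; rewrite !mxE conjE.
have Hh : A \is hermitianmx m false Num.conj.
  by apply/is_hermitianmxP; rewrite expr0 scale1r adE.
have := hermitian_normalmx Hh; move/orthomx_spectralP.
have /mxOverP dr := hermitian_spectral_diag_real Hh.
have Uu := spectral_unitarymx A.
rewrite invmx_unitary// adE.
set U := spectralmx A in Uu * => e.
exists U, (map_mx (@complex.Re R) (spectral_diag A)).
have U1 : U *m adjC U = 1%:M by rewrite -adE; apply/unitarymxP.
split; [exact: U1 | exact: (mulmx1C U1) |].
rewrite {1}e; congr (_ *m diag_mx _ *m _).
by apply/matrixP => i j; rewrite !mxE; have /RRe_real -> := dr i j.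
Qed.

Section Spectral.
Variables (m : nat) (A U : 'M[R[i]]_m) (d : 'rV[R]_m).
Hypotheses (U1 : U *m adjC U = 1%:M) (U2 : adjC U *m U = 1%:M).
Hypothesis AE : A = adjC U *m diag_mx (map_mx (real_complex R) d) *m U.

(** The eigenvectors of [A] are the columns of [adjC U]. *)
Definition eigv (i : 'I_m) : 'cV[R[i]]_m := adjC (row i U).

Lemma eigvE i : U *m eigv i = delta_mx i 0.
Proof.
apply/matrixP => j k; rewrite !mxE ord1 eqxx andbT.
transitivity ((U *m adjC U) j i); last by rewrite U1 mxE.
by rewrite mxE; apply: eq_bigr => l _; rewrite !mxE.
Qed.

Lemma eigv_adj i : adjC (eigv i) *m adjC U = delta_mx 0 i.
Proof.
rewrite -adjC_mul eigvE; apply/matrixP => j k; rewrite adjCE !mxE ord1 eqxx /=.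
by rewrite andbT; case: eqP => _; rewrite /= oppr0.
Qed.

Lemma qf_eigv i : qf A (eigv i) = d 0 i.
Proof.
rewrite /qf AE !mulmxA eigv_adj -mulmxA eigvE -mulmxA -rowE !mxE.
rewrite (bigD1 i)//= !mxE !eqxx /= mulr1n mulr1 big1 ?addr0// => j ji.
by rewrite !mxE (negPf ji) /= mulr0.
Qed.

Lemma psd_eig_ge0 i : psdC A -> 0 <= d 0 i.
Proof. by move=> /psdCE[_ h]; rewrite -qf_eigv. Qed.

Lemma eigv_neq0 i : eigv i != 0.
Proof.
apply/eqP => e; have := eigvE i; rewrite e mulmx0 => /matrixP/(_ i 0).
by rewrite !mxE !eqxx => /eqP; rewrite eq_sym oner_eq0.
Qed.

Lemma posdef_eig_gt0 i : posdefC A -> 0 < d 0 i.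
Proof. by move=> /posdefCE[_ h]; rewrite -qf_eigv h ?eigv_neq0. Qed.

Lemma det_spectral : \det A = (\prod_i d 0 i)%:C.
Proof.
rewrite AE !det_mulmx mulrAC -det_mulmx U2 det1 mul1r det_diag rmorph_prod.
by apply: eq_bigr => i _; rewrite mxE.
Qed.

(** Reduces the sign of a trace of a product to the signs of the eigenvalues of one factor and of
    the form of the other. *)
Lemma tr_mul_spectral (B : 'M[R[i]]_m) :
  complex.Re (\tr (A *m B)) = \sum_i d 0 i * qf B (eigv i).
Proof.
rewrite AE -!mulmxA mxtrace_mulC -!mulmxA /mxtrace cRe_sum; apply: eq_bigr => i _.
rewrite mul_diag_mx mxE mxE cReZ; congr (_ * complex.Re _).
rewrite /eigv adjCK mulmxA !mxE; apply: eq_bigr => j _.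
by rewrite !mxE; congr (_ * _); apply: eq_bigr => k _; rewrite !mxE.
Qed.

Lemma tr_spectral : complex.Re (\tr A) = \sum_i d 0 i.
Proof.
rewrite -[A]mulmx1 tr_mul_spectral; apply: eq_bigr => i _.
have -> : qf 1%:M (eigv i) = 1; last by rewrite mulr1.
rewrite /qf mulmx1 adjCK.
transitivity (complex.Re ((U *m adjC U) i i)); last by rewrite U1 mxE eqxx.
by rewrite !mxE; congr complex.Re; apply: eq_bigr => k _; rewrite !mxE.
Qed.

Lemma qf_spectral v : qf A v = \sum_i d 0 i *
  ((complex.Re ((U *m v) i 0)) ^+ 2 + (complex.Im ((U *m v) i 0)) ^+ 2).
Proof.
rewrite /qf AE !mulmxA -adjC_mul -2!mulmxA.
set w := U *m v; rewrite mxE cRe_sum; apply: eq_bigr => i _.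
rewrite mul_diag_mx adjCE mxE; case: (w i 0) => a b; rewrite mxE /=; ring.
Qed.

Lemma sqn_unitary v : sqn (U *m v) = sqn v.
Proof. by rewrite /sqn /qf !mulmx1 adjC_mul mulmxA -(mulmxA _ _ U) U2 mulmx1. Qed.

Lemma inv_spectral : (forall i, d 0 i != 0) -> A \in unitmx /\
  invmx A = adjC U *m diag_mx (map_mx (real_complex R) (\row_i (d 0 i)^-1)) *m U.
Proof.
move=> d0; set B := adjC U *m _ *m U.
have AB : A *m B = 1%:M.
  rewrite AE /B !mulmxA -(mulmxA _ U) U1 mulmx1 -(mulmxA (adjC U)).
  rewrite mulmx_diag (_ : diag_mx _ = 1%:M) ?mulmx1//.
  apply/matrixP => i j; rewrite !mxE; case: eqP => // _.
  by rewrite -rmorphM /= divff.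
have [Au _] := mulmx1_unit AB; split=> //.
by rewrite -[LHS]mulmx1 -AB mulmxA mulVmx// mul1mx.
Qed.
End Spectral.

(** Sum of [ln x <= x - 1], strict unless [x = 1]. The [leif] form keeps the equality case, on which
    uniqueness rests. *)
Lemma ln_sum_le (I : finType) (x : I -> R) : (forall i, 0 < x i) ->
  ln (\prod_i x i) <= \sum_i (x i - 1) ?= iff [forall i, x i == 1].
Proof.
move=> x0.
have lnprod : ln (\prod_i x i) = \sum_i ln (x i).
  suff [] : 0 < \prod_i x i /\ ln (\prod_i x i) = \sum_i ln (x i) by [].
  apply: (big_ind2 (fun a b => 0 < a /\ ln a = b)) => //.
    by rewrite ltr01 ln1.
  by move=> a b c d [a0 <-] [c0 <-]; rewrite mulr_gt0 ?lnM ?posrE.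
have lnle i : ln (x i) <= x i - 1 ?= iff (x i == 1).
  have e : 1 + ln (x i) <= x i by rewrite -{2}[x i]lnK ?posrE// expR_ge1Dx.
  apply/leifP; case: eqP => [->|/eqP x1]; first by rewrite ln1 subrr.
  have : 1 + ln (x i) < expR (ln (x i)) by rewrite expR_gt1Dx// ln_eq0.
  by rewrite lnK ?posrE//; lra.
rewrite lnprod; have := @leif_sum R I xpredT (fun i => x i == 1) (fun i => ln (x i))
  (fun i => x i - 1) (fun i _ => lnle i).
by [].
Qed.

Lemma posdef_spectral m (A : 'M[R[i]]_m) : posdefC A ->
  exists (U : 'M[R[i]]_m) (d : 'rV[R]_m),
    [/\ U *m adjC U = 1%:M, adjC U *m U = 1%:M,
        A = adjC U *m diag_mx (map_mx (real_complex R) d) *m U &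
        forall i, 0 < d 0 i].
Proof.
move=> hA; have [hA' _] := hA; have [U [d [U1 U2 AE]]] := spectral_herm hA'.
by exists U, d; split=> // i; exact: (posdef_eig_gt0 U1 AE).
Qed.

Lemma posdef_det m (A : 'M[R[i]]_m) : posdefC A ->
  0 < complex.Re (\det A) /\ \det A = (complex.Re (\det A))%:C.
Proof.
move=> /posdef_spectral[U [d [U1 U2 AE d0]]]; rewrite (det_spectral U2 AE) /=.
by split=> //; apply: prodr_gt0.
Qed.

Lemma posdef_unit m (A : 'M[R[i]]_m) : posdefC A -> A \in unitmx.
Proof.
move=> /posdef_det[d0 e]; rewrite unitmxE unitfE e; apply/eqP => -[] e'.
by rewrite e' ltxx in d0.
Qed.

Lemma adjC_inv m (A : 'M[R[i]]_m) : A \in unitmx -> adjC A = A ->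
  adjC (invmx A) = invmx A.
Proof.
move=> Au hA; have e : adjC (invmx A) *m A = 1%:M.
  by rewrite -{2}hA -adjC_mul mulmxV// adjC1.
by rewrite -[LHS]mulmx1 -(mulmxV Au) mulmxA e mul1mx.
Qed.

Lemma qf_conj m (A U : 'M[R[i]]_m) v : qf (U *m A *m adjC U) v = qf A (adjC U *m v).
Proof. by rewrite /qf adjC_mul adjCK !mulmxA. Qed.

Lemma posdef_conj m (A U : 'M[R[i]]_m) : posdefC A -> U \in unitmx ->
  posdefC (U *m A *m adjC U).
Proof.
move=> /posdefCE[hA hp] Uu; apply/posdefCE; split.
  by rewrite !adjC_mul adjCK hA mulmxA.
move=> v v0; rewrite qf_conj hp//; apply: contraNneq v0 => e.
have : invmx (adjC U) *m (adjC U *m v) = 0 by rewrite e mulmx0.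
rewrite mulmxA mulVmx ?mul1mx// => [->//|].
by rewrite /adjC unitmx_tr map_unitmx.
Qed.

(* Factor [Phi = W^* W] and apply [ln x <= x - 1] to the eigenvalues of [W Q W^*]. *)
Lemma lndet_tr_le m (Phi Q : 'M[R[i]]_m) : posdefC Phi -> posdefC Q ->
  ln (complex.Re (\det Q)) + ln (complex.Re (\det Phi)) <=
    complex.Re (\tr (Q *m Phi)) - m%:R /\
  (ln (complex.Re (\det Q)) + ln (complex.Re (\det Phi)) =
    complex.Re (\tr (Q *m Phi)) - m%:R -> Q *m Phi = 1%:M).
Proof.
move=> hP hQ; have [q0 qE] := posdef_det hQ; have [f0 fE] := posdef_det hP.
have [U [d [U1 U2 PE d0]]] := posdef_spectral hP.
set s : 'rV[R]_m := \row_i Num.sqrt (d 0 i).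
set S := diag_mx (map_mx (real_complex R) s); set W := S *m U.
have SS : S *m S = diag_mx (map_mx (real_complex R) d).
  rewrite mulmx_diag; congr diag_mx; apply/matrixP => i j.
  by rewrite !mxE ord1 -rmorphM /= -expr2 sqr_sqrtr// ltW.
have WE : adjC W *m W = Phi.
  by rewrite adjC_mul adjC_diag mulmxA -(mulmxA (adjC U) S) SS PE.
have Wu : W \in unitmx.
  have := posdef_unit hP; rewrite -WE unitmx_mul => /andP[_ ->] //.
have hX := posdef_conj hQ Wu; set X := W *m Q *m adjC W in hX *.
have trX : \tr X = \tr (Q *m Phi).
  by rewrite /X -mulmxA mxtrace_mulC -mulmxA WE.
have detX : \det X = \det Q * \det Phi.
  by rewrite /X -WE !det_mulmx; ring.
have [V [x [V1 V2 XE x0]]] := posdef_spectral hX.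
have lnX : ln (complex.Re (\det Q)) + ln (complex.Re (\det Phi)) =
    ln (\prod_i x 0 i).
  rewrite -lnM ?posrE//; congr ln.
  have := det_spectral V2 XE; rewrite detX qE fE -rmorphM => /complexI ->.
  by [].
have tX : complex.Re (\tr (Q *m Phi)) - m%:R = \sum_i (x 0 i - 1).
  rewrite -trX (tr_spectral V1 XE) big_split /=; congr (_ + _).
  by rewrite sumrN sumr_const card_ord.
have [le_ eq_] := ln_sum_le x0; rewrite lnX tX; split=> //.
(* In the equality case every eigenvalue of [X] is 1, so [X] is the identity; moving [W] to the
   other side turns this into [Q *m Phi = 1%:M]. *)
move=> /eqP; rewrite eq_ => /forallP x1.
have X1 : X = 1%:M.
  rewrite XE (_ : diag_mx _ = 1%:M) ?mulmx1//.
  apply/matrixP => i j; rewrite !mxE; case: eqP => // _.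
  by rewrite (eqP (x1 i)).
have /mulmx1C : W *m (Q *m adjC W) = 1%:M by rewrite mulmxA.
by rewrite -mulmxA WE.
Qed.

(** The determinant is the product of the eigenvalues, so none of them vanishes. *)
Lemma psd_posdef m (A : 'M[R[i]]_m) : psdC A -> \det A != 0 -> posdefC A.
Proof.
move=> hA; have [hA' _] := hA; have [U [d [U1 U2 AE]]] := spectral_herm hA'.
rewrite (det_spectral U2 AE) => dA.
have d0 i : 0 < d 0 i.
  rewrite lt_neqAle (psd_eig_ge0 U1 AE)// andbT eq_sym.
  apply: contraNneq dA => e; rewrite (bigD1 i)//= e mul0r //.
apply/posdefCE; split=> // v v0.
rewrite (qf_spectral AE).
have := sqn_gt0 v0; rewrite -(sqn_unitary U2) sqnE => h.
rewrite lt_neqAle sumr_ge0 ?andbT => [|i _]; last first.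
  by rewrite mulr_ge0 ?addr_ge0 ?sqr_ge0 // ltW.
rewrite eq_sym psumr_eq0 => [|i _]; last first.
  by rewrite mulr_ge0 ?addr_ge0 ?sqr_ge0 // ltW.
apply: contraTN h => /allP h; rewrite big1 ?ltxx// => i _.
have := h i; rewrite mem_index_enum => /(_ isT).
by rewrite mulf_eq0 gt_eqF//= => /eqP.
Qed.

Lemma psd_tr_mul_ge0 m (A B : 'M[R[i]]_m) : psdC A -> psdC B ->
  0 <= complex.Re (\tr (A *m B)).
Proof.
move=> hA /psdCE[_ hB]; have [hA' _] := hA; have [U [d [U1 U2 AE]]] := spectral_herm hA'.
rewrite (tr_mul_spectral AE) sumr_ge0// => i _.
by rewrite mulr_ge0// (psd_eig_ge0 U1 AE).
Qed.

Lemma psd_tr_mul_eq0 m (A B : 'M[R[i]]_m) : psdC A -> posdefC B ->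
  complex.Re (\tr (A *m B)) = 0 -> A = 0.
Proof.
move=> hA /posdefCE[_ hB]; have [hA' _] := hA.
have [U [d [U1 U2 AE]]] := spectral_herm hA'.
have B0 i : 0 < qf B (eigv U i) by rewrite hB ?(eigv_neq0 U1).
rewrite (tr_mul_spectral AE) => /eqP; rewrite psumr_eq0 => [/allP h|i _]; last first.
  by rewrite mulr_ge0 ?(ltW (B0 i))// (psd_eig_ge0 U1 AE).
rewrite AE (_ : diag_mx _ = 0) ?mulmx0 ?mul0mx//.
apply/matrixP => i j; rewrite !mxE.
have := h i; rewrite mem_index_enum => /(_ isT).
by rewrite mulf_eq0 (gt_eqF (B0 i)) orbF => /eqP ->; rewrite mul0rn.
Qed.

Lemma posdef_inv m (A : 'M[R[i]]_m) : posdefC A -> posdefC (invmx A).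
Proof.
move=> hA; have Au := posdef_unit hA; have [hA' _] := hA.
have h := posdef_conj hA (U := invmx A).
by rewrite unitmx_inv Au mulVmx// mul1mx adjC_inv// in h; exact: h.
Qed.

(* With [w = A^-1 v], both bounds come from expanding a square. *)
Lemma qf_inv_le m (A : 'M[R[i]]_m) (s : R) v : posdefC A -> 0 < s ->
  (forall w, s * sqn w <= qf A w) -> qf (invmx A) v <= sqn v / s.
Proof.
move=> hA s0 h; have Au := posdef_unit hA; have [hA' _] := hA.
have hI := adjC_inv Au hA'.
set w := invmx A *m v.
have e1 : qf (invmx A) v = qf A w.
  by rewrite /qf /w adjC_mul hI -!mulmxA (mulmxA A) mulmxV// mul1mx.
have e2 : (adjC v *m w) 0 0 = (qf (invmx A) v)%:C.
  by rewrite -herm_form_real// /w mulmxA.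
have e3 : (adjC w *m v) 0 0 = (qf (invmx A) v)%:C.
  by rewrite -herm_form_real// /w adjC_mul hI.
have := sqn_ge0 (v - s%:C *: w).
have -> : sqn (v - s%:C *: w) = sqn v - 2 * s * qf (invmx A) v + s ^+ 2 * sqn w.
  rewrite /sqn /qf !mulmx1 adjCB adjCZ mulmxBl !mulmxBr.
  rewrite -!scalemxAl -!scalemxAr.
  have eB (X Y : 'M[R[i]]_1) : (X - Y) 0 0 = X 0 0 - Y 0 0 by rewrite !mxE.
  have eZ (X : 'M[R[i]]_1) a : (a *: X) 0 0 = a * X 0 0 by rewrite !mxE.
  rewrite !(eB, eZ) e2 e3 !cReB !cReZ.
  rewrite -/(qf (invmx A) v) /=.
  move: (qf (invmx A) v) (complex.Re _) (complex.Re _) => x y z; ring.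
have := h w; rewrite -e1 => h1 h2.
rewrite ler_pdivlMr//.
have : s * (s * sqn w) <= s * qf (invmx A) v by rewrite ler_pM2l.
move: h2; nra.
Qed.

(** The square is taken in the norm of [A]: [qf A (w - v / b)] is nonnegative. The upper bound on
    [A] is needed only at the vector [v] itself. *)
Lemma qf_inv_ge m (A : 'M[R[i]]_m) (b : R) v : posdefC A -> 0 < b ->
  qf A v <= b * sqn v -> sqn v / b <= qf (invmx A) v.
Proof.
move=> hA b0 h; have Au := posdef_unit hA; have [hA' _] := hA.
have hI := adjC_inv Au hA'.
set w := invmx A *m v.
have Aw : A *m w = v by rewrite mulmxA mulmxV// mul1mx.
have e1 : (adjC w *m A *m w) 0 0 = (qf (invmx A) v)%:C.
  by rewrite -herm_form_real// -mulmxA Aw /w adjC_mul hI.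
have e2 : (adjC v *m A *m w) 0 0 = (sqn v)%:C.
  by rewrite -herm_form_real ?adjC1// -mulmxA Aw mulmx1.
have e3 : (adjC w *m A *m v) 0 0 = (sqn v)%:C.
  by rewrite -[adjC w *m A]adjCK adjC_mul adjCK hA' Aw -herm_form_real ?adjC1// mulmx1.
have /psdCE[_ /(_ (w - b^-1%:C *: v))] := posdefC_psdC hA.
have -> : qf A (w - b^-1%:C *: v) =
    qf (invmx A) v - 2 * (sqn v / b) + b^-1 ^+ 2 * qf A v.
  rewrite {1}/qf adjCB adjCZ !mulmxBl !mulmxBr.
  rewrite -!scalemxAl -!scalemxAr.
  have eB (X Y : 'M[R[i]]_1) : (X - Y) 0 0 = X 0 0 - Y 0 0 by rewrite !mxE.
  have eZ (X : 'M[R[i]]_1) a : (a *: X) 0 0 = a * X 0 0 by rewrite !mxE.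
  rewrite !(eB, eZ) e1 e2 e3 herm_form_real// !cReB !cReZ.
  move: (qf (invmx A) v) (sqn v) (qf A v) => x y z /=; ring.
have : b^-1 ^+ 2 * qf A v <= sqn v / b.
  rewrite [leRHS](_ : _ = b^-1 ^+ 2 * (b * sqn v)); last by field; rewrite gt_eqF.
  by rewrite ler_wpM2l// sqr_ge0.
move: (sqn v / b) (qf (invmx A) v) (_ * qf A v) => x y z; lra.
Qed.

(** [qf A v] is a weighted mean of the eigenvalues, so some eigenvalue is at most [qf A v]; its
    inverse is one of the positive terms of the trace. *)
Lemma tr_inv_ge m (A : 'M[R[i]]_m) v : posdefC A -> sqn v = 1 ->
  (qf A v)^-1 <= complex.Re (\tr (invmx A)).
Proof.
move=> hA v1; have [U [d [U1 U2 AE d0]]] := posdef_spectral hA.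
have [i le_i] : exists i, d 0 i <= qf A v.
  apply/existsP; apply: contraT; rewrite negb_exists => /forallP h.
  have : 0 < qf A v by have /posdefCE[_ ->] := hA => //; apply/eqP => e;
    move: v1; rewrite e /sqn /qf mulmx0 mxE => /eqP; rewrite eq_sym oner_eq0.
  have : qf A v <= qf A v * sqn (U *m v).
    by rewrite (sqn_unitary U2) v1 mulr1.
  rewrite {1}(qf_spectral AE) sqnE mulr_sumr => le_ _.
  have lt_i (i : 'I_m) : qf A v < d 0 i by rewrite ltNge h.
  have sq_ge0 (i : 'I_m) : 0 <= (complex.Re ((U *m v) i 0)) ^+ 2 +
      (complex.Im ((U *m v) i 0)) ^+ 2 by rewrite addr_ge0 ?sqr_ge0.
  (* A unit vector has a coordinate of positive weight, which makes the comparison strict. *)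
  have [i0 i0P] : exists i, 0 < (complex.Re ((U *m v) i 0)) ^+ 2 +
      (complex.Im ((U *m v) i 0)) ^+ 2.
    apply/existsP; apply: contraT; rewrite negb_exists => /forallP hz.
    have : sqn (U *m v) = 0.
      rewrite sqnE big1// => i _; apply/eqP; have := hz i.
      by rewrite lt_neqAle sq_ge0 andbT negbK eq_sym.
    by rewrite (sqn_unitary U2) v1 => /eqP; rewrite oner_eq0.
  move: le_; rewrite [leLHS](bigD1 i0)//= [leRHS](bigD1 i0)//= leNgt => /negP[].
  apply: ltr_leD; first by rewrite ltr_pM2r ?lt_i.
  by apply: ler_sum => i _; apply: ler_wpM2r => //; exact/ltW/lt_i.
have [Au iE] := inv_spectral U1 U2 AE (fun i => lt0r_neq0 (d0 i)).
rewrite (tr_spectral U1 iE) (bigD1 i)//= mxE.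
rewrite ler_wpDr//; first by apply: sumr_ge0 => j _; rewrite mxE invr_ge0 ltW.
by rewrite lef_pV2 ?posrE// (lt_le_trans (d0 i)).
Qed.

(** An entrywise bound: each matrix product costs a factor equal to the inner dimension. *)
Definition mxbound m k (A : 'M[R[i]]_(m, k)) (b : R) :=
  forall i j, `|A i j| <= b%:C.

Lemma mxbound_mul m k l (A : 'M[R[i]]_(m, k)) (B : 'M[R[i]]_(k, l)) a b :
  mxbound A a -> mxbound B b -> mxbound (A *m B) (k%:R * (a * b)).
Proof.
move=> hA hB i j; rewrite mxE (le_trans (ler_norm_sum _ _ _))//.
rewrite (@le_trans _ _ (\sum_(x < k) (a * b)%:C))//.
  apply: ler_sum => x _; rewrite normrM (rmorphM (real_complex R)) ler_pM//.
by rewrite sumr_const card_ord mulr_natl rmorphMn.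
Qed.

Lemma mxbound_entry m k (A : 'M[R[i]]_(m, k)) b i j : mxbound A b ->
  `|complex.Re (A i j)| <= b /\ `|complex.Im (A i j)| <= b.
Proof.
move=> /(_ i j); case: (A i j) => x y; rewrite normc_def lecR /= => h.
split; apply: le_trans h.
  by rewrite -sqrtr_sqr ler_wsqrtr// lerDl sqr_ge0.
by rewrite -sqrtr_sqr ler_wsqrtr// lerDr sqr_ge0.
Qed.

(** The eigenvalues are at most [b] and the entries of a unitary matrix have modulus at most 1, so
    each of the [m] terms of an entry is at most [b]. *)
Lemma mxbound_psd m (A : 'M[R[i]]_m) b : psdC A -> (forall v, qf A v <= b * sqn v) ->
  mxbound A (m%:R * b).
Proof.
move=> hA hb; have [hA' _] := hA; have [U [d [U1 U2 AE]]] := spectral_herm hA'.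
have d0 i : 0 <= d 0 i by exact: (psd_eig_ge0 U1 AE).
have db i : d 0 i <= b.
  rewrite -(qf_eigv U1 AE) (le_trans (hb _))// (_ : sqn _ = 1) ?mulr1//.
  rewrite -(sqn_unitary U2) (eigvE U1) sqnE (bigD1 i)//= mxE !eqxx /= big1.
    by rewrite expr1n expr0n /= !addr0.
  by move=> j ji; rewrite !mxE (negPf ji) /= expr0n /= addr0.
have Ub i j : `|U i j| <= 1.
  have : complex.Re ((adjC U *m U) j j) = 1 by rewrite U2 mxE eqxx.
  rewrite mxE cRe_sum (bigD1 i)//= adjCE.
  set s := \sum_(_ | _) _ => e.
  have s0 : 0 <= s.
    apply: sumr_ge0 => k _; rewrite adjCE; case: (U k j) => x y /=.
    by rewrite mulNr opprK addr_ge0// -expr2 sqr_ge0.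
  rewrite -(@ler_pXn2r _ 2)// ?nnegrE// expr1n sqr_normc.
  case: (U i j) e => x y /= e; rewrite lecE /=; apply/andP; split.
    by apply/eqP; ring.
  by move: e; rewrite mulNr opprK; lra.
move=> i j; rewrite AE mxE (le_trans (ler_norm_sum _ _ _))//.
rewrite (@le_trans _ _ (\sum_(x < m) b%:C))//; last first.
  by rewrite sumr_const card_ord mulr_natl rmorphMn.
apply: ler_sum => x _; rewrite mul_mx_diag !mxE !normrM normcJ.
have -> : `|(d 0 x)%:C| = (d 0 x)%:C by rewrite ger0_norm// ler0c.
have dC : 0 <= (d 0 x)%:C by rewrite ler0c.
apply: (@le_trans _ _ (1 * (d 0 x)%:C * 1)).
  by apply: ler_pM; rewrite ?mulr_ge0//; apply: ler_pM.
by rewrite mul1r mulr1 lecR.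
Qed.

End HermitianMatrices.

(** * Integrals on the circle *)

Definition itg {R : realType} (f : R -> R) : Prop :=
  (@lebesgue_measure R).-integrable Tset (EFin \o f).

(** Real-valued counterpart of [intT]; [intT_itg] identifies the two for integrable functions
    only. *)
Definition IT {R : realType} (f : R -> R) : R :=
  (2 * pi)^-1 * (\int[@lebesgue_measure R]_(t in Tset) f t)%R.

Section CircleIntegral.
Variable R : realType.
Local Notation mu := (@lebesgue_measure R).
Implicit Types f g : R -> R.

Lemma pi2_gt0 : 0 < 2 * pi :> R.
Proof. by rewrite mulr_gt0// pi_gt0. Qed.

Lemma pi2V_gt0 : 0 < (2 * pi)^-1 :> R.
Proof. by rewrite invr_gt0 pi2_gt0. Qed.

Lemma measurable_T : @measurable _ (measurableTypeR R) (@Tset R).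
Proof. exact: measurable_itv. Qed.

Lemma mu_T : mu (@Tset R) = (2 * pi)%:E.
Proof. by rewrite /Tset lebesgue_measure_itv /= lte_fin pi2_gt0 oppr0 adde0. Qed.

Lemma TsetP (t : R) : Tset t <-> 0 <= t < 2 * pi.
Proof. by rewrite /Tset /= in_itv. Qed.

Lemma intT_itg f : itg f -> intT (fun t => (f t)%:E) = (IT f)%:E.
Proof.
move=> hf; rewrite /intT /IT /Rintegral EFinM fineK//.
by apply: integrable_fin_num => //; exact: measurable_T.
Qed.

Lemma itg_cts f : continuous f -> itg f.
Proof.
move=> cf; apply: (@integrableS _ _ _ mu `[0%R, (2 * pi)%R]%classic) => //.
- exact: measurable_T.
- by move=> t; rewrite /Tset /= !in_itv /= => /andP[-> /ltW].
- apply: continuous_compact_integrable; first exact: segment_compact.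
  exact: continuous_subspaceT.
Qed.

Lemma eq_itg f g : (forall t, Tset t -> f t = g t) -> itg f -> itg g.
Proof.
move=> fg; apply: eq_integrable; first exact: measurable_T.
by move=> t; rewrite inE => Tt /=; rewrite fg.
Qed.

Lemma eq_IT f g : (forall t, Tset t -> f t = g t) -> IT f = IT g.
Proof.
by move=> fg; rewrite /IT (@eq_Rintegral _ _ _ mu _ g)// => t; rewrite inE; exact: fg.
Qed.

Lemma itgD f g : itg f -> itg g -> itg (fun t => f t + g t).
Proof.
move=> hf hg; have := integrableD measurable_T hf hg.
by apply: eq_integrable => //; exact: measurable_T.
Qed.

Lemma itgZ a f : itg f -> itg (fun t => a * f t).
Proof.
move=> hf; have := integrableZl measurable_T a hf.
by apply: eq_integrable => //; exact: measurable_T.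
Qed.

Lemma itgB f g : itg f -> itg g -> itg (fun t => f t - g t).
Proof.
move=> hf hg; apply: eq_itg (itgD hf (itgZ (-1) hg)) => t _.
by rewrite mulN1r.
Qed.

Lemma itg_cst (a : R) : itg (fun=> a).
Proof. by apply: itg_cts => t; exact: cvg_cst. Qed.

Lemma itg_sum (I : finType) (F : I -> R -> R) : (forall i, itg (F i)) ->
  itg (fun t => \sum_i F i t).
Proof.
move=> hF; have := @integrable_sum _ _ _ mu _ measurable_T _ (index_enum I) xpredT _ (fun i _ => hF i).
by apply: eq_integrable; [exact: measurable_T|move=> t _ /=; rewrite sumEFin].
Qed.

Lemma ITD f g : itg f -> itg g -> IT (fun t => f t + g t) = IT f + IT g.
Proof. by move=> hf hg; rewrite /IT RintegralD ?mulrDr//; exact: measurable_T. Qed.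

Lemma ITZ a f : itg f -> IT (fun t => a * f t) = a * IT f.
Proof.
move=> hf; rewrite /IT RintegralZl; [exact: mulrCA|exact: measurable_T|exact: hf].
Qed.

Lemma ITB f g : itg f -> itg g -> IT (fun t => f t - g t) = IT f - IT g.
Proof.
move=> hf hg; rewrite /IT RintegralB; first exact: mulrBr.
- exact: measurable_T.
- exact: hf.
- exact: hg.
Qed.

Lemma IT_cst (a : R) : IT (fun=> a) = a.
Proof.
rewrite /IT Rintegral_cst; last exact: measurable_T.
by rewrite [X in fine X]mu_T /= mulrCA mulVf ?mulr1// gt_eqF// pi2_gt0.
Qed.

Lemma IT_sum (I : finType) (F : I -> R -> R) : (forall i, itg (F i)) ->
  IT (fun t => \sum_i F i t) = \sum_i IT (F i).
Proof.
move=> hF; rewrite -big_enum /=.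
have -> : IT (fun t => \sum_i F i t) = IT (fun t => \sum_(i <- enum I) F i t).
  by apply: eq_IT => t _; rewrite big_enum.
have itgs (s : seq I) : itg (fun t => \sum_(i <- s) F i t).
  elim: s => [|i s ih]; first by apply: eq_itg (itg_cst 0) => t _; rewrite big_nil.
  by apply: eq_itg (itgD (hF i) ih) => t _; rewrite big_cons.
elim: (enum I) => [|i s ih].
  by rewrite big_nil -[RHS](IT_cst 0); apply: eq_IT => t _; rewrite big_nil.
rewrite big_cons -ih -ITD//.
by apply: eq_IT => t _; rewrite big_cons.
Qed.

Lemma IT_le f g : itg f -> itg g -> (forall t, Tset t -> f t <= g t) -> IT f <= IT g.
Proof.
move=> hf hg fg; rewrite /IT ler_pM2l ?pi2V_gt0//.
by apply: le_Rintegral => //; exact: measurable_T.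
Qed.

Lemma ae_imp (P Q : R -> Prop) : (forall t, P t -> Q t) ->
  {ae mu, forall t, P t} -> {ae mu, forall t, Q t}.
Proof. by move=> PQ; apply: negligibleS => t; exact/contra_not/PQ. Qed.

Lemma ae_all (P : R -> Prop) : (forall t, P t) -> {ae mu, forall t, P t}.
Proof. by move=> h; apply: negligibleS (negligible_set0 mu) => t /(_ (h t)). Qed.

Lemma ae_and (P Q : R -> Prop) : {ae mu, forall t, P t} ->
  {ae mu, forall t, Q t} -> {ae mu, forall t, P t /\ Q t}.
Proof.
move=> hP hQ; apply: negligibleS (negligibleU hP hQ) => t /=.
by move=> /not_andP.
Qed.

Lemma measurable_continuous f (D : set R) : continuous f -> measurable_fun D f.
Proof.
by move=> cf; apply: measurable_funTS; apply: continuous_measurable_fun; exact: cf.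
Qed.

(** Inversion is continuous on the open complement of 0, and a single point is harmless. *)
Lemma measurable_invr : measurable_fun setT (fun x : R => x^-1).
Proof.
rewrite -(setUv [set 0%R : R]).
have oD : open (~` [set 0%R : R])%classic.
  by apply: closed_openC; apply: accessible_closed_set1; exact: hausdorff_accessible.
apply/measurable_funU.
- exact: measurable_set1.
- exact: open_measurable.
- split; first exact: measurable_fun_set1.
  apply: open_continuous_measurable_fun => //.
  move=> x; rewrite inE /= => /eqP x0; apply: cvgV => //; exact: cvg_id.
Qed.

Lemma IT_ae_eq0 f : itg f -> {ae mu, forall t, Tset t -> 0 <= f t} ->
  0 <= IT f /\ (IT f = 0 -> {ae mu, forall t, Tset t -> f t = 0}).
Proof.
move=> hf f0; have mf : measurable_fun Tset (EFin \o f) by case/integrableP : hf.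
have e : (\int[mu]_(t in Tset) (EFin \o f) t = \int[mu]_(t in Tset) `|(EFin \o f) t|)%E.
  apply: ae_eq_integral => //; [exact: measurable_T|exact: measurableT_comp|].
  by apply: ae_imp f0 => t h Tt /=; rewrite ger0_norm// h.
have efin : (\int[mu]_(t in Tset) (EFin \o f) t)%E \is a fin_num.
  by apply: integrable_fin_num => //; exact: measurable_T.
have e0 : (0 <= \int[mu]_(t in Tset) (EFin \o f) t)%E.
  by rewrite e; apply: integral_ge0 => t _.
split.
  by rewrite /IT mulr_ge0 ?(ltW pi2V_gt0)// /Rintegral fine_ge0.
move=> /eqP; rewrite /IT mulf_eq0 gt_eqF ?pi2V_gt0//= => /eqP h.
have : (\int[mu]_(t in Tset) `|(EFin \o f) t| = 0)%E.
  by rewrite -e -(fineK efin); congr EFin.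
move=> /(ae_eq_integral_abs mu measurable_T mf).
by apply: ae_imp => t h' Tt; have := h' Tt => -[].
Qed.

(** The equality case is what turns equal values of the functional into equality of integrands. *)
Lemma IT_ae_le f g : itg f -> itg g -> {ae mu, forall t, Tset t -> g t <= f t} ->
  IT g <= IT f /\ (IT g = IT f -> {ae mu, forall t, Tset t -> f t = g t}).
Proof.
move=> hf hg gf; have := IT_ae_eq0 (itgB hf hg).
rewrite ITB// subr_ge0 => -[].
  by apply: ae_imp gf => t h Tt; rewrite subr_ge0 h.
move=> -> h; split=> // e; have := h; rewrite e subrr => /(_ erefl).
by apply: ae_imp => t h' Tt; apply/eqP; rewrite -subr_eq0 h'.
Qed.

(** The minorant makes the negative part integrable, so integrability can only fail through an
    infinite positive part. This rules out [-oo] and indeterminate sums at boundary points. *)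
Lemma intT_dichotomy f g : measurable_fun Tset f -> itg g ->
  {ae mu, forall t, Tset t -> g t <= f t} ->
  itg f \/ intT (fun t => (f t)%:E) = +oo%E.
Proof.
move=> mf hg gf; set F := EFin \o f.
have mF : measurable_fun Tset F by exact/measurable_EFinP.
have mG : measurable_fun Tset (EFin \o g) by case/integrableP : hg.
have Fn : (\int[mu]_(t in Tset) (F^\- t) < +oo)%E.
  apply: le_lt_trans (integral_funeneg_lt_pinfty measurable_T hg).
  apply: ae_ge0_le_integral => //; try exact: measurable_T.
  - exact: measurable_funeneg.
  - exact: measurable_funeneg.
  - apply: ae_imp gf => t h Tt; rewrite !funenegE /F /=.
    by rewrite -!EFin_max lee_fin ge_max !le_max lerN2 h// lexx orbT.
have [Fp|Fp] := ltP (\int[mu]_(t in Tset) (F^\+ t))%E +oo%E.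
  left; apply/integrableP; split=> //.
  rewrite (_ : (fun x => `|F x|)%E = (fun x => F^\+ x + F^\- x)%E); last first.
    exact: fune_abse.
  rewrite ge0_integralD//; first exact: lte_add_pinfty.
  - exact: measurable_T.
  - exact: measurable_funepos.
  - exact: measurable_funeneg.
have Fn' : oppe (\int[mu]_(t in Tset) (F^\- t))%E != -oo%E.
  by apply/negP => /eqP/(congr1 oppe); rewrite oppeK /= => h; rewrite h ltxx in Fn.
right; rewrite /intT integralE.
have -> : (\int[mu]_(t in Tset) (F^\+ t) = +oo)%E by apply/eqP; rewrite eq_le Fp leey.
rewrite addye; last exact: Fn'.
by rewrite gt0_muley// lte_fin pi2V_gt0.
Qed.

(** Substitution t -> 2 pi - t, made on the closed interval, which differs from the torus by one
    point. It kills the imaginary parts of the moments. *)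
Lemma IT_odd f : continuous f -> (forall t, f (2 * pi - t) = - f t) -> IT f = 0.
Proof.
move=> cf fo; have hf := itg_cts cf.
have mf D : measurable D -> measurable_fun D (EFin \o f).
  by move=> mD; apply/measurable_EFinP; apply: measurable_continuous.
have e : (\int[mu]_(t in `[0%R, (2 * pi)%R]) (f t)%:E =
         \int[mu]_(t in `[0%R, (2 * pi)%R]) (- f t)%:E)%E.
  have D1 : derive1 (fun t : R => 2 * pi - t) = cst (-1)%R.
    apply/funext => z; rewrite derive1E deriveB// derive_cst derive_id.
    by rewrite add0r.
  have := @integration_by_substitution_decreasing R (fun t => 2 * pi - t) f 0 (2 * pi)
    (ltW pi2_gt0).
  rewrite subr0 subrr => ->.
  - apply: eq_integral => t _ /=; rewrite D1; congr EFin.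
    by rewrite /= !fctE opprK mulr1 fo.
  - by move=> x y _ _ xy; rewrite ltrD2l ltrN2.
  - by rewrite D1 => ? _; exact: cvg_cst.
  - by rewrite D1; exact: is_cvg_cst.
  - by rewrite D1; exact: is_cvg_cst.
  - have cF : continuous (fun t : R => 2 * pi - t).
      by move=> t; apply: cvgB; [exact: cvg_cst|exact: cvg_id].
    split; first by move=> x _; apply: derivableB.
    + by apply: cvg_at_right_filter; exact: cF.
    + by apply: cvg_at_left_filter; exact: cF.
  - exact: continuous_subspaceT.
have e1 : IT f = IT (fun t => - f t).
  rewrite /IT /Rintegral /Tset.
  rewrite integral_itv_bndo_bndc; last exact: mf.
  rewrite [in RHS]integral_itv_bndo_bndc; last first.
    by apply/measurable_EFinP/measurable_funN; apply: measurable_continuous.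
  by rewrite e.
have e2 : IT (fun t => - f t) = - IT f.
  rewrite -mulN1r -ITZ//; apply: eq_IT => t _; rewrite mulN1r //.
by move: e1; rewrite e2; lra.
Qed.

Lemma IT_FTC (f F : R -> R) : continuous f -> (forall t : R, is_derive t 1 F (f t)) ->
  IT f = (2 * pi)^-1 * (F (2 * pi) - F 0).
Proof.
move=> cf dF; rewrite /IT /Rintegral /Tset integral_itv_bndo_bndc; last first.
  by apply/measurable_EFinP; apply: measurable_continuous.
have cF : continuous F.
  by move=> t; apply/differentiable_continuous/derivable1_diffP; case: (dF t).
rewrite (@continuous_FTC2 R f F)//; first exact: pi2_gt0.
- exact: continuous_subspaceT.
- split.
  + by move=> x _; case: (dF x).
  + by apply: cvg_at_right_filter; exact: cF.
  + by apply: cvg_at_left_filter; exact: cF.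
- by move=> t _; rewrite derive1E; case: (dF t).
Qed.

Lemma IT_cosk (k : nat) : (0 < k)%N -> IT (fun t : R => cos (k%:R * t)) = 0.
Proof.
move=> k0; have k0' : (k%:R : R) != 0 by rewrite pnatr_eq0 -lt0n.
have dF (t : R) : is_derive t 1 (fun t => k%:R^-1 * sin (k%:R * t)) (cos (k%:R * t)).
  apply: is_derive_eq.
  by rewrite /GRing.scale /=; field.
rewrite (IT_FTC _ dF).
- rewrite mulr0 sin0 mulr0 subr0 (_ : k%:R * (2 * pi) = (0 + (pi *+ 2) *+ k)); last first.
    by rewrite add0r -[RHS]mulr_natl -[pi *+ 2]mulr_natl.
  by rewrite (periodicn (@sinD2pi R)) sin0 !mulr0.
- move=> t; apply: continuous_comp; first exact: mulrl_continuous.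
  exact: continuous_cos.
Qed.

Lemma cosB_le (x y : R) : `|cos x - cos y| <= `|x - y|.
Proof.
wlog xy : x y / y <= x => [h|].
  by have [/h//|/ltW/h] := leP y x; rewrite distrC (distrC y).
have [|c _ ->] := @MVT_segment R cos (fun t => - sin t) y x xy.
- exact/continuous_subspaceT/continuous_cos.
- by rewrite normrM normrN ler_piMl// sin_max.
Qed.

Lemma sinB_le (x y : R) : `|sin x - sin y| <= `|x - y|.
Proof.
rewrite -!cosBpihalf (le_trans (cosB_le _ _))//.
by rewrite (_ : x - pi / 2 - (y - pi / 2) = x - y)//; ring.
Qed.

(** The slope may have either sign, so that one formula serves both sides of a peak of the
    integrand. *)
Lemma int_inv_affine (a b al be : R) : a < b -> be != 0 ->
  (forall t, a <= t <= b -> 0 < al + be * t) ->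
  (\int[mu]_(t in `[a, b]) ((al + be * t)^-1)%:E =
   ((ln (al + be * b) - ln (al + be * a)) / be)%:E)%E.
Proof.
move=> ab be0 h.
have cl : continuous (fun t : R => al + be * t).
  move=> t; apply: cvgD; [exact: cvg_cst|exact: mulrl_continuous].
have dF (t : R) : a <= t <= b ->
    is_derive t 1 (fun t => be^-1 * ln (al + be * t)) ((al + be * t)^-1).
  move=> /h t0; have dl := is_derive1_ln t0.
  have l1 : is_derive t 1 (fun t : R => al + be * t) be.
    by apply: is_derive_eq; rewrite /GRing.scale /=; ring.
  have := @is_deriveZ R _ _ _ be^-1 _ _ _ (@is_derive1_comp R (@ln R) _ t _ _ dl l1).
  move=> d; apply: (@is_derive_eq _ _ _ _ _ _ _ _ d).
  by rewrite /GRing.scale /= mulrCA mulVf// mulr1.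
rewrite (@continuous_FTC2 R _ (fun t => be^-1 * ln (al + be * t)))//.
- rewrite -EFinB; congr EFin; field; exact: be0.
- apply: continuous_in_subspaceT => t; rewrite inE /= in_itv /= => tab.
  by apply: cvgV; [rewrite gt_eqF// h|exact: cl].
- have cF t : a <= t <= b -> {for t, continuous (fun t : R => be^-1 * ln (al + be * t))}.
    move=> tab; apply/differentiable_continuous/derivable1_diffP.
    by case: (dF t tab).
  split.
  + by move=> t; rewrite in_itv /= => /andP[t1 t2]; case: (dF t) => //; rewrite !ltW.
  + by apply: cvg_at_right_filter; apply: cF; rewrite lexx ltW.
  + by apply: cvg_at_left_filter; apply: cF; rewrite lexx ltW.
- move=> t; rewrite in_itv /= => /andP[t1 t2]; rewrite derive1E.
  by case: (dF t) => //; rewrite !ltW.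
Qed.

(* The integral of [1 / (mu + L |t - t0|)] over the half circle on one side of [t0]
   is [L^-1 ln (1 + L pi / mu)], which blows up as [mu] tends to [0]. *)
Lemma IT_inv_blowup (L C : R) : 0 < L -> exists2 d, 0 < d &
  forall (g : R -> R) (t0 nu : R), Tset t0 -> 0 < nu -> itg g ->
    (forall t, Tset t -> (nu + L * `|t - t0|)^-1 <= g t) -> IT g <= C -> d <= nu.
Proof.
(* Solves L^-1 ln (1 + L pi / nu) <= 2 pi C for [nu], after dropping the 1; the factor 2 pi undoes
   the normalization of [IT]. *)
move=> L0; exists (L * pi * expR (- (2 * pi * (L * C)))).
  by rewrite !mulr_gt0 ?expR_gt0 ?pi_gt0.
move=> g t0 nu Tt0 nu0 hg hle hC.
pose h (t : R) := (nu + L * `|t - t0|)^-1.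
have hpos t : 0 < nu + L * `|t - t0|.
  by rewrite ltr_wpDr// mulr_ge0// ltW.
have ch : continuous h.
  move=> t; apply: cvgV; first by rewrite gt_eqF.
  apply: cvgD; first exact: cvg_cst.
  apply: cvgM; first exact: cvg_cst.
  by apply: cvg_norm; apply: cvgB; [exact: cvg_id|exact: cvg_cst].
have hC' : IT h <= C.
  by apply: le_trans hC; apply: IT_le => //; exact: itg_cts.
have pi0 := @pi_gt0 R.
have key : (((ln (nu + L * pi) - ln nu) / L)%:E <= (2 * pi * IT h)%:E)%E.
  have -> : ((2 * pi * IT h)%:E = \int[mu]_(t in Tset) (h t)%:E)%E.
    rewrite /IT mulrA mulfV ?gt_eqF ?pi2_gt0// mul1r /Rintegral fineK//.
    by apply: integrable_fin_num; [exact: measurable_T|exact: itg_cts].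
  have sub a b : a < b -> 0 <= a -> b <= 2 * pi ->
      (\int[mu]_(t in `[a, b]) (h t)%:E <= \int[mu]_(t in Tset) (h t)%:E)%E.
    move=> ab a0 b1; rewrite -integral_itv_bndo_bndc; last first.
      by apply/measurable_EFinP; apply: measurable_continuous.
    apply: ge0_subset_integral => //.
    - exact: measurable_T.
    - by apply/measurable_EFinP; apply: measurable_continuous.
    - by move=> t _; rewrite lee_fin invr_ge0 ltW.
    - move=> t /=; rewrite in_itv /= => /andP[at_ tb].
      by apply/TsetP; rewrite (le_trans a0 at_) (lt_le_trans tb b1).
  have /TsetP/andP[t00 t01] := Tt0.
  (* One of the half circles [t0, t0 + pi] and [t0 - pi, t0] lies inside [0, 2 pi], so no
     periodicity is involved. *)
  have [t0pi|pit0] := leP t0 pi.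
    apply: le_trans (sub t0 (t0 + pi) _ _ _); [|lra|lra|lra].
    have -> : (\int[mu]_(t in `[t0, (t0 + pi)%R]) (h t)%:E =
        \int[mu]_(t in `[t0, (t0 + pi)%R]) ((nu - L * t0 + L * t)^-1)%:E)%E.
      apply: eq_integral => t; rewrite inE /= in_itv /= => /andP[t1 t2]; rewrite /h ger0_norm ?subr_ge0//.
      by congr (_^-1)%:E; ring.
    rewrite int_inv_affine; [|lra|by rewrite gt_eqF|]; last first.
      move=> t /andP[t1 t2]; have := hpos t; rewrite ger0_norm ?subr_ge0//; lra.
    rewrite lee_fin ler_pM2r ?invr_gt0//.
    rewrite (_ : nu - L * t0 + L * (t0 + pi) = nu + L * pi); last by ring.
    by rewrite (_ : nu - L * t0 + L * t0 = nu)//; ring.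
  apply: le_trans (sub (t0 - pi) t0 _ _ _); [|lra|lra|lra].
  have -> : (\int[mu]_(t in `[(t0 - pi)%R, t0]) (h t)%:E =
      \int[mu]_(t in `[(t0 - pi)%R, t0]) ((nu + L * t0 + (- L) * t)^-1)%:E)%E.
    apply: eq_integral => t; rewrite inE /= in_itv /= => /andP[t1 t2].
    rewrite /h distrC ger0_norm ?subr_ge0//.
    by congr (_^-1)%:E; ring.
  rewrite int_inv_affine; [|lra|by rewrite oppr_eq0 gt_eqF|]; last first.
    move=> t /andP[t1 t2]; have := hpos t; rewrite distrC ger0_norm ?subr_ge0//; lra.
  rewrite (_ : nu + L * t0 + - L * (t0 - pi) = nu + L * pi); last by ring.
  rewrite (_ : nu + L * t0 + - L * t0 = nu); last by ring.
  by rewrite invrN mulrN -mulNr opprB lexx.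
rewrite lee_fin in key.
have key2 : ln (nu + L * pi) - ln nu <= 2 * pi * (L * C).
  rewrite ler_pdivrMr// in key; apply: (le_trans key).
  rewrite (_ : _ * L = 2 * pi * (L * IT h)); last by ring.
  by rewrite ler_pM2l ?pi2_gt0// ler_pM2l.
have Lpi : 0 < L * pi by rewrite mulr_gt0.
have : (nu + L * pi) / nu <= expR (2 * pi * (L * C)).
  by rewrite -[leLHS]lnK ?posrE ?divr_gt0 ?addr_gt0// ler_expR ln_div ?posrE ?addr_gt0.
rewrite ler_pdivrMr// => k3.
rewrite expRN ler_pdivrMr ?expR_gt0// [leRHS]mulrC; apply: le_trans k3.
by rewrite lerDr ltW.
Qed.

End CircleIntegral.

(** * Minimization over closed convex sets *)

(* A closed convex set presented as an intersection of closed half-spaces, so that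
   closedness is stable under arbitrary intersections by construction. *)
Definition halfspaces {R : realType} (I : finType) (K : (I -> R) -> Prop) : Prop :=
  exists (A : Type) (l : A -> I -> R) (b : A -> R),
    forall x, K x <-> forall a, b a <= \sum_i l a i * x i.

Section ConvexMinimization.
Variables (R : realType) (I : finType).
Implicit Types (K : (I -> R) -> Prop).

(** The constraints of all members are pooled over a sigma type; the presentations, being
    existential, are chosen by [cid]. *)
Lemma halfspaces_all (A : Type) (K : A -> (I -> R) -> Prop) :
  (forall a, halfspaces (K a)) -> halfspaces (fun x => forall a, K a x).
Proof.
move=> h0; pose A' a := sval (cid (h0 a)); pose hA a := svalP (cid (h0 a)).
pose l a := sval (cid (hA a)); pose hl a := svalP (cid (hA a)).
pose b a := sval (cid (hl a)); pose h a := svalP (cid (hl a)).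
exists {a : A & A' a}, (fun u => l (projT1 u) (projT2 u)),
  (fun u => b (projT1 u) (projT2 u)) => x; split.
  by move=> Kx -[a a'] /=; exact: (h a x).1.
by move=> Kx a; apply/h => a'; exact: (Kx (existT _ a a')).
Qed.

Lemma halfspaces_and K1 K2 : halfspaces K1 -> halfspaces K2 ->
  halfspaces (fun x => K1 x /\ K2 x).
Proof.
move=> h1 h2.
have /halfspaces_all[A [l [b h]]] : forall c : bool, halfspaces (if c then K1 else K2).
  by case.
exists A, l, b => x; split => [[k1 k2]|/h k]; first by apply/h; case.
by split; [exact: (k true)|exact: (k false)].
Qed.

Lemma halfspaces_imp (P : Prop) K : halfspaces K -> halfspaces (fun x => P -> K x).
Proof. by move=> h; exact: (@halfspaces_all P (fun=> K)). Qed.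

Lemma halfspaces1 (l : I -> R) (b : R) : halfspaces (fun x => b <= \sum_i l i * x i).
Proof. by exists unit, (fun=> l), (fun=> b) => x; split => // /(_ tt). Qed.

Lemma halfspaces_eq K1 K2 : (forall x, K1 x <-> K2 x) -> halfspaces K1 -> halfspaces K2.
Proof.
move=> e [A [l [b h]]]; exists A, l, b => x.
by split => [/e/h//|/h/e].
Qed.

Lemma sum_delta (x : I -> R) i : \sum_j (j == i)%:R * x j = x i.
Proof.
rewrite (bigD1 i)//= eqxx mul1r big1 ?addr0// => j /negPf ->.
by rewrite mul0r.
Qed.

Lemma halfspaces_ge i (b : R) : halfspaces (fun x : I -> R => b <= x i).
Proof.
apply: halfspaces_eq (halfspaces1 (fun j => (j == i)%:R) b) => x.
by rewrite sum_delta.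
Qed.

Lemma halfspaces_le i (b : R) : halfspaces (fun x : I -> R => x i <= b).
Proof.
apply: halfspaces_eq (halfspaces1 (fun j => - (j == i)%:R) (- b)) => x.
under eq_bigr do rewrite mulNr.
by rewrite sumrN sum_delta lerN2.
Qed.

Lemma halfspaces_eqc i (b : R) : halfspaces (fun x : I -> R => x i = b).
Proof.
apply: halfspaces_eq (halfspaces_and (halfspaces_ge i b) (halfspaces_le i b)) => x.
split=> [[h1 h2]|->//]; by apply/eqP; rewrite eq_le h1 h2.
Qed.

Lemma continuous_linear_form (l : I -> R) (s : seq I) :
  continuous (fun v : 'rV[R]_#|I| => \sum_(i <- s) l i * v 0 (enum_rank i)).
Proof.
elim: s => [|i s ih] v.
  rewrite (_ : (fun _ => _) = fun=> 0); first exact: cst_continuous.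
  by apply/funext => w; rewrite big_nil.
rewrite (_ : (fun _ => _) = fun w : 'rV[R]_#|I| => l i * w 0 (enum_rank i) +
   \sum_(i <- s) l i * w 0 (enum_rank i)); last by apply/funext => w; rewrite big_cons.
apply: (@continuousD R R 'rV[R]_#|I| (fun w => l i * w 0 (enum_rank i))); last exact: ih.
apply: (@continuousM R 'rV[R]_#|I| (fun=> l i)); first exact: cst_continuous.
exact: coord_continuous.
Qed.

(* [J] is not assumed continuous: an affine minorant touching [J] at each point of [K]
   makes it lower semicontinuous there. *)
Lemma lsc_min_exists K (J : (I -> R) -> R) (B : R) x0 : 0 <= B -> halfspaces K -> K x0 ->
  (forall x, K x -> forall i, `|x i| <= B) ->
  (forall xh, K xh -> exists g : I -> R, forall x, K x ->
    J xh + \sum_i g i * (x i - xh i) <= J x) ->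
  exists2 xh, K xh & forall x, K x -> J xh <= J x.
Proof.
move=> B0 [A [l [b hK]]] Kx0 KB sub.
pose dec (v : 'rV[R]_#|I|) : I -> R := fun i => v 0 (enum_rank i).
have decK (x : I -> R) : dec (\row_i x (enum_val i)) = x.
  by apply/funext => i; rewrite /dec mxE enum_rankK.
pose Kv := [set v | K (dec v)]%classic.
have cKv : compact Kv.
  apply: bounded_closed_compact.
    exists B; split; first exact: num_real.
    move=> M BM v /KB Kvb; rewrite /Num.norm /= mx_normrE.
    apply/bigmax_leP; split.
      by rewrite (le_trans B0 (ltW BM)).
    move=> [i j] _ /=; rewrite ord1 (le_trans _ (ltW BM))//.
    by have := Kvb (enum_val j); rewrite /dec enum_valK.
  have -> : Kv = (\bigcap_(a in [set: A])
      [set v | b a <= \sum_i l a i * dec v i])%classic.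
    apply/seteqP; split=> v /=.
      by move=> /hK Ka a _; exact: Ka.
    by move=> Ka; apply/hK => a; exact: Ka.
  apply: closed_bigI => a _.
  apply: (@closed_comp _ _ (fun v => \sum_i l a i * dec v i) [set y | b a <= y]%classic).
    by move=> v _; exact: continuous_linear_form.
  exact: closed_ge.
(* Sublevel sets at points of [Kv] are nested, hence form a filter base; compactness yields a
   cluster point [c], the candidate minimizer. *)
pose F := filter_from Kv (fun z => [set v | Kv v /\ J (dec v) <= J (dec z)])%classic.
have Kv0 : Kv (\row_i x0 (enum_val i)) by rewrite /Kv /= decK.
have FF : ProperFilter F.
  apply: filter_from_proper.
    apply: filter_from_filter; first by exists (\row_i x0 (enum_val i)).
    move=> z1 z2 K1 K2; have [le12|/ltW le21] := leP (J (dec z1)) (J (dec z2)).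
      by exists z1 => // v [Kvv le1]; do 2 split => //; exact: le_trans le1 le12.
    by exists z2 => // v [Kvv le2]; do 2 split => //; exact: le_trans le2 le21.
  by move=> z Kz; exists z.
have FK : F Kv by exists (\row_i x0 (enum_val i)) => // v [].
have [c [Kc clc]] := cKv F FF FK.
exists (dec c) => // x Kx.
rewrite leNgt; apply/negP => lt_x.
(* If [J] were smaller at [x], the affine minorant at [c] would exceed [J x] near [c], where points
   of the sublevel set of [x] accumulate. *)
have [g hg] := sub _ Kc.
pose G (v : 'rV[R]_#|I|) := \sum_i g i * dec v i - \sum_i g i * dec c i.
have cG : continuous G.
  move=> v; apply: (@continuousB R R 'rV[R]_#|I| (fun v => \sum_i g i * dec v i)).
    exact: continuous_linear_form.
  exact: cst_continuous.
have Gc : G c = 0 by rewrite /G subrr.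
have nb : nbhs c [set v | J x - J (dec c) < G v]%classic.
  have nG : nbhs (G c) [set y | J x - J (dec c) < y]%classic.
    by rewrite Gc; apply: lt_nbhsr; rewrite subr_lt0.
  exact: (cG c _ nG).
have FA : F [set v | Kv v /\ J (dec v) <= J x]%classic.
  by exists (\row_i x (enum_val i)); rewrite /Kv /= decK.
have [v [[Kvv le_v] /= lt_v]] := clc _ _ FA nb.
have := hg _ Kvv.
rewrite (_ : \sum_i g i * (dec v i - dec c i) = G v); first lra.
by rewrite /G -sumrB; apply: eq_bigr => i _; rewrite mulrBr.
Qed.

(** The bound 1 / (1 + sum of the inverses) plays the role of a minimum and stays positive when the
    family is empty. *)
Lemma uniform_pos (T : finType) (P : T -> R -> Prop) :
  (forall i k k', P i k -> k' <= k -> P i k') ->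
  (forall i, exists2 k, 0 < k & P i k) -> exists2 k, 0 < k & forall i, P i k.
Proof.
move=> mono h.
have /choice[k hk] : forall i, exists k, 0 < k /\ P i k.
  by move=> i; have [k k0 Pk] := h i; exists k.
have s0 : 0 < 1 + \sum_i (k i)^-1.
  by rewrite ltr_pwDl// sumr_ge0// => i _; rewrite invr_ge0 ltW//; case: (hk i).
exists ((1 + \sum_i (k i)^-1)^-1); first by rewrite invr_gt0.
move=> i; have [ki Pi] := hk i; apply: mono Pi _.
rewrite -[leRHS]invrK lef_pV2 ?posrE ?invr_gt0//.
rewrite (bigD1 i)//= addrCA lerDl addr_ge0// sumr_ge0// => j _.
by rewrite invr_ge0 ltW//; case: (hk j).
Qed.

(** The unit sphere of the max norm is not convex, but it is a finite union of faces of the cube,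
    one for each coordinate and sign. [K' u] is the part of the cone on such a face, compact and
    convex, where the form has a positive minimum; homogeneity does the rest. *)
Lemma cone_coercive K (l : I -> R) : halfspaces K ->
  (forall x a, K x -> 0 <= a -> K (fun i => a * x i)) ->
  (forall x i, K x -> x i != 0 -> 0 < \sum_j l j * x j) ->
  exists2 k, 0 < k & forall x, K x -> forall i, k * `|x i| <= \sum_j l j * x j.
Proof.
move=> hK coneK posK.
pose sg (c : bool) : R := if c then 1 else -1.
pose K' (u : I * bool) (x : I -> R) :=
  K x /\ ((forall j, x j <= 1) /\ (forall j, -1 <= x j)) /\ 1 <= sg u.2 * x u.1.
have hK' u : halfspaces (K' u).
  apply: halfspaces_and => //; apply: halfspaces_and.
    by apply: halfspaces_and; apply: halfspaces_all => j;
      [exact: halfspaces_le|exact: halfspaces_ge].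
  apply: halfspaces_eq (halfspaces1 (fun j => sg u.2 * (j == u.1)%:R) 1) => x.
  under eq_bigr do rewrite -mulrA.
  by rewrite -mulr_sumr sum_delta.
have [k k0 hk] : exists2 k, 0 < k &
    forall u x, K' u x -> k <= \sum_j l j * x j.
  apply: (@uniform_pos _ (fun u k => forall x, K' u x -> k <= \sum_j l j * x j)).
    by move=> u k k' Pk k'k x /Pk; exact: le_trans.
  (* On a face that misses the cone any positive constant will do. *)
  move=> u; have [[x0 Kx0]|no] := pselect (exists x, K' u x); last first.
    by exists 1 => // x Kx; exfalso; apply: no; exists x.
  have [//||xh Kh minh] := @lsc_min_exists (K' u) (fun x => \sum_j l j * x j) 1 x0 ler01 (hK' u) Kx0.
  - by move=> x [_ [[h1 h2] _]] i; rewrite ler_norml h1 h2.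
  - move=> xh _; exists l => x _.
    rewrite -subr_ge0 opprD addrA -sumrB -sumrB sumr_ge0// => i _.
    by rewrite -!mulrBr subrr mulr0.
  - exists (\sum_j l j * xh j) => //; have [Kxh [_ h1]] := Kh.
    apply: (@posK _ u.1) => //; apply/eqP => e.
    by move: h1; rewrite e mulr0 ler10.
exists k => // x Kx i.
have [->|xi0] := eqVneq (x i) 0.
  rewrite normr0 mulr0.
  have [j xj|z] := pickP (fun j => x j != 0); first exact: ltW (posK _ _ Kx xj).
  by rewrite big1// => j _; move: (z j) => /negbFE/eqP ->; rewrite mulr0.
have [j0 hj0] : exists j0, forall j, `|x j| <= `|x j0|.
  have [j0 _ h] := @arg_maxP _ _ I i xpredT (fun j => `|x j|) isT.
  by exists j0 => j; exact: h.
set M := `|x j0|; have M0 : 0 < M by apply: lt_le_trans (hj0 i); rewrite normr_gt0.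
have Ky : K' (j0, 0 <= x j0) (fun i => M^-1 * x i).
  split; first by apply: coneK => //; rewrite invr_ge0 ltW.
  split.
    have nM j : `|M^-1 * x j| <= 1.
      rewrite normrM ger0_norm ?invr_ge0 ?(ltW M0)// mulrC ler_pdivrMr// mul1r.
      exact: hj0.
    by split => j; have := nM j; rewrite ler_norml => /andP[].
  rewrite /= mulrCA ler_pdivlMl// mulr1 /sg /M.
  by case: ifP => h; [rewrite mul1r ger0_norm|rewrite mulN1r ler0_norm// ltW// ltNge h].
have := hk _ _ Ky.
under eq_bigr do rewrite mulrCA.
rewrite -mulr_sumr ler_pdivlMl//; apply: le_trans.
by rewrite mulrC ler_pM2r//; exact: hj0.
Qed.

End ConvexMinimization.

(** * Trigonometric polynomials *)

(* Unlike [peval], whose constant term is [1], [pe] uses the coefficient [p 0] and is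
   therefore linear in [p]. *)
Definition pe {R : realType} {n : nat} (p : 'I_n.+1 -> R) (t : R) : R :=
  \sum_k p k * cos (k%:R * t).

Section TrigPolynomials.
Variables (R : realType) (n m : nat).
Local Notation mu := (@lebesgue_measure R).
Implicit Types (Q : 'I_n.+1 -> 'M[R]_m) (p : 'I_n.+1 -> R).

Lemma expi0 : expi (0 : R) = 1.
Proof. by rewrite /expi cos0 sin0. Qed.

Lemma expiN (t : R) : expi (- t) = (expi t)^*.
Proof. by rewrite /expi cosN sinN. Qed.

Lemma expiD (s t : R) : expi (s + t) = expi s * expi t.
Proof. by rewrite /expi cosD sinD; apply/eqP; rewrite eq_complex /= addrC eqxx /= addrC. Qed.

Lemma expiMn (k : nat) (t : R) : expi (k%:R * t) = expi t ^+ k.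
Proof.
elim: k => [|k ih]; first by rewrite mul0r expi0 expr0.
by rewrite exprS -ih -expiD; congr expi; rewrite -natr1; ring.
Qed.

Lemma expi_conjM (t : R) : expi t * conjc (expi t) = 1.
Proof. by rewrite -expiN -expiD subrr expi0. Qed.

Lemma expi_neq0 (t : R) : expi t != 0.
Proof.
by apply/eqP => e; have := expi_conjM t; rewrite e mul0r => /eqP; rewrite eq_sym oner_eq0.
Qed.

Lemma expi_2pi (k : nat) (t : R) : expi (k%:R * (2 * pi - t)) = (expi (k%:R * t))^*.
Proof.
rewrite -expiN mulrBr expiD (_ : k%:R * (2 * pi) = 0 + (pi *+ 2) *+ k); last first.
  by rewrite add0r -[RHS]mulr_natl -[pi *+ 2]mulr_natl.
rewrite {1}/expi (periodicn (@sinD2pi R)) (periodicn (@cosD2pi R)) sin0 cos0.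
by rewrite mul1r.
Qed.

(** For 0 < t - s < 2 pi, 1 - cos (t - s) = 2 sin^2 ((t - s) / 2) is positive. *)
Lemma expi_inj (s t : R) : Tset s -> Tset t -> expi s = expi t -> s = t.
Proof.
move=> /TsetP/andP[s0 s1] /TsetP/andP[t0 t1].
wlog st : s t s0 s1 t0 t1 / s <= t => [h e|].
  by have [/h|/ltW/h] := leP s t; [apply|move=> h'; apply/esym/h'].
move=> [ec es]; apply/eqP; rewrite eq_le st /= leNgt; apply/negP => lt_st.
have c1 : cos (t - s) = 1 by rewrite cosB -ec -es -!expr2 cos2Dsin2.
pose u := (t - s) / 2.
have u0 : 0 < u < pi by apply/andP; split; rewrite /u; lra.
have : cos (u *+ 2) = 1 - sin u ^+ 2 *+ 2 by rewrite cos_mulr2n cos2sin2; ring.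
rewrite (_ : u *+ 2 = t - s) ?c1; last by rewrite /u -mulr_natr; field.
have := sin_gt0_pi u0 => su e.
have : 0 < sin u ^+ 2 by rewrite exprn_gt0.
by move: e; rewrite -mulr_natr; lra.
Qed.

Lemma halfC : (2^-1 : R[i]) = (2^-1 : R)%:C.
Proof. by rewrite fmorphV rmorph_nat. Qed.

Lemma expi_addN (t : R) : expi (- t) + expi t = (2 * cos t)%:C.
Proof. by apply/eqP; rewrite eq_complex /= cosN sinN addNr eqxx andbT; apply/eqP; ring. Qed.

Lemma peval_pe p t : p ord0 = 1 -> peval p t = pe p t.
Proof.
move=> p0; rewrite /peval /pevalC halfC cReD cReZ cRe_sum /pe.
rewrite [RHS]big_ord_recl p0 mul0r cos0 mulr1; congr (_ + _).
rewrite [in LHS]big_mkcond big_ord_recl /= add0r mulr_sumr; apply: eq_bigr => k _.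
by rewrite /= cosN; field.
Qed.

Lemma continuous_sum_fun (I : Type) (s : seq I) (F : I -> R -> R) :
  (forall i, continuous (F i)) -> continuous (fun t => \sum_(i <- s) F i t).
Proof.
move=> cF; elim: s => [|i s ih].
  rewrite (_ : (fun _ => _) = fun=> 0); first by move=> t; exact: cvg_cst.
  by apply/funext => t; rewrite big_nil.
rewrite (_ : (fun _ => _) = fun t => F i t + \sum_(i <- s) F i t).
  by move=> t; apply: cvgD; [exact: cF|exact: ih].
by apply/funext => t; rewrite big_cons.
Qed.

Lemma continuous_cosk (k : nat) : continuous (fun t : R => cos (k%:R * t)).
Proof.
by move=> t; apply: continuous_comp; [exact: mulrl_continuous|exact: continuous_cos].
Qed.

Lemma continuous_sink (k : nat) : continuous (fun t : R => sin (k%:R * t)).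
Proof.
by move=> t; apply: continuous_comp; [exact: mulrl_continuous|exact: continuous_sin].
Qed.

Lemma pe_cts p : continuous (pe p).
Proof.
apply: continuous_sum_fun => k t; apply: cvgM; first exact: cvg_cst.
exact: continuous_cosk.
Qed.

Lemma pe_2pi p t : pe p (2 * pi - t) = pe p t.
Proof.
apply: eq_bigr => k _; congr (_ * _).
by have := expi_2pi k t => -[->].
Qed.

Definition Qsym Q := (Q ord0)^T = Q ord0.

(** A symmetric [Q ord0] splits into two halves that form the term k = 0, so the sum has no
    exceptional index. All later work on [Qeval] goes through this form, linear in the
    coefficients. *)
Lemma Qeval_entry Q t j h : Qsym Q -> Qeval Q t j h = (2^-1)%:C *
  \sum_(k < n.+1) (expi (- (k%:R * t)) * (Q k j h)%:C + expi (k%:R * t) * (Q k h j)%:C).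
Proof.
move=> Qs; rewrite /Qeval !mxE halfC [in RHS]big_ord_recl mul0r oppr0 expi0 mulrDr.
congr (_ + _).
  rewrite !mul1r; have -> : Q ord0 h j = Q ord0 j h by rewrite -{1}Qs mxE.
  by rewrite -!rmorphD -rmorphM; congr (_%:C); field.
congr (_ * _); rewrite [in LHS]big_mkcond summxE big_ord_recl /= mxE add0r.
by apply: eq_bigr => k _; rewrite !mxE.
Qed.

Opaque Qeval.

Lemma conjcZ (a : R) (z : R[i]) : conjc (a%:C * z) = a%:C * conjc z.
Proof. by case: z => x y; apply/eqP; rewrite eq_complex /= !mul0r !subr0 !addr0 mulrN !eqxx. Qed.

Lemma Qeval_herm Q t : Qsym Q -> adjC (Qeval Q t) = Qeval Q t.
Proof.
move=> Qs; apply/matrixP => j h; rewrite adjCE (Qeval_entry t h j Qs) (Qeval_entry t j h Qs).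
rewrite conjcZ; congr (_ * _); rewrite (rmorph_sum conjc); apply: eq_bigr => k _.
rewrite expiN; move: (expi (k%:R * t)) => [a b]; apply/eqP; rewrite eq_complex /=.
by apply/andP; split; apply/eqP; ring.
Qed.

Lemma Qeval_2pi Q t : Qsym Q -> Qeval Q (2 * pi - t) = map_mx conjc (Qeval Q t).
Proof.
move=> Qs; apply/matrixP => j h; rewrite [RHS]mxE.
rewrite [X in conjc X](Qeval_entry t j h Qs) [LHS](Qeval_entry (2 * pi - t) j h Qs).
rewrite conjcZ; congr (_ * _); rewrite (rmorph_sum conjc); apply: eq_bigr => k _.
rewrite !expiN expi_2pi; move: (expi (k%:R * t)) => [a b]; apply/eqP; rewrite eq_complex /=.
by apply/andP; split; apply/eqP; ring.
Qed.

(* For hermitian [Phi] the entries [(j, h)] and [(h, j)] of [Q(t) Phi] contribute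
   conjugate terms, so only [Re (e^{ikt} Phi_jh)] survives. *)
Lemma tr_Qeval Q t (Phi : 'M[R[i]]_m) : Qsym Q -> adjC Phi = Phi ->
  complex.Re (\tr (Qeval Q t *m Phi)) =
  \sum_k \sum_j \sum_h Q k j h * complex.Re (expi (k%:R * t) * Phi j h).
Proof.
move=> Qs hP.
have PE j h : Phi h j = (Phi j h)^* by rewrite -{1}hP adjCE.
pose F k j h := Q k j h * complex.Re (expi (k%:R * t) * Phi j h).
have e j h : complex.Re (Qeval Q t j h * Phi h j) =
    \sum_(k < n.+1) (2^-1 * F k j h + 2^-1 * F k h j).
  rewrite Qeval_entry// -mulrA cReZ mulr_suml cRe_sum mulr_sumr.
  apply: eq_bigr => k _; rewrite -mulrDr /F (PE j h) expiN.
  move: (expi _) (Phi j h) => [a b] [c d] /=; ring.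
transitivity (\sum_j \sum_h \sum_(k < n.+1) (2^-1 * F k j h + 2^-1 * F k h j)).
  rewrite /mxtrace cRe_sum; apply: eq_bigr => j _; rewrite mxE cRe_sum.
  by apply: eq_bigr => h _; exact: e.
transitivity (\sum_(k < n.+1) \sum_j \sum_h (2^-1 * F k j h + 2^-1 * F k h j)).
  rewrite [RHS]exchange_big; apply: eq_bigr => j _; exact: exchange_big.
apply: eq_bigr => k _.
transitivity (\sum_j \sum_h 2^-1 * F k j h + \sum_j \sum_h 2^-1 * F k h j).
  by rewrite -big_split; apply: eq_bigr => j _; rewrite -big_split.
rewrite [X in _ + X]exchange_big -big_split; apply: eq_bigr => j _ /=.
by rewrite -big_split; apply: eq_bigr => h _ /=; rewrite /F; field.
Qed.

(** The form is the trace of [Qeval Q t] against the hermitian matrix [v *m adjC v]. For fixed [t]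
    and [v] it is linear in [Q], so positivity is a family of half-spaces. *)
Lemma qf_Qeval Q t v : Qsym Q -> qf (Qeval Q t) v =
  \sum_k \sum_j \sum_h Q k j h * complex.Re (expi (k%:R * t) * (v j 0 * conjc (v h 0))).
Proof.
move=> Qs; rewrite /qf -mulmxA.
have -> : ((adjC v *m (Qeval Q t *m v)) 0 0) = \tr (Qeval Q t *m (v *m adjC v)).
  by rewrite -trace_mx11 mxtrace_mulC -mulmxA.
rewrite tr_Qeval//; last by rewrite adjC_mul adjCK.
by do 3 (apply: eq_bigr => ? _); rewrite mxE big_ord1 adjCE.
Qed.

(** There are finitely many roots, and [expi] is injective on the torus, so the exceptional set is
    finite. *)
Lemma null_zeros (P : {poly R[i]}) : P != 0 ->
  {ae mu, forall t, Tset t -> P.[expi t] != 0}.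
Proof.
move=> P0; suff : mu.-negligible [set t : R | Tset t /\ root P (expi t)].
  by apply: negligibleS => t /= /not_implyP[Tt /negP]; rewrite negbK.
have [rs hrs] : exists rs : seq R[i], forall z, root P z -> z \in rs.
  have [k] := ubnP (size P); elim: k P P0 => // k ih P P0 sP.
  have [[z rz]|no] := pselect (exists z, root P z); last first.
    by exists [::] => z rz; exfalso; apply: no; exists z.
  have /factor_theorem[q qE] := rz.
  have q0 : q != 0 by apply: contraNneq P0 => q0; rewrite qE q0 mul0r.
  have [|rs hrs] := ih q q0.
    by move: sP; rewrite qE size_Mmonic ?monicXsubC// size_XsubC addn2.
  exists (z :: rs) => w; rewrite qE rootM root_XsubC inE => /orP[/hrs ->|->//].
  by rewrite orbT.
have fin : finite_set [set t : R | Tset t /\ root P (expi t)].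
  pose g z := xget 0 [set t : R | Tset t /\ expi t = z]%classic.
  apply: (@sub_finite_set _ _ (g @` [set` rs])%classic); last first.
    by apply: finite_image; exact: finite_seq.
  move=> t [Tt /hrs rt]; exists (expi t) => //; rewrite /g; case: xgetP => [s _ [Ts e]|/(_ t)].
    exact: expi_inj.
  by case.
have c0 := finite_set_countable fin.
exists [set t : R | Tset t /\ root P (expi t)]%classic; split => //.
  exact: countable_measurable.
exact: countable_lebesgue_measure0.
Qed.

(* [e^{int}] times a trigonometric polynomial is an ordinary polynomial in [e^{it}]. *)
Definition laurent (a b : 'I_n.+1 -> R[i]) : {poly R[i]} :=
  \sum_k (a k *: 'X^(n - k) + b k *: 'X^(n + k)).

Lemma laurentE a b t : (laurent a b).[expi t] =
  expi t ^+ n * \sum_(k < n.+1) (expi (- (k%:R * t)) * a k + expi (k%:R * t) * b k).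
Proof.
rewrite /laurent horner_sum mulr_sumr; apply: eq_bigr => k _.
rewrite hornerD !hornerZ !hornerXn mulrDr expiN expiMn exprD.
congr (_ + _); last by ring.
have kn : (k <= n)%N by rewrite -ltnS.
rewrite (_ : expi t ^+ n = expi t ^+ (n - k) * expi t ^+ k); last by rewrite -exprD subnK.
rewrite (rmorphXn conjc) -mulrA (mulrA (expi t ^+ k)) -exprMn expi_conjM.
by rewrite expr1n mul1r mulrC.
Qed.

(** The exponents n - k never exceed n, so above degree n only [b] contributes. *)
Lemma laurent_coef a b (k : 'I_n.+1) : (0 < k)%N -> (laurent a b)`_(n + k) = b k.
Proof.
move=> k0; rewrite /laurent coef_sum (bigD1 k)//= big1 => [|j jk].
  rewrite coefD !coefZ !coefXn eqxx mulr1 addr0.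
  by rewrite (_ : (_ == _)%N = false) ?mulr0 ?add0r//; apply/eqP; lia.
rewrite coefD !coefZ !coefXn (_ : (n + k == n - j)%N = false) ?mulr0 ?add0r; last by apply/eqP; lia.
rewrite (_ : (n + k == n + j)%N = false) ?mulr0//.
by rewrite eqn_add2l eq_sym; apply/negbTE.
Qed.

Lemma laurent_coef0 a b : (laurent a b)`_n = a ord0 + b ord0.
Proof.
rewrite /laurent coef_sum (bigD1 ord0)//= big1 => [|j j0].
  by rewrite coefD !coefZ !coefXn subn0 addn0 eqxx !mulr1 addr0.
have jp : (0 < j)%N by rewrite lt0n.
have jn : (j < n.+1)%N by [].
rewrite coefD !coefZ !coefXn (_ : (n == n - j)%N = false) ?mulr0 ?add0r; last by apply/eqP; lia.
by rewrite (_ : (n == n + j)%N = false) ?mulr0//; apply/eqP; lia.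
Qed.

Lemma ae_interval_poly0 (P : {poly R[i]}) (u v : R) : 0 <= u -> u < v -> v <= 2 * pi ->
  {ae mu, forall t, u < t < v -> P.[expi t] = 0} -> P = 0.
Proof.
move=> u0 uv v1 hP; apply/eqP; apply: contraT => /null_zeros hz.
have := ae_and hP hz => -[N [mN N0 sub]].
have : (mu `]u, v[%classic <= mu N)%E.
  apply: le_measure; rewrite ?inE//.
  move=> t /=; rewrite in_itv /= => tuv; apply: sub => /= -[h1 h2].
  have Tt : Tset t.
    by apply/TsetP; case/andP: tuv => t1 t2; rewrite (le_trans u0 (ltW t1)) (lt_le_trans t2 v1).
  by have := h2 Tt; rewrite (h1 tuv) eqxx.
rewrite N0 lebesgue_measure_itv /= lte_fin uv -EFinD lee_fin; lra.
Qed.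

(** At degree n the two families meet, hence only the sum of the constant coefficients can be
    recovered. *)
Lemma ae_laurent0 (a b : 'I_n.+1 -> R[i]) (u v : R) : 0 <= u -> u < v -> v <= 2 * pi ->
  {ae mu, forall t, u < t < v ->
    \sum_(k < n.+1) (expi (- (k%:R * t)) * a k + expi (k%:R * t) * b k) = 0} ->
  a ord0 + b ord0 = 0 /\ forall k : 'I_n.+1, (0 < k)%N -> b k = 0.
Proof.
move=> u0 uv v1 h.
have e : laurent a b = 0.
  apply: (ae_interval_poly0 u0 uv v1); apply: ae_imp h => t h tuv.
  by rewrite laurentE h// mulr0.
split; first by rewrite -laurent_coef0 e coef0.
by move=> k k0; rewrite -(laurent_coef a b k0) e coef0.
Qed.

(** For k = 0 the entries (j, h) and (h, j) appear only through their sum; the symmetry of [Q ord0]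
    separates them. *)
Lemma ae_Qeval0 Q (u v : R) : Qsym Q -> 0 <= u -> u < v -> v <= 2 * pi ->
  {ae mu, forall t, u < t < v -> Qeval Q t = 0} -> forall k j h, Q k j h = 0.
Proof.
move=> Qs u0 uv v1 hQ k j h.
have [|e0 ek] := @ae_laurent0 (fun k => (Q k h j)%:C) (fun k => (Q k j h)%:C) u v u0 uv v1.
  apply: ae_imp hQ => t hQ /hQ/matrixP/(_ h j); rewrite Qeval_entry// mxE => /eqP.
  rewrite mulf_eq0 => /orP[/eqP[] /eqP|/eqP//].
  by rewrite invr_eq0 pnatr_eq0.
have [k0|] := posnP k; last by move=> /ek[].
have -> : k = ord0 by apply: val_inj.
move: e0 => [] ; rewrite (_ : Q ord0 h j = Q ord0 j h); last by rewrite -{1}Qs mxE.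
by lra.
Qed.

Lemma pe_laurent p t : \sum_(k < n.+1) (expi (- (k%:R * t)) * (p k)%:C + expi (k%:R * t) * (p k)%:C)
  = (2 * pe p t)%:C.
Proof.
rewrite /pe mulr_sumr rmorph_sum; apply: eq_bigr => k _.
by rewrite -mulrDl expi_addN -rmorphM; congr (_%:C); ring.
Qed.

Lemma ae_pe0 p (u v : R) : 0 <= u -> u < v -> v <= 2 * pi ->
  {ae mu, forall t, u < t < v -> pe p t = 0} -> forall k, p k = 0.
Proof.
move=> u0 uv v1 hp k.
have [|e0 ek] := @ae_laurent0 (fun k => (p k)%:C) (fun k => (p k)%:C) u v u0 uv v1.
  by apply: ae_imp hp => t h /h e; rewrite pe_laurent e mulr0.
have [k0|] := posnP k; last by move=> /ek[].
have -> : k = ord0 by apply: val_inj.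
by move: e0 => []; lra.
Qed.

Lemma ae_pe_neq0 p : p ord0 = 1 -> {ae mu, forall t, Tset t -> pe p t != 0}.
Proof.
move=> p0; pose P := laurent (fun k => (p k)%:C) (fun k => (p k)%:C).
have P0 : P != 0.
  apply/eqP => /(congr1 (fun P : {poly R[i]} => P`_n)).
  rewrite laurent_coef0 coef0 p0 => -[] /eqP; rewrite gt_eqF// addr_gt0//.
apply: ae_imp (null_zeros P0) => t h /h; apply: contraNneq => e.
by rewrite laurentE pe_laurent e !mulr0.
Qed.

(** Multiplying each entry by e^{int} gives a polynomial matrix in e^{it}; its determinant differs
    from the original one by a factor that never vanishes, so one nonzero value leaves only finitely
    many zeros. *)
Lemma ae_det_neq0 Q : Qsym Q -> (exists2 t0 : R, Tset t0 & \det (Qeval Q t0) != 0) ->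
  {ae mu, forall t, Tset t -> \det (Qeval Q t) != 0}.
Proof.
move=> Qs [t0 Tt0 d0].
pose M : 'M[{poly R[i]}]_m := \matrix_(j, h)
  laurent (fun k => (2^-1 * Q k j h)%:C) (fun k => (2^-1 * Q k h j)%:C).
have ME t : (\det M).[expi t] = (expi t ^+ n) ^+ m * \det (Qeval Q t).
  rewrite -horner_evalE -det_map_mx -detZ; congr (\det _).
  apply/matrixP => j h.
  transitivity ((laurent (fun k => (2^-1 * Q k j h)%:C) (fun k => (2^-1 * Q k h j)%:C)).[expi t]).
    by rewrite [LHS]mxE /M mxE.
  transitivity (expi t ^+ n * Qeval Q t j h); last by rewrite [RHS]mxE.
  rewrite laurentE (Qeval_entry t j h Qs); congr (_ * _); rewrite mulr_sumr; apply: eq_bigr => k _.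
  by rewrite !rmorphM /=; ring.
have M0 : \det M != 0.
  apply/eqP => e; have := ME t0; rewrite e horner0 => /esym/eqP.
  by rewrite mulf_eq0 (negPf d0) orbF !expf_eq0 (negPf (expi_neq0 _)) !andbF.
apply: ae_imp (null_zeros M0) => t h /h; rewrite ME; apply: contraNneq => ->.
by rewrite mulr0.
Qed.

End TrigPolynomials.


(** * The dual functional and its tangent *)

(** Stated on real and imaginary parts, the functions that are actually integrated. *)
Definition ctsC {R : realType} (f : R -> R[i]) : Prop :=
  continuous (fun t => complex.Re (f t)) /\ continuous (fun t => complex.Im (f t)).

Definition ctsM {R : realType} {m k : nat} (A : R -> 'M[R[i]]_(m, k)) : Prop :=
  forall i j, ctsC (fun t => A t i j).

(** * Continuity of complex functions and of matrix inverses *)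

Section ComplexContinuity.
Variable R : realType.
Implicit Types f g : R -> R[i].

Lemma eq_ctsC f g : (forall t, f t = g t) -> ctsC f -> ctsC g.
Proof. by move=> /funext ->. Qed.

Lemma ctsC_cst (z : R[i]) : ctsC (fun=> z).
Proof. by split=> t; exact: cvg_cst. Qed.

Lemma ctsCD f g : ctsC f -> ctsC g -> ctsC (fun t => f t + g t).
Proof.
move=> [f1 f2] [g1 g2]; split.
  rewrite (_ : (fun _ => _) = fun t => complex.Re (f t) + complex.Re (g t)).
    by move=> t; apply: cvgD; [exact: f1|exact: g1].
  by apply/funext => t; rewrite cReD.
rewrite (_ : (fun _ => _) = fun t => complex.Im (f t) + complex.Im (g t)).
  by move=> t; apply: cvgD; [exact: f2|exact: g2].
by apply/funext => t; rewrite cImD.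
Qed.

Lemma ctsCM f g : ctsC f -> ctsC g -> ctsC (fun t => f t * g t).
Proof.
move=> [f1 f2] [g1 g2]; split.
  rewrite (_ : (fun _ => _) = fun t => complex.Re (f t) * complex.Re (g t) -
      complex.Im (f t) * complex.Im (g t)).
    by move=> t; apply: cvgB; apply: cvgM;
      [exact: f1|exact: g1|exact: f2|exact: g2].
  by apply/funext => t; rewrite cReM.
rewrite (_ : (fun _ => _) = fun t => complex.Re (f t) * complex.Im (g t) +
    complex.Im (f t) * complex.Re (g t)).
  by move=> t; apply: cvgD; apply: cvgM;
    [exact: f1|exact: g2|exact: f2|exact: g1].
by apply/funext => t; rewrite cImM.
Qed.

Lemma ctsC_sum (I : Type) (s : seq I) (F : I -> R -> R[i]) :
  (forall i, ctsC (F i)) -> ctsC (fun t => \sum_(i <- s) F i t).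
Proof.
move=> cF; elim: s => [|i s ih].
  by apply: eq_ctsC (ctsC_cst 0) => t; rewrite big_nil.
by apply: eq_ctsC (ctsCD (cF i) ih) => t; rewrite big_cons.
Qed.

Lemma ctsC_prod (I : Type) (s : seq I) (F : I -> R -> R[i]) :
  (forall i, ctsC (F i)) -> ctsC (fun t => \prod_(i <- s) F i t).
Proof.
move=> cF; elim: s => [|i s ih].
  by apply: eq_ctsC (ctsC_cst 1) => t; rewrite big_nil.
by apply: eq_ctsC (ctsCM (cF i) ih) => t; rewrite big_cons.
Qed.

Lemma ctsC_real (f : R -> R) : continuous f -> ctsC (fun t => (f t)%:C).
Proof. by move=> cf; split => //= t; exact: cvg_cst. Qed.

Lemma ctsC_expi (k : nat) : ctsC (fun t : R => expi (k%:R * t)).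
Proof. by split; [exact: continuous_cosk|exact: continuous_sink]. Qed.

Lemma ctsC_conj f : ctsC f -> ctsC (fun t => conjc (f t)).
Proof.
move=> [f1 f2]; split.
  rewrite (_ : (fun _ => _) = fun t => complex.Re (f t)) //.
  by apply/funext => t; case: (f t).
rewrite (_ : (fun _ => _) = fun t => - complex.Im (f t)).
  by move=> t; apply: cvgN; exact: f2.
by apply/funext => t; case: (f t).
Qed.

Lemma ctsM_det m (A : R -> 'M[R[i]]_m) : ctsM A -> ctsC (fun t => \det (A t)).
Proof.
move=> cA; rewrite /determinant.
apply: ctsC_sum => s; apply: ctsCM; first exact: ctsC_cst.
by apply: ctsC_prod => i; exact: cA.
Qed.

Lemma continuous_invf (f : R -> R) : continuous f -> (forall t, f t != 0) ->
  continuous (fun t => (f t)^-1).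
Proof. by move=> cf f0 t; apply: cvgV; [exact: f0|exact: cf]. Qed.

(** Cramer's rule; the determinant is real and positive, so its inverse is a continuous real
    function. *)
Lemma ctsM_inv m (A : R -> 'M[R[i]]_m) : ctsM A -> (forall t, posdefC (A t)) ->
  ctsM (fun t => invmx (A t)).
Proof.
move=> cA pA i j.
have [cd _] := ctsM_det cA.
have d0 t : complex.Re (\det (A t)) != 0 by have [/lt0r_neq0] := posdef_det (pA t).
have := ctsCM (ctsC_real (continuous_invf cd d0))
  (ctsCM (ctsC_cst ((-1) ^+ (j + i))) (ctsM_det (A := fun t => row' j (col' i (A t))) _)).
move=> h; apply: eq_ctsC (h _) => [t|k l]; last first.
  by apply: eq_ctsC (cA (lift j k) (lift i l)) => t; rewrite !mxE.
rewrite /invmx posdef_unit// [in RHS]mxE [X in _ = _ * X]mxE /cofactor.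
have [_ dE] := posdef_det (pA t).
by rewrite [in RHS]dE -fmorphV.
Qed.

Lemma continuous_lnf (f : R -> R) : continuous f -> (forall t, 0 < f t) ->
  continuous (fun t => ln (f t)).
Proof.
move=> cf f0 t; apply: (@continuous_comp _ _ _ f (@ln R)); first exact: cf.
exact: continuous_ln.
Qed.

End ComplexContinuity.

(** Positivity is asked on the whole line rather than on the torus, so that the integrands are
    continuous functions on [R]. *)
Definition pospair {R : realType} {n m : nat} (p : 'I_n.+1 -> R)
    (Q : 'I_n.+1 -> 'M[R]_m) : Prop :=
  [/\ p ord0 = 1, Qsym Q, forall t, 0 < pe p t & forall t, posdefC (Qeval Q t)].

Definition lnPhi {R : realType} {n m : nat} (p : 'I_n.+1 -> R)
    (Q : 'I_n.+1 -> 'M[R]_m) (t : R) : R := ln (complex.Re (\det (Phihat p Q t))).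

(** The pairing written with traces of [(Q k)^T *m S k] in the dual functional; see [tr_pairQ]. *)
Definition pairQ {R : realType} {n m : nat} (Q S : 'I_n.+1 -> 'M[R]_m) : R :=
  \sum_k \sum_j \sum_h Q k j h * S k j h.

Section Functional.
Variables (R : realType) (n m : nat).
Implicit Types (p ph c : 'I_n.+1 -> R) (Q Qh Rk : 'I_n.+1 -> 'M[R]_m).

Lemma ctsM_Qeval Q : Qsym Q -> ctsM (Qeval Q).
Proof.
move=> Qs j h.
apply: eq_ctsC (fun t => esym (Qeval_entry t j h Qs)) _.
apply: ctsCM; first exact: ctsC_cst.
apply: ctsC_sum => k; apply: ctsCD; apply: ctsCM; try exact: ctsC_cst.
  by apply: eq_ctsC (ctsC_conj (ctsC_expi R k)) => t; rewrite expiN.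
exact: ctsC_expi.
Qed.

Section Interior.
Variables (p : 'I_n.+1 -> R) (Q : 'I_n.+1 -> 'M[R]_m).
Hypothesis pQ : pospair p Q.

Lemma PhihatE t : Phihat p Q t = (pe p t)%:C *: invmx (Qeval Q t).
Proof. by have [p0 _ _ _] := pQ; rewrite /Phihat peval_pe. Qed.

Lemma posdefC_scale k (a : R) (A : 'M[R[i]]_k) : 0 < a -> posdefC A -> posdefC (a%:C *: A).
Proof.
move=> a0 /posdefCE[hA h]; apply/posdefCE; split; first by rewrite adjCZ hA.
by move=> v v0; rewrite qfZ mulr_gt0// h.
Qed.

Lemma Phihat_posdef t : posdefC (Phihat p Q t).
Proof.
have [_ _ p0 Q0] := pQ; rewrite PhihatE.
by apply: posdefC_scale => //; exact: posdef_inv.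
Qed.

Lemma Qeval_Phihat t : Qeval Q t *m Phihat p Q t = (pe p t)%:C%:M.
Proof.
have [_ _ _ Q0] := pQ; rewrite PhihatE -scalemxAr mulmxV ?posdef_unit//.
by rewrite scalemx1.
Qed.

Lemma ctsM_Phihat : ctsM (Phihat p Q).
Proof.
have [_ Qs p0 Q0] := pQ => j h.
have := ctsCM (ctsC_real (@pe_cts R n p)) (ctsM_inv (ctsM_Qeval Qs) Q0 j h).
by apply: eq_ctsC => t; rewrite PhihatE mxE.
Qed.

Lemma continuous_lnPhi : continuous (lnPhi p Q).
Proof.
have [cd _] := ctsM_det ctsM_Phihat.
apply: (@continuous_lnf R (fun t => complex.Re (\det (Phihat p Q t)))) => // t.
by have [] := posdef_det (Phihat_posdef t).
Qed.

Lemma Phihat_herm t : adjC (Phihat p Q t) = Phihat p Q t.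
Proof. by have [] := Phihat_posdef t. Qed.

Lemma Phihat_2pi t : Phihat p Q (2 * pi - t) = map_mx conjc (Phihat p Q t).
Proof.
have [_ Qs _ _] := pQ.
rewrite !PhihatE pe_2pi Qeval_2pi// -map_invmx; apply/matrixP => j h.
by rewrite [LHS]mxE [RHS]mxE [X in conjc X]mxE conjcZ [X in _ * X]mxE.
Qed.

Lemma lnPhi_2pi t : lnPhi p Q (2 * pi - t) = lnPhi p Q t.
Proof.
rewrite /lnPhi Phihat_2pi det_map_mx.
by case: (\det _).
Qed.

Lemma continuous_pV : continuous (fun t => (pe p t)^-1).
Proof.
have [_ _ p0 _] := pQ; apply: continuous_invf; first exact: pe_cts.
by move=> t; rewrite gt_eqF.
Qed.

Lemma continuous_pV2 : continuous (fun t => (pe p t) ^- 2).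
Proof.
rewrite (_ : (fun _ => _) = fun t => (pe p t)^-1 * (pe p t)^-1).
  by move=> t; apply: cvgM; exact: continuous_pV.
by apply/funext => t; rewrite expr2 invfM.
Qed.
End Interior.

Lemma scaled_le (a x y z M : R) : 0 < a -> - z + x <= a^-1 * y - M ->
  a * x - y <= a * z - M * a.
Proof.
move=> a0 h; have a1 : a != 0 by rewrite gt_eqF.
rewrite -subr_ge0 (_ : _ - _ = a * ((a^-1 * y - M) - (- z + x))); last by field.
by rewrite mulr_ge0 ?(ltW a0)// subr_ge0.
Qed.

Lemma scaled_eq (a x y z M : R) : 0 < a -> a * x - y = a * z - M * a ->
  - z + x = a^-1 * y - M.
Proof.
move=> a0 h; have a1 : a != 0 by rewrite gt_eqF.
apply/eqP; rewrite -subr_eq0 (_ : _ - _ = a^-1 * ((a * x - y) - (a * z - M * a))); last by field.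
by rewrite h subrr mulr0.
Qed.

Lemma lerD_eq (x1 y1 x2 y2 : R) : x1 <= y1 -> x2 <= y2 -> x1 + x2 = y1 + y2 ->
  x1 = y1 /\ x2 = y2.
Proof. by move=> h1 h2 e; split; lra. Qed.

(* [ln det] of [Qt / a] against [Phi]: this is the Fenchel-type inequality behind
   the duality, with equality exactly at [Phi = a Qt^-1]. *)
Lemma dual_pointwise (a : R) (Qt Phi : 'M[R[i]]_m) : 0 < a -> posdefC Qt -> posdefC Phi ->
  a * ln (complex.Re (\det Phi)) - complex.Re (\tr (Qt *m Phi)) <=
    a * ln (complex.Re (\det (a%:C *: invmx Qt))) - m%:R * a /\
  (a * ln (complex.Re (\det Phi)) - complex.Re (\tr (Qt *m Phi)) =
    a * ln (complex.Re (\det (a%:C *: invmx Qt))) - m%:R * a -> Qt *m Phi = a%:C%:M).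
Proof.
move=> a0 hQ hP.
have a0' : a != 0 by rewrite gt_eqF.
have hQ' : posdefC (a^-1%:C *: Qt) by apply: posdefC_scale; rewrite ?invr_gt0.
have hI : posdefC (a%:C *: invmx Qt).
  exact (posdefC_scale a0 (posdef_inv hQ)).
have [le_ eq_] := lndet_tr_le hP hQ'.
have [d1 dE1] := posdef_det hQ'; have [d2 dE2] := posdef_det hI.
have lnE : ln (complex.Re (\det (a^-1%:C *: Qt))) =
    - ln (complex.Re (\det (a%:C *: invmx Qt))).
  apply/eqP; rewrite -addr_eq0 -lnM ?posrE//; apply/eqP.
  rewrite (_ : _ * _ = 1) ?ln1//.
  have : \det (a^-1%:C *: Qt) * \det (a%:C *: invmx Qt) = 1.
    rewrite -det_mulmx -scalemxAl -scalemxAr mulmxV ?posdef_unit// scalerA.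
    by rewrite -rmorphM /= mulVf// scale1r det1.
  by rewrite dE1 dE2 -rmorphM => -[].
have trE : complex.Re (\tr (a^-1%:C *: Qt *m Phi)) = a^-1 * complex.Re (\tr (Qt *m Phi)).
  by rewrite -scalemxAl mxtraceZ cReZ.
rewrite lnE trE in le_ eq_.
split; first exact: scaled_le.
move=> /(scaled_eq a0)/eq_; rewrite -scalemxAl => /(congr1 (fun M => a%:C *: M)).
by rewrite scalerA -rmorphM /= mulfV// scale1r scalemx1.
Qed.

(** The gap between 1/a and its tangent at b is (a - b)^2 / (a b^2). *)
Lemma inv_tangent (a b : R) : 0 < a -> 0 < b ->
  2 * b^-1 - a * b ^- 2 <= a^-1 /\ (2 * b^-1 - a * b ^- 2 = a^-1 -> a = b).
Proof.
move=> a0 b0; have a0' : a != 0 by rewrite gt_eqF. have b0' : b != 0 by rewrite gt_eqF.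
have e : a^-1 - (2 * b^-1 - a * b ^- 2) = (a - b) ^+ 2 / (a * b ^+ 2).
  by field; rewrite a0' b0'.
have h0 : 0 <= (a - b) ^+ 2 / (a * b ^+ 2).
  by rewrite divr_ge0 ?sqr_ge0// mulr_ge0 ?sqr_ge0// ltW.
split; first by lra.
move=> e1; have : (a - b) ^+ 2 / (a * b ^+ 2) = 0 by rewrite -e e1 subrr.
move=> /eqP; rewrite mulf_eq0 => /orP[|].
  by rewrite sqrf_eq0 subr_eq0 => /eqP.
by rewrite invr_eq0 gt_eqF// mulr_gt0// exprn_gt0.
Qed.

Variables (lam : R) (Rk : 'I_n.+1 -> 'M[R]_m) (c : 'I_n.+1 -> R).

Definition Jint p Q (t : R) : R :=
  pe p t * ln (complex.Re (\det ((pe p t)%:C *: invmx (Qeval Q t)))) - m%:R * pe p t.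

Definition Jreal p Q : R :=
  IT (Jint p Q) + lam * IT (fun t => (pe p t)^-1) + pairQ Q Rk - \sum_k p k * c k.

(** Differentiating p ln det (p Q^-1) in p gives ln det plus the constant m, which the term [- m p]
    cancels. *)
Definition Amom p Q (k : 'I_n.+1) : R :=
  IT (fun t => cos (k%:R * t) * (lnPhi p Q t - lam * (pe p t) ^- 2)).

Definition Bmom p Q (k : 'I_n.+1) : 'M[R]_m :=
  \matrix_(j, h) IT (fun t => complex.Re (expi (k%:R * t) * Phihat p Q t j h)).

(* The tangent at [(ph, Qh)] of the integrand of [Jreal], as a function of [(p, Q)];
   [Gaff] is the tangent of [Jreal] itself, and [(Amom - c, Rk - Bmom)] its gradient. *)
Definition Gint ph Qh p Q (t : R) : R :=
  (pe p t * lnPhi ph Qh t - complex.Re (\tr (Qeval Q t *m Phihat ph Qh t))) +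
  lam * (2 * (pe ph t)^-1 - pe p t * (pe ph t) ^- 2).

Definition Gaff ph Qh p Q : R :=
  2 * lam * IT (fun t => (pe ph t)^-1) + \sum_k p k * (Amom ph Qh k - c k) +
  (pairQ Q Rk - pairQ Q (Bmom ph Qh)).

(** [lam] is arbitrary here: the value 0 later isolates the tangent of the [ln det] part. *)
Lemma itg_Gint ph Qh p Q : pospair ph Qh -> Qsym Q -> itg (Gint ph Qh p Q) /\
  IT (Gint ph Qh p Q) + pairQ Q Rk - \sum_k p k * c k = Gaff ph Qh p Q.
Proof.
move=> hi Qs.
pose a (k : 'I_n.+1) (t : R) := cos (k%:R * t) * (lnPhi ph Qh t - lam * (pe ph t) ^- 2).
pose b (k : 'I_n.+1) j h (t : R) := complex.Re (expi (k%:R * t) * Phihat ph Qh t j h).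
have ia k : itg (a k).
  apply: itg_cts => t; apply: cvgM; first exact: continuous_cosk.
  apply: cvgB; first exact: continuous_lnPhi.
  by apply: cvgM; [exact: cvg_cst|exact: (continuous_pV2 hi)].
have ib k j h : itg (b k j h).
  by apply: itg_cts; case: (ctsCM (ctsC_expi R k) (ctsM_Phihat hi j h)).
have iV : itg (fun t => (pe ph t)^-1) by apply: itg_cts; exact: continuous_pV hi.
have GE t : Gint ph Qh p Q t = 2 * lam * (pe ph t)^-1 + \sum_k p k * a k t -
    \sum_k \sum_j \sum_h Q k j h * b k j h t.
  rewrite /Gint tr_Qeval ?Phihat_herm//.
  have -> : \sum_k p k * a k t = pe p t * (lnPhi ph Qh t - lam * (pe ph t) ^- 2).
    by rewrite /pe mulr_suml; apply: eq_bigr => k _; rewrite mulrA.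
  rewrite /b; set X := (\sum_(k < n.+1) \sum_j \sum_h _).
  by clearbody X; ring.
have ipa k : itg (fun t => p k * a k t) by exact: itgZ.
have iqb k j h : itg (fun t => Q k j h * b k j h t) by exact: itgZ.
have iq2 k j : itg (fun t => \sum_h Q k j h * b k j h t) by exact: itg_sum.
have iq3 k : itg (fun t => \sum_j \sum_h Q k j h * b k j h t) by exact: itg_sum.
have iq4 : itg (fun t => \sum_k \sum_j \sum_h Q k j h * b k j h t) by exact: itg_sum.
have is1 : itg (fun t => \sum_k p k * a k t) by exact: itg_sum.
have iv1 : itg (fun t => 2 * lam * (pe ph t)^-1) by exact: itgZ.
split; first by apply: eq_itg (itgB (itgD iv1 is1) iq4) => t _; rewrite GE.
rewrite (eq_IT (g := fun t => 2 * lam * (pe ph t)^-1 + \sum_k p k * a k t -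
    \sum_k \sum_j \sum_h Q k j h * b k j h t)) => [|t _]; last exact: GE.
rewrite ITB//; last exact: itgD.
rewrite ITD// ITZ// !IT_sum//.
have -> : \sum_k IT (fun t => p k * a k t) = \sum_k p k * Amom ph Qh k.
  by apply: eq_bigr => k _; rewrite ITZ.
have -> : \sum_k IT (fun t => \sum_j \sum_h Q k j h * b k j h t) = pairQ Q (Bmom ph Qh).
  apply: eq_bigr => k _; rewrite IT_sum//; apply: eq_bigr => j _.
  by rewrite IT_sum//; apply: eq_bigr => h _; rewrite ITZ// mxE.
rewrite /Gaff.
have -> : \sum_k p k * (Amom ph Qh k - c k) = \sum_k p k * Amom ph Qh k - \sum_k p k * c k.
  by rewrite -sumrB; apply: eq_bigr => k _; rewrite mulrBr.
ring.
Qed.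

Lemma Jint_lnPhi p Q : pospair p Q -> Jint p Q = fun t => pe p t * lnPhi p Q t - m%:R * pe p t.
Proof. by move=> hi; apply/funext => t; rewrite /Jint /lnPhi PhihatE. Qed.

Lemma itg_Jint p Q : pospair p Q -> itg (Jint p Q).
Proof.
move=> hi; rewrite Jint_lnPhi//; apply: itg_cts => t; apply: cvgB; apply: cvgM.
- exact: pe_cts.
- exact: continuous_lnPhi.
- exact: cvg_cst.
- exact: pe_cts.
Qed.

Lemma Gint_le ph Qh p Q t : 0 <= lam -> pospair ph Qh -> 0 < pe p t -> posdefC (Qeval Q t) ->
  Gint ph Qh p Q t <= Jint p Q t + lam * (pe p t)^-1.
Proof.
move=> lam0 hi p0 Q0; have [_ _ ph0 _] := hi.
apply: lerD; first by have [] := dual_pointwise p0 Q0 (Phihat_posdef hi t).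
by rewrite ler_wpM2l//; have [] := inv_tangent p0 (ph0 t).
Qed.

(** Both inequalities behind [Gint_le] must be tight. The one for 1/x, weighted by a positive [lam],
    identifies [p]; the other makes [Qeval Q t] and [Qeval Qh t] agree after multiplication by the
    invertible density. *)
Lemma Gint_eq ph Qh p Q t : 0 < lam -> pospair ph Qh -> 0 < pe p t -> posdefC (Qeval Q t) ->
  Gint ph Qh p Q t = Jint p Q t + lam * (pe p t)^-1 ->
  pe p t = pe ph t /\ Qeval Q t = Qeval Qh t.
Proof.
move=> lam0 hi p0 Q0 e; have [_ _ ph0 Qh0] := hi.
have [l1 e1] := dual_pointwise p0 Q0 (Phihat_posdef hi t).
have [l2 e2] := inv_tangent p0 (ph0 t).
have [eL /(mulfI (lt0r_neq0 lam0))/e2 ep] := lerD_eq l1 (ler_wpM2l (ltW lam0) l2) e.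
split; first exact: ep.
apply: (can_inj (mulmxK (posdef_unit (Phihat_posdef hi t)))).
transitivity ((pe p t)%:C%:M : 'M[R[i]]_m); first exact: e1 eL.
by rewrite ep; apply/esym; exact: (Qeval_Phihat hi t).
Qed.

Lemma Gaff_le ph Qh p Q : 0 <= lam -> pospair ph Qh -> pospair p Q ->
  Gaff ph Qh p Q <= Jreal p Q.
Proof.
move=> lam0 hi hi'; have [_ Qs p0 Q0] := hi'.
have [iG <-] := itg_Gint p hi Qs.
rewrite /Jreal lerB// lerD//.
have iV : itg (fun t => (pe p t)^-1) by apply: itg_cts; exact: continuous_pV hi'.
rewrite -ITZ// -ITD//; [|exact: itg_Jint|exact: itgZ].
apply: IT_le => //; first by apply: itgD; [exact: itg_Jint|exact: itgZ].
by move=> t _; exact: Gint_le.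
Qed.

(** At the base point the product of [Q] and the density is p I, whose trace m p is exactly the
    linear term of [Jint]. *)
Lemma Gaff_refl p Q : pospair p Q -> Gaff p Q p Q = Jreal p Q.
Proof.
move=> hi; have [_ Qs p0 Q0] := hi.
have [iG <-] := itg_Gint p hi Qs.
rewrite /Jreal; congr (_ + _ - _).
have iV : itg (fun t => (pe p t)^-1) by apply: itg_cts; exact: continuous_pV hi.
rewrite -ITZ// -ITD//; [|exact: itg_Jint|exact: itgZ].
apply: eq_IT => t _; rewrite Jint_lnPhi// /Gint Qeval_Phihat// mxtrace_scalar.
rewrite -(rmorphMn (real_complex R)) /= -mulr_natl.
have : pe p t != 0 by rewrite gt_eqF.
move: (pe p t) (lnPhi p Q t) => x L x0; by field.
Qed.

End Functional.


(** * Coercivity *)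

(** Gathers all coefficients of a pair in one finite type, so that the abstract minimization results
    apply. *)
Definition coord (n m : nat) : finType := ('I_n.+1 + 'I_n.+1 * 'I_m * 'I_m)%type.

Definition px {R : realType} {n m : nat} (x : coord n m -> R) : 'I_n.+1 -> R :=
  fun k => x (inl k).

Definition Qx {R : realType} {n m : nat} (x : coord n m -> R) : 'I_n.+1 -> 'M[R]_m :=
  fun k => \matrix_(j, h) x (inr (k, j, h)).

Definition mkx {R : realType} {n m : nat} (p : 'I_n.+1 -> R) (Q : 'I_n.+1 -> 'M[R]_m) :
  coord n m -> R := fun i => match i with inl k => p k | inr (k, j, h) => Q k j h end.

(** The normalization of [p ord0] is left out: for s = 0 this is a genuine cone, and for s > 0
    adding it gives the slices. *)
Definition cone {R : realType} {n m : nat} (E : rel 'I_m) (s : R) (p : 'I_n.+1 -> R)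
    (Q : 'I_n.+1 -> 'M[R]_m) : Prop :=
  [/\ Qsym Q, forall k j h, ~~ E j h -> Q k j h = 0, forall t, s <= pe p t &
      forall t v, s * sqn v <= qf (Qeval Q t) v].

Lemma qf_comb {R : realType} m (a b : R) (A B : 'M[R[i]]_m) v :
  qf (a%:C *: A + b%:C *: B) v = a * qf A v + b * qf B v.
Proof. by rewrite qfD !qfZ. Qed.

Lemma IT_norm_le {R : realType} (f : R -> R) (b : R) : itg f -> (forall t, `|f t| <= b) ->
  `|IT f| <= b.
Proof.
move=> hf fb; rewrite ler_norml; apply/andP; split.
  rewrite -[leLHS]IT_cst; apply: IT_le => // [|t _]; first exact: itg_cst.
  by have := fb t; rewrite ler_norml => /andP[].
rewrite -[leRHS]IT_cst; apply: IT_le => // [|t _]; first exact: itg_cst.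
by have := fb t; rewrite ler_norml => /andP[].
Qed.

(** * Pairs of polynomials as vectors, and constant pairs *)

Section Coordinates.
Variables (R : realType) (n m : nat).
Implicit Types (p : 'I_n.+1 -> R) (Q S : 'I_n.+1 -> 'M[R]_m) (x : coord n m -> R).

Lemma px_mkx p Q : px (mkx p Q) = p.
Proof. by []. Qed.

Lemma Qx_mkx p Q : Qx (mkx p Q) = Q.
Proof. by apply/funext => k; apply/matrixP => j h; rewrite mxE. Qed.

Lemma sum_coord (F : coord n m -> R) : \sum_i F i =
  \sum_k F (inl k) + \sum_k \sum_j \sum_h F (inr (k, j, h)).
Proof.
rewrite big_sumType /=; congr (_ + _).
under [RHS]eq_bigr do rewrite pair_bigA /=.
rewrite pair_bigA /=.
rewrite (reindex (fun u : 'I_n.+1 * ('I_m * 'I_m) => (u.1, u.2.1, u.2.2)))//=.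
by exists (fun u => (u.1.1, (u.1.2, u.2))) => [[a [b c]]|[[a b] c]].
Qed.

Lemma halfspaces_lin (f : (coord n m -> R) -> R) (l : coord n m -> R) (b : R) :
  (forall x, f x = \sum_i l i * x i) -> halfspaces (fun x => b <= f x).
Proof.
move=> fE; apply: halfspaces_eq (halfspaces1 l b) => x.
by rewrite fE.
Qed.

Lemma halfspaces_cone (E : rel 'I_m) (s : R) :
  halfspaces (fun x => cone E s (px x) (Qx x)).
Proof.
pose w t (v : 'cV[R[i]]_m) (k : 'I_n.+1) (j h : 'I_m) :=
  complex.Re (expi (k%:R * t) * (v j 0 * conjc (v h 0))).
(* Applied to (j, h) and to (h, j), the inequality is the symmetry of [Q ord0]. *)
have H2 : halfspaces (fun x : coord n m -> R =>
    forall j h, 0 <= x (inr (ord0, j, h)) - x (inr (ord0, h, j))).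
  apply: halfspaces_all => j; apply: halfspaces_all => h.
  apply: (@halfspaces_lin _ (fun i => (i == inr (ord0, j, h))%:R - (i == inr (ord0, h, j))%:R)).
  move=> x; under eq_bigr do rewrite mulrBl.
  by rewrite sumrB !sum_delta.
have H3 : halfspaces (fun x : coord n m -> R =>
    forall k j h, ~~ E j h -> x (inr (k, j, h)) = 0).
  apply: halfspaces_all => k; apply: halfspaces_all => j; apply: halfspaces_all => h.
  by apply: halfspaces_imp; exact: halfspaces_eqc.
have H4 : halfspaces (fun x : coord n m -> R => forall t, s <= pe (px x) t).
  apply: halfspaces_all => t.
  apply: (@halfspaces_lin _ (fun i => match i with inl k => cos (k%:R * t) | inr _ => 0 end)).
  move=> x; rewrite sum_coord [X in _ + X]big1 ?addr0.
    by apply: eq_bigr => k _; rewrite mulrC.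
  by move=> k _; rewrite big1// => j _; rewrite big1// => h _; rewrite mul0r.
have H5 : halfspaces (fun x : coord n m -> R => forall t v, s * sqn v <=
    \sum_k \sum_j \sum_h x (inr (k, j, h)) * w t v k j h).
  apply: halfspaces_all => t; apply: halfspaces_all => v.
  apply: (@halfspaces_lin _ (fun i => match i with inl _ => 0 | inr (k, j, h) => w t v k j h end)).
  move=> x; rewrite sum_coord [X in X + _]big1 ?add0r; last by move=> k _; rewrite mul0r.
  by do 3 (apply: eq_bigr => ? _); rewrite mulrC.
apply: halfspaces_eq (halfspaces_and H2 (halfspaces_and H3 (halfspaces_and H4 H5))) => x.
have qE : Qsym (Qx x) -> forall t v, qf (Qeval (Qx x) t) v =
    \sum_k \sum_j \sum_h x (inr (k, j, h)) * w t v k j h.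
  by move=> Qs t v; rewrite qf_Qeval//; do 3 (apply: eq_bigr => ? _); rewrite mxE.
split.
  move=> [h2 [h3 [h4 h5]]].
  have Qs : Qsym (Qx x).
    apply/matrixP => j h; rewrite !mxE; apply/eqP; rewrite eq_le -subr_ge0 h2 /=.
    by rewrite -subr_ge0 h2.
  by split => // [k j h nE|t v]; [rewrite mxE h3|rewrite qE].
move=> [Qs h3 h4 h5]; split.
  move=> j h; have /matrixP/(_ j h) := Qs; rewrite !mxE => ->.
  by rewrite subrr.
split; first by move=> k j h /(h3 k); rewrite mxE.
by split => // t v; rewrite -qE.
Qed.

Lemma cone_pospair (E : rel 'I_m) (s : R) p Q : 0 < s -> p ord0 = 1 -> cone E s p Q -> pospair p Q.
Proof.
move=> s0 p0 [Qs _ ps qs]; split=> // t; first exact: lt_le_trans (ps t).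
apply/posdefCE; split; first exact: Qeval_herm.
by move=> v v0; apply: lt_le_trans (qs t v); rewrite mulr_gt0// sqn_gt0.
Qed.

Lemma pe_lin a p b p' t : pe (fun k => a * p k + b * p' k) t = a * pe p t + b * pe p' t.
Proof.
rewrite /pe !mulr_sumr -big_split; apply: eq_bigr => k _ /=; ring.
Qed.

Lemma Qsym_lin a Q b Q' : Qsym Q -> Qsym Q' -> Qsym (fun k => a *: Q k + b *: Q' k).
Proof. by move=> h h'; rewrite /Qsym linearD !linearZ /= h h'. Qed.

Lemma Qeval_lin a Q b Q' t : Qsym Q -> Qsym Q' ->
  Qeval (fun k => a *: Q k + b *: Q' k) t = a%:C *: Qeval Q t + b%:C *: Qeval Q' t.
Proof.
move=> h h'; apply/matrixP => j l.
transitivity (a%:C * Qeval Q t j l + b%:C * Qeval Q' t j l); last first.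
  by rewrite [RHS]mxE [X in _ = X + _]mxE [X in _ = _ + X]mxE.
rewrite [LHS](Qeval_entry t j l (Qsym_lin a b h h')).
rewrite [X in _ = _ * X + _](Qeval_entry t j l h) [X in _ = _ + _ * X](Qeval_entry t j l h').
rewrite !(mulrCA _ (2^-1)%:C) -mulrDr; congr (_ * _).
rewrite !mulr_sumr -big_split; apply: eq_bigr => k _ /=.
by rewrite !mxE !rmorphD !rmorphM /=; ring.
Qed.

Lemma qf_lin a Q b Q' t v : Qsym Q -> Qsym Q' ->
  qf (Qeval (fun k => a *: Q k + b *: Q' k) t) v =
  a * qf (Qeval Q t) v + b * qf (Qeval Q' t) v.
Proof.
move=> h h'; transitivity (qf (a%:C *: Qeval Q t + b%:C *: Qeval Q' t) v).
  by congr qf; exact: Qeval_lin.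
exact: qf_comb.
Qed.

Definition cstp (a : R) : 'I_n.+1 -> R := fun k => if k == ord0 then a else 0.
Definition cstQ (A : 'M[R]_m) : 'I_n.+1 -> 'M[R]_m := fun k => if k == ord0 then A else 0.

Lemma pe_cstp a t : pe (cstp a) t = a.
Proof.
rewrite /pe (bigD1 ord0)//= big1 => [|k /negPf k0]; last by rewrite /cstp k0 mul0r.
by rewrite /cstp eqxx mul0r cos0 mulr1 addr0.
Qed.

Lemma Qeval_cstQ (A : 'M[R]_m) t : A^T = A -> Qeval (cstQ A) t = toCmx A.
Proof.
move=> As; have Qs : Qsym (cstQ A) by rewrite /Qsym /cstQ eqxx.
apply/matrixP => j h; rewrite (Qeval_entry t j h Qs) (bigD1 ord0)//= big1 => [|k /negPf k0].
  rewrite /cstQ eqxx mul0r oppr0 expi0 !mul1r addr0 [RHS]mxE.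
  have -> : A h j = A j h by rewrite -{1}As mxE.
  by rewrite -rmorphD -rmorphM /=; congr (_%:C); field.
by rewrite /cstQ k0 !mxE !mulr0 addr0.
Qed.

Lemma Qeval_scalar (a : R) t : Qeval (cstQ a%:M) t = a%:C%:M.
Proof.
by rewrite Qeval_cstQ ?tr_scalar_mx//; apply/matrixP => j h; rewrite !mxE rmorphMn.
Qed.

Lemma Qsym_cstQ (A : 'M[R]_m) : A^T = A -> Qsym (cstQ A).
Proof. by rewrite /Qsym /cstQ eqxx. Qed.

(** A scalar matrix is supported on the diagonal, which [E] contains. *)
Lemma cone_cst (E : rel 'I_m) (Erefl : forall j, E j j) (a b s : R) : s <= a -> s <= b ->
  cone E s (cstp a) (cstQ b%:M).
Proof.
move=> sa sb; have Qs : Qsym (cstQ b%:M) by apply: Qsym_cstQ; exact: tr_scalar_mx.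
split=> //.
- move=> k j h; rewrite /cstQ; case: eqP => _; rewrite ?mxE//.
  by case: eqP => [->|//]; rewrite Erefl.
- by move=> t; rewrite pe_cstp.
- by move=> t v; rewrite Qeval_scalar qf_scalar ler_wpM2r// sqn_ge0.
Qed.

Lemma IT_pe p : IT (pe p) = p ord0.
Proof.
rewrite /pe IT_sum => [|k]; last first.
  by apply: itgZ; apply: itg_cts; exact: continuous_cosk.
rewrite (bigD1 ord0)//= big1 ?addr0 => [|k k0].
  rewrite (eq_IT (g := fun=> p ord0)) ?IT_cst// => t _.
  by rewrite mul0r cos0 mulr1.
rewrite ITZ ?IT_cosk ?mulr0 ?lt0n//.
by apply: itg_cts; exact: continuous_cosk.
Qed.

End Coordinates.

Section Coercivity.
Variables (R : realType) (n m : nat) (E : rel 'I_m) (Erefl : forall j, E j j).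
Variables (Rk : 'I_n.+1 -> 'M[R]_m) (Phibar : R -> 'M[R[i]]_m).
Local Notation mu := (@lebesgue_measure R).
Hypothesis Phi_psd : forall t : R, 0 <= t < 2 * pi -> psdC (Phibar t).
Hypothesis Phi_int : forall j h : 'I_m, integrableTC (fun t => Phibar t j h).
Hypothesis Phi_pd : exists a b : R, [/\ 0 <= a, a < b, b <= 2 * pi &
  forall t : R, a < t < b -> posdefC (Phibar t)].
Hypothesis Phi_mom : forall (k : 'I_n.+1) (j h : 'I_m), E j h ->
  intTC (fun t => Phibar t j h * expi (k%:R * t)) = ((Rk k j h)%:E, 0%:E).
Implicit Types (p c : 'I_n.+1 -> R) (Q : 'I_n.+1 -> 'M[R]_m).

Lemma itgM_bounded (f g : R -> R) : itg f -> continuous g -> (forall t, `|g t| <= 1) ->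
  itg (fun t => f t * g t).
Proof.
move=> hf cg g1; simple refine (@le_integrable _ (measurableTypeR R) _ mu Tset (@measurable_T R)
  (EFin \o (fun t => f t * g t)) (EFin \o f) _ _ hf).
  apply/measurable_EFinP; apply: measurable_funM.
    by apply/measurable_EFinP; case/integrableP : hf.
  exact: measurable_continuous.
by move=> t _; rewrite /= lee_fin normrM ler_piMr.
Qed.

Lemma Phibar_mom (k : 'I_n.+1) (j h : 'I_m) :
  itg (fun t => complex.Re (expi (k%:R * t) * Phibar t j h)) /\
  (E j h -> IT (fun t => complex.Re (expi (k%:R * t) * Phibar t j h)) = Rk k j h).
Proof.
have [i1 i2] := Phi_int j h.
have iF : itg (fun t => complex.Re (expi (k%:R * t) * Phibar t j h)).
  have := itgB (itgM_bounded i1 (@continuous_cosk R k) (fun t => cos_max _))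
    (itgM_bounded i2 (@continuous_sink R k) (fun t => sin_max _)).
  apply: eq_itg => t _; rewrite cReM /expi /=; ring.
split=> // /(Phi_mom k) [e _].
have := intT_itg iF; rewrite (_ : (fun t => _) = (fun t =>
  (complex.Re (Phibar t j h * expi (k%:R * t)))%:E)) ?e => [[->//]|].
by apply/funext => t; rewrite mulrC.
Qed.

(** The moments of [Phibar] are prescribed on [E] only, but outside [E] the coefficients of [Q]
    vanish. *)
Lemma pairQ_Phibar Q : Qsym Q -> (forall k j h, ~~ E j h -> Q k j h = 0) ->
  itg (fun t => complex.Re (\tr (Qeval Q t *m Phibar t))) /\
  IT (fun t => complex.Re (\tr (Qeval Q t *m Phibar t))) = pairQ Q Rk.
Proof.
move=> Qs Q0.
pose b (k : 'I_n.+1) j h (t : R) := complex.Re (expi (k%:R * t) * Phibar t j h).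
have ib k j h : itg (b k j h) by have [] := Phibar_mom k j h.
have e t : Tset t -> complex.Re (\tr (Qeval Q t *m Phibar t)) =
    \sum_k \sum_j \sum_h Q k j h * b k j h t.
  by move=> /TsetP /Phi_psd[hP _]; exact: tr_Qeval.
have iqb k j h : itg (fun t => Q k j h * b k j h t) by exact: itgZ.
have iq2 k j : itg (fun t => \sum_h Q k j h * b k j h t) by exact: itg_sum.
have iq3 k : itg (fun t => \sum_j \sum_h Q k j h * b k j h t) by exact: itg_sum.
have iq4 : itg (fun t => \sum_k \sum_j \sum_h Q k j h * b k j h t) by exact: itg_sum.
split; first by apply: eq_itg iq4 => t Tt; rewrite e.
rewrite (eq_IT e) IT_sum//; apply: eq_bigr => k _; rewrite IT_sum//.
apply: eq_bigr => j _; rewrite IT_sum//; apply: eq_bigr => h _; rewrite ITZ//.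
have [Ejh|/Q0 ->] := boolP (E j h); last by rewrite !mul0r.
by have [_ ->] := Phibar_mom k j h.
Qed.

(** [p ord0] is the mean of [p], and the pairing is the integral of a nonnegative trace. If the
    latter is 0, then [Q] vanishes almost everywhere on the interval where [Phibar] is positive
    definite, hence identically. *)
Lemma cone_pos p Q : cone E 0 p Q ->
  [/\ 0 <= p ord0, 0 <= pairQ Q Rk, p ord0 = 0 -> forall k, p k = 0 &
      pairQ Q Rk = 0 -> forall k j h, Q k j h = 0].
Proof.
move=> [Qs Q0 pp qq].
have ip : itg (pe p) by apply: itg_cts; exact: pe_cts.
have [h1 h2] := IT_ae_eq0 ip (ae_all (fun t _ => pp t)).
have [iq IQ] := pairQ_Phibar Qs Q0.
have Qpsd t : psdC (Qeval Q t).
  apply/psdCE; split; first exact: Qeval_herm.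
  by move=> v; have := qq t v; rewrite mul0r.
have [|h3 h4] := IT_ae_eq0 iq.
  apply: ae_all => t Tt.
  by apply: psd_tr_mul_ge0 => //; apply: Phi_psd; exact/TsetP.
rewrite IT_pe in h1 h2; rewrite IQ in h3 h4; split=> //.
  move=> /h2 hp; have pi0 := @pi2_gt0 R.
  apply: (@ae_pe0 R n p 0 (2 * pi)) => //.
  by apply: ae_imp hp => t h /andP[t0 t1]; apply: h; apply/TsetP; rewrite (ltW t0).
move=> /h4 hQ; have [a [b [a0 ab b1 pd]]] := Phi_pd.
apply: (@ae_Qeval0 R n m Q a b) => //.
apply: ae_imp hQ => t h /[dup] tab /andP[t0 t1].
apply: psd_tr_mul_eq0 (Qpsd t) (pd _ tab) _; apply: h.
by apply/TsetP; rewrite (le_trans a0 (ltW t0)) (lt_le_trans t1 b1).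
Qed.

(** [cone_coercive] for the form [p ord0] plus the pairing; replacing one component by 0 then
    separates the two estimates. *)
Lemma cone_bound : exists2 k, 0 < k & forall p Q, cone E 0 p Q ->
  (forall i, k * `|p i| <= p ord0) /\ (forall i j h, k * `|Q i j h| <= pairQ Q Rk).
Proof.
pose l (i : coord n m) : R := match i with
  | inl k => (k == ord0)%:R | inr (k, j, h) => Rk k j h end.
have lE x : \sum_i l i * x i = px x ord0 + pairQ (Qx x) Rk.
  rewrite sum_coord /= sum_delta; congr (_ + _).
  by do 3 (apply: eq_bigr => ? _); rewrite mxE mulrC.
have [x a|x i|k k0 hk] := @cone_coercive R (coord n m) _ l (halfspaces_cone n E 0).
- move=> [Qs Q0 pp qq] a0.
  have pE : px (fun i => a * x i) = fun k => a * px x k + 0 * px x k.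
    by apply/funext => k; rewrite mul0r addr0.
  have QE : Qx (fun i => a * x i) = fun k => a *: Qx x k + 0 *: Qx x k.
    by apply/funext => k; apply/matrixP => j h; rewrite !mxE mul0r addr0.
  rewrite pE QE; split; first exact: Qsym_lin.
  + by move=> k j h /Q0 e; rewrite scale0r addr0 mxE e mulr0.
  + by move=> t; rewrite pe_lin mul0r addr0 mulr_ge0.
  + move=> t v; rewrite qf_lin// mul0r mul0r addr0 mulr_ge0//.
    by have := qq t v; rewrite mul0r.
- move=> /cone_pos[h1 h2 h3 h4] xi; rewrite lE lt_neqAle addr_ge0// andbT eq_sym.
  apply: contraNneq xi => /eqP; rewrite paddr_eq0// => /andP[/eqP/h3 e1 /eqP/h4 e2].
  case: i => [k|[[k j] h]]; first by rewrite -/(px x k) e1.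
  by have := e2 k j h; rewrite mxE => ->.
exists k => // p Q [Qs Q0 pp qq].
have z0 : (0 : 'M[R]_m)^T = 0 by rewrite trmx0.
have c1 : cone E 0 p (cstQ (0 : 'M[R]_m)).
  split; [exact: Qsym_cstQ| |exact: pp|].
    by move=> i j h _; rewrite /cstQ; case: ifP; rewrite mxE.
  move=> t v; rewrite Qeval_cstQ// /toCmx map_mx0 mul0r.
  by rewrite /qf mulmx0 mul0mx mxE.
have c2 : cone E 0 (cstp 0) Q.
  by split => // t; rewrite pe_cstp.
have pz (S : 'I_n.+1 -> 'M[R]_m) : pairQ (cstQ 0) S = 0.
  rewrite /pairQ big1// => i _; rewrite big1// => j _; rewrite big1// => h _.
  by rewrite /cstQ; case: ifP; rewrite mxE mul0r.
split.
  move=> i; have := hk (mkx p (cstQ 0)); rewrite px_mkx Qx_mkx => /(_ c1 (inl i)).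
  by rewrite lE px_mkx Qx_mkx pz addr0.
move=> i j h; have := hk (mkx (cstp 0) Q); rewrite px_mkx Qx_mkx => /(_ c2 (inr (i, j, h))).
by rewrite lE px_mkx Qx_mkx /cstp eqxx add0r.
Qed.

Lemma norm_Re_expi (k : nat) (t : R) (z : R[i]) (b : R) : `|z| <= b%:C ->
  `|complex.Re (expi (k%:R * t) * z)| <= b.
Proof.
move=> zb; have := normc_ge_Re (expi (k%:R * t) * z); rewrite normrM.
have -> : `|expi (k%:R * t)| = 1 :> R[i].
  by rewrite normc_def /= cos2Dsin2 sqrtr1.
by rewrite mul1r => /le_trans/(_ zb); rewrite lecR.
Qed.

(* Compare with the constant point [(1, b I)]; for [b] large the linear term
   [<Q, R>] absorbs half of itself. *)
Lemma Jreal_coercive (lam : R) c : 0 <= lam -> exists C, forall p Q,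
  pospair p Q -> cone E 0 p Q -> C + 2^-1 * pairQ Q Rk <= Jreal lam Rk c p Q.
Proof.
move=> lam0; have [ka ka0 hka] := cone_bound.
pose N : R := \sum_(k < n.+1) \sum_(j < m) \sum_(h < m) 1.
have N0 : 0 <= N by do 3 (apply: sumr_ge0 => ? _).
(* [N] counts the coefficients of [Q], each at most [pairQ Q Rk / ka], while the density at the
   constant pair is I / b. This [b] makes N / (ka b) at most 1/2. *)
pose b := 2 * N / ka + 1.
have b0 : 0 < b by rewrite ltr_wpDl// divr_ge0 ?(ltW ka0)// mulr_ge0.
have i1 : pospair (cstp 1 : 'I_n.+1 -> R) (cstQ b%:M : 'I_n.+1 -> 'M[R]_m).
  have := @cone_cst R n m E Erefl 1 b (Num.min 1 b); rewrite !ge_min !lexx orbT /=.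
  move=> /(_ isT isT) c1; apply: (cone_pospair _ _ c1); last by rewrite /cstp eqxx.
  by rewrite lt_min ltr01 b0.
set p1 : 'I_n.+1 -> R := cstp 1 in i1; set Q1 : 'I_n.+1 -> 'M[R]_m := cstQ b%:M in i1.
have Bb k j h : `|Bmom p1 Q1 k j h| <= b^-1.
  rewrite mxE.
  have hb t : `|complex.Re (expi (k%:R * t) * Phihat p1 Q1 t j h)| <= b^-1.
    apply: norm_Re_expi; rewrite PhihatE// pe_cstp scale1r Qeval_scalar.
    rewrite invmx_scalar mxE -fmorphV normrMn.
    have -> : `|b^-1%:C| = b^-1%:C by rewrite ger0_norm// ler0c invr_ge0 ltW.
    by case: (j == h); rewrite ?mulr1n// mulr0n ler0c invr_ge0 ltW.
  have ii : itg (fun t => complex.Re (expi (k%:R * t) * Phihat p1 Q1 t j h)).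
    by apply: itg_cts; case: (ctsCM (ctsC_expi R k) (ctsM_Phihat i1 j h)).
  exact: IT_norm_le.
pose C := - \sum_k ka^-1 * `|Amom lam p1 Q1 k - c k|.
exists C => p Q hi hc; have [p0 _ _ _] := hi; have [hp hQ] := hka _ _ hc.
apply: le_trans (Gaff_le Rk c lam0 i1 hi); rewrite /Gaff.
have S0 : 0 <= pairQ Q Rk by have [] := cone_pos hc.
have h1 : 0 <= 2 * lam * IT (fun t => (pe p1 t)^-1).
  have -> : IT (fun t => (pe p1 t)^-1) = 1.
    by rewrite -[RHS](@IT_cst R 1); apply: eq_IT => t _; rewrite pe_cstp invr1.
  by rewrite mulr1 mulr_ge0.
have h2 : C <= \sum_k p k * (Amom lam p1 Q1 k - c k).
  rewrite /C -sumrN; apply: ler_sum => k _.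
  have := ler_norm (- (p k * (Amom lam p1 Q1 k - c k))); rewrite normrN normrM => h.
  rewrite lerNl; apply: le_trans h _; apply: ler_wpM2r => //.
  by have := hp k; rewrite p0 -ler_pdivlMl// mulr1.
have h3 : pairQ Q (Bmom p1 Q1) <= 2^-1 * pairQ Q Rk.
  apply: (@le_trans _ _ (N * (ka^-1 * pairQ Q Rk * b^-1))).
    have hW k j h : Q k j h * Bmom p1 Q1 k j h <= ka^-1 * pairQ Q Rk * b^-1.
      rewrite (le_trans (ler_norm _))// normrM ler_pM//.
      by rewrite ler_pdivlMl//; exact: hQ.
    move: (ka^-1 * _ * _) hW => W hW.
    rewrite /pairQ /N mulr_suml; apply: ler_sum => k _.
    rewrite mulr_suml; apply: ler_sum => j _.
    by rewrite mulr_suml; apply: ler_sum => h _; rewrite mul1r.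
  rewrite (_ : _ * _ = (N / (ka * b)) * pairQ Q Rk); last by field; rewrite !gt_eqF.
  apply: ler_wpM2r => //; rewrite ler_pdivrMr ?mulr_gt0//.
  rewrite (_ : ka * b = 2 * N + ka); last by rewrite /b; field; rewrite gt_eqF.
  by move: N0 ka0; lra.
move: h1 h2 h3; lra.
Qed.

End Coercivity.

Section QuadraticForm.
Variables (R : realType) (m : nat).

Lemma qf_scale (A : 'M[R[i]]_m) (a : R) v : qf A (a%:C *: v) = a ^+ 2 * qf A v.
Proof.
rewrite /qf adjCZ -scalemxAr -!scalemxAl mxE [X in _ * X]mxE !cReZ; ring.
Qed.

Lemma qf0 (A : 'M[R[i]]_m) : qf A 0 = 0.
Proof. by rewrite /qf mulmx0 mxE. Qed.

Lemma qf_ge_unit (A : 'M[R[i]]_m) (d : R) :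
  (forall v, sqn v = 1 -> d <= qf A v) -> forall v, d * sqn v <= qf A v.
Proof.
move=> h v; have [->|v0] := eqVneq v 0.
  by rewrite /sqn !qf0 mulr0.
have s0 := sqn_gt0 v0; pose a := (Num.sqrt (sqn v))^-1.
have a2 : a ^+ 2 = (sqn v)^-1 by rewrite /a exprVn sqr_sqrtr ?ltW.
have := h (a%:C *: v); rewrite /sqn !qf_scale -/(sqn v) a2 mulVf ?gt_eqF// => /(_ erefl).
by rewrite mulrC ler_pdivlMr.
Qed.

End QuadraticForm.

Lemma addr_diff {R : realType} (a b z : R) : a + z - (b + z) = a - b.
Proof. ring. Qed.

Lemma le_scaled {R : realType} (d a x : R) : 0 < d -> d <= a -> 0 <= x ->
  x <= d^-1 * (a * x).
Proof. by move=> d0 da x0; rewrite ler_pdivlMl// ler_wpM2r. Qed.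

Lemma eq_ler {R : realType} (a b : R) : a = b -> a <= b.
Proof. by move=> ->. Qed.

Lemma eq_le_trans {R : realType} (a b c : R) : a = b -> b <= c -> a <= c.
Proof. by move=> ->. Qed.

(** A Lipschitz [f] stays below f(t0) + L |u - t0|, so [IT_inv_blowup] applies with [nu] equal to
    f(t0). [d] depends only on [L] and [C]; [g] is kept apart from 1/f so that a trace can dominate
    it. *)
Lemma IT_inv_lower {R : realType} (L C : R) : 0 < L -> exists2 d, 0 < d &
  forall (f g : R -> R) (t0 : R), Tset t0 -> (forall u, 0 < f u) ->
    (forall u, `|f u - f t0| <= L * `|u - t0|) -> itg g ->
    (forall u, (f u)^-1 <= g u) -> IT g <= C -> d <= f t0.
Proof.
move=> L0; have [d d0 h] := IT_inv_blowup C L0; exists d => //.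
move=> f g t0 Tt0 f0 fL hg fg; apply: (h g t0) => // u Tu.
apply: le_trans (fg u); rewrite lef_pV2 ?posrE//; last first.
  by rewrite ltr_pwDl// mulr_ge0// ltW.
by rewrite -lerBlDl (le_trans (ler_norm _)).
Qed.

(** * Reduction to the torus and uniform Lipschitz bounds *)

Section Periodicity.
Variables (R : realType) (n m : nat).
Implicit Types (p : 'I_n.+1 -> R) (Q : 'I_n.+1 -> 'M[R]_m).

Lemma expi_2piz (z : int) : expi (z%:~R * (2 * pi)) = 1 :> R[i].
Proof.
have e k : expi (k%:R * (2 * pi)) = 1 :> R[i].
  have h := expi_2pi k (0 : R).
  by move: h; rewrite subr0 mulr0 => ->; rewrite expi0 conjc1.
case: z => k; first by rewrite -pmulrn e.
by rewrite NegzE mulrNz mulNr expiN -pmulrn e conjc1.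
Qed.

(** Slices constrain every real t, while the blow-up estimate wants its point in the torus. *)
Lemma Tset_repr (t : R) : exists2 t', Tset t' &
  forall k : nat, expi (k%:R * t) = expi (k%:R * t').
Proof.
have pi2 := @pi2_gt0 R; pose z := Num.floor (t / (2 * pi)).
exists (t - z%:~R * (2 * pi)).
  apply/TsetP; rewrite subr_ge0 -ler_pdivlMr// floor_le /= ltrBlDr.
  have := floorD1_gt (t / (2 * pi)).
  by rewrite ltr_pdivrMr// intrD mulrDl mul1r addrC.
move=> k; rewrite !expiMn; congr (_ ^+ _).
transitivity (expi ((t - z%:~R * (2 * pi)) + z%:~R * (2 * pi))); first by rewrite subrK.
by rewrite expiD expi_2piz mulr1.
Qed.

Lemma pe_repr p t t' : (forall k : nat, expi (k%:R * t) = expi (k%:R * t')) -> pe p t = pe p t'.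
Proof. by move=> h; apply: eq_bigr => k _; have [->] := h k. Qed.

Lemma qf_repr Q t t' v : Qsym Q -> (forall k : nat, expi (k%:R * t) = expi (k%:R * t')) ->
  qf (Qeval Q t) v = qf (Qeval Q t') v.
Proof.
move=> Qs h; apply: (etrans (qf_Qeval t v Qs)); apply: (etrans _ (esym (qf_Qeval t' v Qs))).
by do 3 (apply: eq_bigr => ? _); rewrite h.
Qed.

Lemma pe_bound p t : `|pe p t| <= \sum_k `|p k|.
Proof.
rewrite (le_trans (ler_norm_sum _ _ _))//; apply: ler_sum => k _.
by rewrite normrM ler_piMr// cos_max.
Qed.

Lemma pe_lipschitz p (B t t' : R) : (forall k, `|p k| <= B) ->
  `|pe p t - pe p t'| <= (\sum_(k < n.+1) B * k%:R) * `|t - t'|.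
Proof.
move=> pB; rewrite /pe -sumrB mulr_suml (le_trans (ler_norm_sum _ _ _))//.
apply: ler_sum => k _; rewrite -mulrBr normrM -mulrA ler_pM//.
by rewrite (le_trans (cosB_le _ _))// -mulrBr normrM normr_nat.
Qed.

Lemma norm_entry_le (v : 'cV[R[i]]_m) j h : `|v j 0 * conjc (v h 0)| <= (sqn v)%:C.
Proof.
have le2 i : `|v i 0| ^+ 2 <= (sqn v)%:C.
  rewrite -add_Re2_Im2 lecR sqnE (bigD1 i)//= lerDl.
  by rewrite sumr_ge0// => l _; rewrite addr_ge0// sqr_ge0.
have s0 : 0 <= (sqn v)%:C by rewrite ler0c sqn_ge0.
rewrite normrM normcJ -(@ler_pXn2r _ 2)// ?nnegrE ?mulr_ge0// exprMn [leRHS]expr2.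
by rewrite ler_pM// exprn_ge0.
Qed.

Lemma norm_ReIm (z : R[i]) (b : R) : `|z| <= b%:C ->
  `|complex.Re z| <= b /\ `|complex.Im z| <= b.
Proof.
move=> zb; have := @mxbound_entry R 1 1 (const_mx z) b 0 0; rewrite mxE; apply.
by move=> i j; rewrite mxE.
Qed.

Lemma qf_bound Q t v : Qsym Q ->
  `|qf (Qeval Q t) v| <= (\sum_k \sum_j \sum_h `|Q k j h|) * sqn v.
Proof.
move=> Qs; rewrite qf_Qeval// mulr_suml (le_trans (ler_norm_sum _ _ _))//.
apply: ler_sum => k _; rewrite mulr_suml (le_trans (ler_norm_sum _ _ _))//.
apply: ler_sum => j _; rewrite mulr_suml (le_trans (ler_norm_sum _ _ _))//.
apply: ler_sum => h _; rewrite normrM ler_wpM2l//.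
by apply: norm_Re_expi; exact: norm_entry_le.
Qed.

(** The constant does not depend on [v] or on [Q] beyond the bound [B], as a uniform blow-up
    argument requires. The factor 2 comes from treating cosines and sines separately. *)
Lemma qf_lipschitz Q (B t t' : R) v : Qsym Q -> (forall k j h, `|Q k j h| <= B) ->
  sqn v = 1 -> `|qf (Qeval Q t) v - qf (Qeval Q t') v| <=
  (\sum_(k < n.+1) \sum_(j < m) \sum_(h < m) B * (2 * k%:R)) * `|t - t'|.
Proof.
move=> Qs QB v1; apply: (eq_le_trans (f_equal2 (fun a b => `|a - b|) (qf_Qeval t v Qs) (qf_Qeval t' v Qs))).
rewrite -sumrB mulr_suml (le_trans (ler_norm_sum _ _ _))//.
apply: ler_sum => k _; rewrite -sumrB mulr_suml (le_trans (ler_norm_sum _ _ _))//.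
apply: ler_sum => j _; rewrite -sumrB mulr_suml (le_trans (ler_norm_sum _ _ _))//.
apply: ler_sum => h _; rewrite -mulrBr normrM -mulrA ler_pM//.
have := norm_entry_le v j h; rewrite v1 => /norm_ReIm[].
move: (v j 0 * _) => z z1 z2; rewrite !cReM /expi /=.
rewrite (_ : _ - _ = (cos (k%:R * t) - cos (k%:R * t')) * complex.Re z -
  (sin (k%:R * t) - sin (k%:R * t')) * complex.Im z); last by ring.
rewrite (le_trans (ler_normB _ _))// !normrM.
have e : `|k%:R * t - k%:R * t'| = k%:R * `|t - t'| by rewrite -mulrBr normrM normr_nat.
rewrite (_ : 2 * k%:R * _ = k%:R * `|t - t'| * 1 + k%:R * `|t - t'| * 1); last by ring.
by rewrite -e lerD// ler_pM// ?cosB_le ?sinB_le.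
Qed.

Lemma tr_Phihat p Q t : pospair p Q -> complex.Re (\tr (Phihat p Q t)) =
  pe p t * complex.Re (\tr (invmx (Qeval Q t))).
Proof. by move=> hi; rewrite (PhihatE hi) mxtraceZ cReZ. Qed.

Lemma pairQ_id (S : 'I_n.+1 -> 'M[R]_m) : pairQ (cstQ 1%:M) S = \sum_j S ord0 j j.
Proof.
rewrite /pairQ (bigD1 ord0)//= [X in _ + X]big1 ?addr0 => [|k /negPf k0]; last first.
  by rewrite big1// => j _; rewrite big1// => h _; rewrite /cstQ k0 mxE mul0r.
apply: eq_bigr => j _; rewrite (bigD1 j)//= big1 ?addr0 => [|h hj].
  by rewrite /cstQ eqxx mxE eqxx mul1r.
by rewrite /cstQ eqxx mxE eq_sym (negPf hj) mul0r.
Qed.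

End Periodicity.

(** * Interior minimizers *)

Section Minimizer.
Variables (R : realType) (n m : nat) (E : rel 'I_m) (Erefl : forall j, E j j).
Variables (Rk : 'I_n.+1 -> 'M[R]_m) (c : 'I_n.+1 -> R) (lam : R).
Hypothesis lam0 : 0 < lam.
Hypothesis coer : forall l : R, 0 <= l -> exists C, forall p Q,
  pospair p Q -> cone E 0 p Q -> C + 2^-1 * pairQ Q Rk <= Jreal l Rk c p Q.
Hypothesis bnd : exists2 k, 0 < k & forall (p : 'I_n.+1 -> R) (Q : 'I_n.+1 -> 'M[R]_m),
  cone E 0 p Q ->
  (forall i, k * `|p i| <= p ord0) /\ (forall i j h, k * `|Q i j h| <= pairQ Q Rk).
Hypothesis pos : forall (p : 'I_n.+1 -> R) (Q : 'I_n.+1 -> 'M[R]_m),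
  cone E 0 p Q -> 0 <= pairQ Q Rk.
Implicit Types (p : 'I_n.+1 -> R) (Q : 'I_n.+1 -> 'M[R]_m).
Local Notation J := (Jreal lam Rk c).
Local Notation G := (Gaff lam Rk c).

Lemma cone_le (s s' : R) p Q : s' <= s -> cone E s p Q -> cone E s' p Q.
Proof.
move=> ss [Qs Q0 pp qq]; split=> // [t|t v]; first exact: le_trans (pp t).
by apply: le_trans (qq t v); rewrite ler_wpM2r// sqn_ge0.
Qed.

(** With [Q1], a reference point common to all slices with s <= 1: its value bounds that of every
    minimizer, uniformly in [s]. *)
Let p1 : 'I_n.+1 -> R := cstp 1.
Let Q1 : 'I_n.+1 -> 'M[R]_m := cstQ 1%:M.

Lemma cone1 (s : R) : s <= 1 -> cone E s p1 Q1.
Proof. by move=> s1; apply: cone_cst. Qed.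

Lemma p10 : p1 ord0 = 1.
Proof. by rewrite /p1 /cstp eqxx. Qed.

Lemma level_bounds : exists B C : R, [/\ 0 <= B & forall p Q, pospair p Q -> cone E 0 p Q ->
  J p Q <= J p1 Q1 -> [/\ forall k, `|p k| <= B, forall k j h, `|Q k j h| <= B &
    IT (fun t => (pe p t)^-1) <= C]].
Proof.
have [k k0 hk] := bnd.
have [C hC] := coer (ltW lam0).
(* Coercivity for half the weight leaves the other half of the barrier, which is thereby bounded. *)
have lam2 : 0 <= lam / 2 by rewrite divr_ge0// ltW.
have [D hD] := coer lam2.
pose B := k^-1 + `|2 * (J p1 Q1 - C)| / k.
have B0 : 0 <= `|2 * (J p1 Q1 - C)| / k by rewrite divr_ge0// ltW.
exists B, (2 * (J p1 Q1 - D) / lam); split.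
  by rewrite addr_ge0// invr_ge0 ltW.
move=> p Q hi hc hJ; have [h1 h2] := hk _ _ hc; have S0 := pos hc.
have [p0 _ _ _] := hi.
have S1 : pairQ Q Rk <= `|2 * (J p1 Q1 - C)|.
  apply: le_trans (ler_norm _); have := le_trans (hC _ _ hi hc) hJ; lra.
split.
- move=> i; have := h1 i; rewrite p0 -ler_pdivlMl// mulr1 => /le_trans; apply.
  by rewrite lerDl.
- move=> i j h; have := le_trans (h2 i j h) S1; rewrite -ler_pdivlMl// mulrC.
  by move=> /le_trans; apply; rewrite lerDr invr_ge0 ltW.
- have := hD _ _ hi hc; rewrite ler_pdivlMr//.
  move: hJ; rewrite /Jreal; move: (IT (fun t => (pe p t)^-1)) => x; lra.
Qed.

Lemma Gaff_diff ph Qh p Q p' Q' : G ph Qh p' Q' - G ph Qh p Q =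
  \sum_k (p' k - p k) * (Amom lam ph Qh k - c k) +
  \sum_k \sum_j \sum_h (Q' k j h - Q k j h) * (Rk k j h - Bmom ph Qh k j h).
Proof.
rewrite /Gaff /pairQ.
have -> : \sum_k (p' k - p k) * (Amom lam ph Qh k - c k) =
    \sum_k p' k * (Amom lam ph Qh k - c k) - \sum_k p k * (Amom lam ph Qh k - c k).
  by rewrite -sumrB; apply: eq_bigr => k _; rewrite mulrBl.
have -> : \sum_k \sum_j \sum_h (Q' k j h - Q k j h) * (Rk k j h - Bmom ph Qh k j h) =
    (pairQ Q' Rk - pairQ Q' (Bmom ph Qh)) - (pairQ Q Rk - pairQ Q (Bmom ph Qh)).
  rewrite /pairQ -!sumrB; apply: eq_bigr => k _; rewrite -!sumrB.
  by apply: eq_bigr => j _; rewrite -!sumrB; apply: eq_bigr => h _; ring.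
rewrite /pairQ; ring.
Qed.

(** The box of size [B] supplies compactness and loses nothing: it contains every point at or below
    the level of the reference pair, and the other points are beaten by that pair. *)
Lemma exists_min (s : R) : 0 < s -> s <= 1 -> exists p Q, [/\ p ord0 = 1, cone E s p Q &
  forall p' Q', p' ord0 = 1 -> cone E s p' Q' -> J p Q <= J p' Q'].
Proof.
move=> s0 s1; have [B [C [B0 hB]]] := level_bounds.
pose K (x : coord n m -> R) := (x (inl ord0) = 1 /\ cone E s (px x) (Qx x)) /\
  ((forall i, x i <= B) /\ (forall i, - B <= x i)).
have hK : halfspaces K.
  apply: halfspaces_and.
    by apply: halfspaces_and; [exact: halfspaces_eqc|exact: halfspaces_cone].
  by apply: halfspaces_and; apply: halfspaces_all => i;
    [exact: halfspaces_le|exact: halfspaces_ge].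
have inK p Q : p ord0 = 1 -> cone E s p Q -> J p Q <= J p1 Q1 -> K (mkx p Q).
  move=> p0 hc hJ; have hi := cone_pospair s0 p0 hc.
  have [h1 h2 _] := hB _ _ hi (cone_le (ltW s0) hc) hJ.
  split; first by split; [exact: p0|rewrite px_mkx Qx_mkx].
  have h i : `|mkx p Q i| <= B by case: i => [k|[[k j] h]] /=.
  by split => i; have := h i; rewrite ler_norml => /andP[].
have K1 : K (mkx p1 Q1) by apply: inK; [exact: p10|exact: cone1|exact: lexx].
pose Jx (x : coord n m -> R) := J (px x) (Qx x).
have Ki x : K x -> pospair (px x) (Qx x).
  by move=> [[x0 hc] _]; exact: (cone_pospair s0 x0 hc).
have [x|xh Kxh|xh Kxh minx] := @lsc_min_exists R (coord n m) K Jx B _ B0 hK K1.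
- by move=> [_ [h1 h2]] i; rewrite ler_norml h1 h2.
- exists (fun i => match i with
    | inl k => Amom lam (px xh) (Qx xh) k - c k
    | inr (k, j, h) => Rk k j h - Bmom (px xh) (Qx xh) k j h end).
  move=> x Kx; have le1 := Gaff_le Rk c (ltW lam0) (Ki _ Kxh) (Ki _ Kx).
  apply: le_trans le1; rewrite /Jx -(Gaff_refl lam Rk c (Ki _ Kxh)).
  rewrite -lerBrDl Gaff_diff sum_coord /= le_eqVlt; apply/orP; left; apply/eqP.
  congr (_ + _); first by apply: eq_bigr => k _; rewrite mulrC.
  by do 3 (apply: eq_bigr => ? _); rewrite !mxE mulrC.
exists (px xh), (Qx xh); have [[x0 hc] _] := Kxh; split=> // p' Q' p0' hc'.
have [le1|/ltW gt1] := leP (J p' Q') (J p1 Q1).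
  by have := minx _ (inK _ _ p0' hc' le1); rewrite /Jx px_mkx Qx_mkx.
apply: le_trans gt1.
by have := minx _ K1; rewrite /Jx px_mkx Qx_mkx.
Qed.

Definition minimizer (s : R) p Q := [/\ p ord0 = 1, cone E s p Q &
  forall p' Q', p' ord0 = 1 -> cone E s p' Q' -> J p Q <= J p' Q'].

(** The tangent is taken at the competitor: its value at [(p, Q)] is at most J(p, Q), hence at most
    J(p', Q'), which is its own value at [(p', Q')]. No limit is taken, but the gradient sits at the
    displaced point. *)
Lemma first_order p Q p' Q' : pospair p Q -> pospair p' Q' -> J p Q <= J p' Q' ->
  0 <= \sum_k (p' k - p k) * (Amom lam p' Q' k - c k) +
  \sum_k \sum_j \sum_h (Q' k j h - Q k j h) * (Rk k j h - Bmom p' Q' k j h).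
Proof.
move=> hi hi' le1; rewrite -Gaff_diff subr_ge0 (Gaff_refl lam Rk c hi').
by apply: le_trans le1; exact: Gaff_le (ltW lam0) hi' hi.
Qed.

Lemma IT_trPhi p Q : pospair p Q -> itg (fun t => complex.Re (\tr (Phihat p Q t))) /\
  IT (fun t => complex.Re (\tr (Phihat p Q t))) = \sum_j Bmom p Q ord0 j j.
Proof.
move=> hi.
have ib j : itg (fun t => complex.Re (Phihat p Q t j j)).
  by apply: itg_cts; case: (ctsM_Phihat hi j j).
have e t : complex.Re (\tr (Phihat p Q t)) = \sum_j complex.Re (Phihat p Q t j j).
  by rewrite /mxtrace cRe_sum.
split; first by apply: eq_itg (itg_sum ib) => t _; rewrite e.
rewrite (@eq_IT _ _ (fun t => \sum_j complex.Re (Phihat p Q t j j))) => [|t _]; last exact: e.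
rewrite IT_sum//; apply: eq_bigr => j _; rewrite mxE; apply: eq_IT => t _.
by rewrite mul0r expi0 mul1r.
Qed.

(* Moving [Q] along the identity is always admissible; first-order optimality then
   bounds the integral of [tr (p (Q + s I)^-1)], which keeps [Q + s I] away from
   singular matrices uniformly in [s]. *)
Lemma minimizer_lower_bound : exists2 d, 0 < d & forall s p Q, 0 < s -> s <= 1 ->
  minimizer s p Q -> (forall t, d <= pe p t) /\
    (forall t v, (d - s) * sqn v <= qf (Qeval Q t) v).
Proof.
have [B [C1 [B0 hB]]] := level_bounds.
(* Dominates the Lipschitz constants of [p] and of the forms of [Q] on unit vectors; the 1 makes it
   positive. *)
pose L := 1 + (\sum_(k < n.+1) B * k%:R) +
  \sum_(k < n.+1) \sum_(j < m) \sum_(h < m) B * (2 * k%:R).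
have La : 0 <= \sum_(k < n.+1) B * k%:R by apply: sumr_ge0 => k _; rewrite mulr_ge0.
have Lb : 0 <= \sum_(k < n.+1) \sum_(j < m) \sum_(h < m) B * (2 * k%:R).
  by do 3 (apply: sumr_ge0 => ? _); rewrite !mulr_ge0.
have L0 : 0 < L by rewrite /L; move: La Lb; lra.
have LLa : \sum_(k < n.+1) B * k%:R <= L by rewrite /L; move: La Lb; lra.
have LLb : \sum_(k < n.+1) \sum_(j < m) \sum_(h < m) B * (2 * k%:R) <= L.
  by rewrite /L; move: La Lb; lra.
have [d1 d10 h1] := IT_inv_lower C1 L0.
pose T := \sum_j Rk ord0 j j.
have [d2 d20 h2] := IT_inv_lower (d1^-1 * T) L0.
exists (Num.min d1 d2); first by rewrite lt_min d10.
move=> s p Q s0 s1 [p0 hc hmin].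
have hi := cone_pospair s0 p0 hc; have [_ Qs pp QQ] := hi.
have [] := hB _ _ hi (cone_le (ltW s0) hc) (hmin _ _ p10 (cone1 s1)) => pB QB IB.
have le_d1 t : d1 <= pe p t.
  have [t0 Tt0 e] := Tset_repr t; rewrite (pe_repr p e).
  apply: (h1 (pe p) (fun t => (pe p t)^-1) t0 Tt0 pp _ _ (fun u => lexx _) IB).
    move=> u; apply: (le_trans (pe_lipschitz u t0 pB)).
    exact: (ler_wpM2r (normr_ge0 _) LLa).
  by apply: itg_cts; exact: continuous_pV hi.
split; first by move=> t; rewrite ge_min le_d1.
pose Q' k := 1 *: Q k + s *: (cstQ 1%:M : 'I_n.+1 -> 'M[R]_m) k.
have Qs1 : Qsym (cstQ 1%:M : 'I_n.+1 -> 'M[R]_m) by apply: Qsym_cstQ; exact: tr_scalar_mx.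
have qfQ' t v : qf (Qeval Q' t) v = qf (Qeval Q t) v + s * sqn v.
  apply: (etrans (qf_lin 1 s t v Qs Qs1)); apply: (f_equal2 +%R (mul1r _)).
  by apply: (f_equal ( *%R s)); rewrite Qeval_scalar qf_scalar mul1r.
have hc' : cone E s p Q'.
  have [_ Q0 ps qs] := hc; split; [exact: (Qsym_lin 1 s Qs Qs1)| |exact: ps|].
    move=> k j h nE; rewrite mxE [X in X + _]mxE [X in _ + X]mxE Q0// mulr0 add0r.
    have [_ z0 _ _] := @cone1 0 ler01.
    by have := z0 k j h nE; rewrite /Q1 => ->; rewrite mulr0.
  move=> t v; rewrite (qfQ' t v); apply: (le_trans (qs t v)).
  by rewrite lerDl mulr_ge0 ?sqn_ge0 ?(ltW s0).
have hi' := cone_pospair s0 p0 hc'.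
have := first_order hi hi' (hmin _ _ p0 hc').
rewrite big1 ?add0r => [|k _]; last by rewrite subrr mul0r.
have -> : \sum_k \sum_j \sum_h (Q' k j h - Q k j h) * (Rk k j h - Bmom p Q' k j h) =
    s * (pairQ (cstQ 1%:M) Rk - pairQ (cstQ 1%:M) (Bmom p Q')).
  rewrite /pairQ -sumrB mulr_sumr; apply: eq_bigr => k _.
  rewrite -sumrB mulr_sumr; apply: eq_bigr => j _.
  rewrite -sumrB mulr_sumr; apply: eq_bigr => h _.
  rewrite /Q' mxE [X in X + _ - _]mxE [X in _ + X - _]mxE; ring.
(* The inequality in the direction [s I] now reads: the integral of the trace of the density of [Q']
   is at most [T], the trace of [Rk ord0]. *)
rewrite pmulr_rge0// subr_ge0 !pairQ_id -/T.
have [itr <-] := IT_trPhi hi' => leT.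
move=> t; apply: qf_ge_unit => v v1.
have [t0 Tt0 e] := Tset_repr t; have e0 := qf_repr v Qs e.
have [_ _ _ QQ'] := hi'.
have v0 : v != 0.
  by apply: contra_eq_neq v1 => ->; rewrite /sqn qf0 eq_sym oner_eq0.
have q0 u : 0 < qf (Qeval Q' u) v by have /posdefCE[_ ->] := QQ' u.
have lip u : `|qf (Qeval Q' u) v - qf (Qeval Q' t0) v| <= L * `|u - t0|.
  apply: (eq_le_trans (f_equal2 (fun a b => `|a - b|) (qfQ' u v) (qfQ' t0 v))).
  apply: (eq_le_trans (f_equal Num.norm (addr_diff _ _ _))).
  apply: (le_trans (qf_lipschitz u t0 Qs QB v1)).
  exact: (ler_wpM2r (normr_ge0 _) LLb).
(* The trace of the inverse bounds the inverse of the form at any unit vector, and [d1 <= p] trades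
   this trace for that of the density. *)
have ginv u : (qf (Qeval Q' u) v)^-1 <= d1^-1 * complex.Re (\tr (Phihat p Q' u)).
  have h := tr_inv_ge (QQ' u) v1; apply: (le_trans h).
  rewrite (tr_Phihat u hi'); apply: (le_scaled d10 (le_d1 u)).
  by apply: le_trans h; rewrite invr_ge0; exact: ltW (q0 u).
have leT' : IT (fun u => d1^-1 * complex.Re (\tr (Phihat p Q' u))) <= d1^-1 * T.
  by rewrite (ITZ d1^-1 itr) ler_pM2l ?invr_gt0.
have e1 : qf (Qeval Q' t0) v = qf (Qeval Q t) v + s.
  apply: (etrans (qfQ' t0 v)); apply: (f_equal2 +%R (esym e0)).
  exact: (etrans (f_equal ( *%R s) v1) (mulr1 s)).
have h := le_trans (h2 _ _ _ Tt0 q0 lip (itgZ d1^-1 itr) ginv leT') (eq_ler e1).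
by rewrite lerBlDr; apply: le_trans h; rewrite ge_min lexx orbT.
Qed.

Lemma exists_interior_min : exists s p Q, [/\ 0 < s, minimizer s p Q & cone E (2 * s) p Q].
Proof.
have [d d0 hd] := minimizer_lower_bound.
(* With 3 s <= d, both [d] and [d - s] are at least 2 s: the minimizer clears its own constraint by
   a margin [s]. *)
pose s := Num.min 1 (d / 3).
have s0 : 0 < s by rewrite lt_min ltr01 divr_gt0.
have s1 : s <= 1 by rewrite ge_min lexx.
have sd : 3 * s <= d.
  have : s <= d / 3 by rewrite ge_min lexx orbT.
  lra.
have [p [Q hm]] := exists_min s0 s1.
exists s, p, Q; split=> //; have [p0 [Qs Q0 _ _] _] := hm.
have [h1 h2] := hd _ _ _ s0 s1 hm; split=> //.
  by move=> t; apply: le_trans (h1 t); lra.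
by move=> t v; apply: le_trans (h2 t v); rewrite ler_wpM2r ?sqn_ge0//; lra.
Qed.

End Minimizer.

(** * Stationarity *)

Section PerturbationBounds.
Variables (R : realType) (n m : nat).
Implicit Types (p : 'I_n.+1 -> R) (Q : 'I_n.+1 -> 'M[R]_m).

(** Letting r tend to 0 without limits; it serves the vanishing of the gradient and also the passage
    to the closure. *)
Lemma ge0_of_lin (a C r0 : R) : 0 < r0 -> (forall r, 0 < r -> r <= r0 -> 0 <= a + C * r) ->
  0 <= a.
Proof.
move=> r00 h; rewrite leNgt; apply/negP => a0.
(* Small enough that C r cannot make up for half of -a; the added 1 keeps the denominator
   positive. *)
pose r := Num.min r0 (- a / (2 * (`|C| + 1))).
have C1 : 0 < `|C| + 1 by rewrite ltr_wpDl.
have r_gt0 : 0 < r by rewrite lt_min r00 divr_gt0 ?mulr_gt0 ?oppr_gt0.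
have := h r r_gt0; rewrite ge_min lexx => /(_ isT).
have : r <= - a / (2 * (`|C| + 1)) by rewrite ge_min lexx orbT.
rewrite ler_pdivlMr ?mulr_gt0// => h1.
have := ler_norm C => h2.
have : C * r <= (`|C| + 1) * r by rewrite ler_pM2r//; lra.
move: h1; rewrite mulrCA; lra.
Qed.

Lemma lin_lower (s x y d z r : R) : 0 < r -> r * d <= s -> 2 * s * z <= y -> 0 <= z ->
  `|x| <= d * z -> s * z <= 1 * y + r * x.
Proof.
move=> r0 h0 h2 z0; rewrite ler_norml => /andP[h1 _].
have : r * - (d * z) <= r * x by rewrite ler_pM2l.
have : r * d * z <= s * z by rewrite ler_wpM2r.
rewrite mulrN mulrA; move: h2; lra.
Qed.

Lemma ln_lipschitz (s a b : R) : 0 < s -> s <= a -> s <= b ->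
  `|ln a - ln b| <= `|a - b| / s.
Proof.
move=> s0; wlog ba : a b / b <= a => [h sa sb|sa sb].
  have [/h|/ltW/h] := leP b a; first by apply.
  by move=> /(_ sb sa); rewrite distrC (distrC b).
have b0 := lt_le_trans s0 sb; have a0 := lt_le_trans s0 sa.
rewrite !ger0_norm ?subr_ge0 ?ler_ln ?posrE//.
rewrite -ln_div ?posrE// (_ : a / b = 1 + (a - b) / b); last by field; rewrite gt_eqF.
have ab0 : 0 <= (a - b) / b by rewrite divr_ge0 ?subr_ge0// ltW.
apply: (le_trans (le_ln1Dx _)); first by rewrite (lt_le_trans _ ab0)// ltrN10.
by rewrite ler_wpM2l ?subr_ge0// lef_pV2 ?posrE.
Qed.

Lemma invsq_lipschitz (s a b : R) : 0 < s -> s <= a -> s <= b ->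
  `|a ^- 2 - b ^- 2| <= `|a - b| * (2 / s ^+ 3).
Proof.
move=> s0 sa sb; have b0 := lt_le_trans s0 sb; have a0 := lt_le_trans s0 sa.
have a1 : a != 0 by rewrite gt_eqF. have b1 : b != 0 by rewrite gt_eqF.
have s1 : s != 0 by rewrite gt_eqF.
have -> : a ^- 2 - b ^- 2 = (b - a) * (a ^- 2 * b^-1 + a^-1 * b ^- 2).
  by field; rewrite a1 b1.
rewrite normrM distrC ler_wpM2l//.
have ia : a^-1 <= s^-1 by rewrite lef_pV2 ?posrE.
have ib : b^-1 <= s^-1 by rewrite lef_pV2 ?posrE.
have ia0 : 0 <= a^-1 by rewrite invr_ge0 ltW. have ib0 : 0 <= b^-1 by rewrite invr_ge0 ltW.
have is0 : 0 <= s^-1 by rewrite invr_ge0 ltW.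
rewrite -!exprVn ger0_norm; last by rewrite addr_ge0// mulr_ge0// exprn_ge0.
rewrite (_ : 2 * s^-1 ^+ 3 = s^-1 ^+ 2 * s^-1 + s^-1 * s^-1 ^+ 2); last by ring.
by rewrite lerD// ler_pM ?exprn_ge0// lerXn2r.
Qed.

Lemma invmx_diff (A B : 'M[R[i]]_m) : A \in unitmx -> B \in unitmx ->
  invmx A - invmx B = invmx A *m (B - A) *m invmx B.
Proof.
move=> Au Bu; rewrite mulmxBr mulmxBl mulVmx// -mulmxA mulmxV// mulmx1 mul1mx.
by [].
Qed.

Lemma mxbound_inv (A : 'M[R[i]]_m) (s : R) : posdefC A -> 0 < s ->
  (forall v, s * sqn v <= qf A v) -> mxbound (invmx A) (m%:R * s^-1).
Proof.
move=> hA s0 h; apply: mxbound_psd; first exact/posdefC_psdC/posdef_inv.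
by move=> v; rewrite mulrC; exact: qf_inv_le.
Qed.

Lemma norm_expiM (t : R) (z : R[i]) : `|expi t * z| = `|z|.
Proof. by rewrite normrM (_ : `|expi t| = 1) ?mul1r// /expi normc_def /= cos2Dsin2 sqrtr1. Qed.

(** Resolvent identity; the powers of [m] come from two matrix products and two entrywise bounds on
    inverses. *)
Lemma inv_perturb (A B X : 'M[R[i]]_m) (s r z x P : R) j h :
  posdefC A -> posdefC B -> 0 < s -> (forall v, s * sqn v <= qf A v) ->
  (forall v, s * sqn v <= qf B v) -> mxbound X x -> B = A + r%:C *: X ->
  0 <= r -> 0 <= z -> z <= P ->
  `|(z%:C *: invmx A) j h - (z%:C *: invmx B) j h| <=
  (r * (P * (m%:R * ((m%:R * ((m%:R * s^-1) * x)) * (m%:R * s^-1)))))%:C.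
Proof.
move=> hA hB s0 sA sB bX BE r0 z0 zP.
have bM := mxbound_mul (mxbound_mul (mxbound_inv hA s0 sA) bX) (mxbound_inv hB s0 sB).
have : invmx A - invmx B = r%:C *: (invmx A *m X *m invmx B).
  rewrite (invmx_diff (posdef_unit hA) (posdef_unit hB)).
  have -> : B - A = r%:C *: X by rewrite BE addrAC subrr add0r.
  by rewrite -scalemxAr -scalemxAl.
move=> AB.
have eAB : invmx A j h - invmx B j h = r%:C * (invmx A *m X *m invmx B) j h.
  by apply: (@etrans _ _ ((invmx A - invmx B) j h)); [rewrite !mxE|rewrite AB mxE].
rewrite [X in X - _]mxE [X in _ - X]mxE -mulrBr eAB.
rewrite normrM [X in _ * X]normrM.
have -> : `|z%:C| = z%:C by rewrite ger0_norm// ler0c.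
have -> : `|r%:C| = r%:C by rewrite ger0_norm// ler0c.
rewrite mulrCA [leRHS](rmorphM (real_complex R)) ler_wpM2l ?ler0c//.
rewrite [leRHS](rmorphM (real_complex R)).
apply: ler_pM; [by rewrite ler0c|exact: normr_ge0|by rewrite lecR|exact: bM].
Qed.

Lemma mxbound_Qeval Q t : Qsym Q -> mxbound (Qeval Q t) (\sum_k \sum_j \sum_h `|Q k j h|).
Proof.
move=> Qs j h; set D := \sum_k _.
have leD j' h' : \sum_k `|Q k j' h'| <= D.
  apply: ler_sum => k _; rewrite (bigD1 j')//= (bigD1 h')//= -addrA lerDl.
  by rewrite addr_ge0 ?sumr_ge0// => a _; rewrite sumr_ge0.
rewrite (Qeval_entry t j h Qs) normrM.
have -> : `|(2^-1)%:C| = (2^-1)%:C :> R[i] by rewrite ger0_norm// ler0c invr_ge0.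
rewrite -[X in X * _]/((2^-1 : R)%:C).
apply: (@le_trans _ _ ((2^-1)%:C * (\sum_k `|Q k j h| + \sum_k `|Q k h j|)%:C)).
  rewrite ler_wpM2l ?ler0c ?invr_ge0// (le_trans (ler_norm_sum _ _ _))//.
  rewrite -big_split rmorph_sum; apply: ler_sum => k _ /=.
  rewrite (le_trans (ler_normD _ _))// !norm_expiM rmorphD /=.
  by rewrite !normc_def /= expr0n /= !addr0 !sqrtr_sqr.
rewrite -rmorphM lecR; have := leD j h; have := leD h j; lra.
Qed.

(** Separates [p] from [Q], so that a variation of [p] alone leaves the determinant untouched. *)
Lemma lnPhiE p Q t : pospair p Q -> lnPhi p Q t =
  m%:R * ln (pe p t) + ln (complex.Re (\det (invmx (Qeval Q t)))).
Proof.
move=> hi; have [_ _ p0 Q0] := hi.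
have [d0 dE] := posdef_det (posdef_inv (Q0 t)).
rewrite /lnPhi (PhihatE hi) detZ dE -rmorphXn -rmorphM /=.
by rewrite lnM ?posrE ?exprn_gt0// lnXn// mulr_natl.
Qed.

End PerturbationBounds.

(** * Vanishing of the gradient at an interior minimizer *)

Section Stationarity.
Variables (R : realType) (n m : nat) (E : rel 'I_m).
Hypothesis Esym : forall j h, E j h = E h j.
Variables (Rk : 'I_n.+1 -> 'M[R]_m) (hR0 : (Rk ord0)^T = Rk ord0).
Variables (c : 'I_n.+1 -> R) (lam : R).
Hypothesis lam0 : 0 < lam.
Variables (s : R) (p : 'I_n.+1 -> R) (Q : 'I_n.+1 -> 'M[R]_m).
Hypothesis s0 : 0 < s.
Hypothesis hmin : minimizer E Rk c lam s p Q.
Hypothesis hint : cone E (2 * s) p Q.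

Lemma min_pospair : pospair p Q.
Proof. by have [p0 hc _] := hmin; exact: (cone_pospair s0 p0 hc). Qed.

Section Direction.
Variables (dp : 'I_n.+1 -> R) (dQ : 'I_n.+1 -> 'M[R]_m).
Hypothesis dp0 : dp ord0 = 0.
Hypothesis dQs : Qsym dQ.
Hypothesis dQ0 : forall k j h, ~~ E j h -> dQ k j h = 0.

Let pr (r : R) : 'I_n.+1 -> R := fun k => 1 * p k + r * dp k.
Let Qr (r : R) : 'I_n.+1 -> 'M[R]_m := fun k => 1 *: Q k + r *: dQ k.

(** The bound 2 s leaves a margin [s], which a small multiple of the direction cannot exhaust. *)
Lemma admissible : exists2 r0 : R, 0 < r0 & forall r : R, 0 < r -> r <= r0 ->
  [/\ pr r ord0 = 1, cone E s (pr r) (Qr r) & pospair (pr r) (Qr r)].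
Proof.
have [r0 r00 hr0] : exists2 r0 : R, 0 < r0 & forall r : R, 0 < r -> r <= r0 ->
    r * (\sum_k `|dp k|) <= s /\ r * (\sum_k \sum_j \sum_h `|dQ k j h|) <= s.
  have : 0 <= \sum_k `|dp k| by apply: sumr_ge0 => k _.
  have : 0 <= \sum_k \sum_j \sum_h `|dQ k j h| by do 3 (apply: sumr_ge0 => ? _).
  move: (\sum_k `|dp k|) (\sum_k \sum_j \sum_h `|dQ k j h|) => x y y0 x0.
  have D1 : 0 < x + y + 1 by move: x0 y0; lra.
  exists (s / (x + y + 1)); first by rewrite divr_gt0.
  move=> r r_gt0; rewrite ler_pdivlMr// => h.
  by split; apply: le_trans h; rewrite ler_pM2l//; move: x0 y0; lra.
have [Qs Q0 ps qs] := hint; have [p0 _ _] := hmin.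
exists r0; first exact: r00.
move=> r r_gt0 rr0; have [rDa rDb] := hr0 r r_gt0 rr0.
have pr0 : pr r ord0 = 1 by rewrite /pr p0 dp0 mulr0 addr0 mul1r.
have hc : cone E s (pr r) (Qr r).
  split.
  - exact: (Qsym_lin 1 r Qs dQs).
  - by move=> k j h nE; rewrite !mxE Q0// dQ0// !mulr0 addr0.
  - move=> t; have := ps t; have := pe_bound dp t.
    have -> : pe (pr r) t = pe p t + r * pe dp t by rewrite pe_lin mul1r.
    move: (pe dp t) (pe p t) (\sum_k `|dp k|) rDa => x y z h0.
    rewrite ler_norml => /andP[h1 _] h2.
    have : r * - z <= r * x by rewrite ler_pM2l.
    rewrite mulrN; lra.
  - move=> t v; apply: (le_trans _ (eq_ler (esym (qf_lin 1 r t v Qs dQs)))).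
    exact: lin_lower r_gt0 rDb (qs t v) (sqn_ge0 v) (qf_bound t v dQs).
split; [exact: pr0|exact: hc|exact: (cone_pospair s0 pr0 hc)].
Qed.

Lemma variational : exists2 r0 : R, 0 < r0 & forall r : R, 0 < r -> r <= r0 ->
  [/\ cone E s (pr r) (Qr r), pospair (pr r) (Qr r) &
  0 <= \sum_k dp k * (Amom lam (pr r) (Qr r) k - c k) +
    \sum_k \sum_j \sum_h dQ k j h * (Rk k j h - Bmom (pr r) (Qr r) k j h)].
Proof.
have [r0 r00 h] := admissible; exists r0; first exact: r00.
move=> r r_gt0 rr0.
have [pr0 hc hi] := h r r_gt0 rr0; have [_ _ hm] := hmin.
split; [exact: hc|exact: hi|].
have h1 := first_order lam0 min_pospair hi (hm _ _ pr0 hc).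
rewrite -(pmulr_rge0 _ r_gt0) mulrDr; apply: (le_trans h1); apply: eq_ler.
congr (_ + _).
  rewrite mulr_sumr; apply: eq_bigr => k _.
  have -> : pr r k - p k = r * dp k by rewrite /pr mul1r addrAC subrr add0r.
  exact: esym (mulrA _ _ _).
rewrite mulr_sumr; apply: eq_bigr => k _; rewrite mulr_sumr; apply: eq_bigr => j _.
rewrite mulr_sumr; apply: eq_bigr => h' _.
have -> : Qr r k j h' - Q k j h' = r * dQ k j h'.
  by rewrite /Qr mxE scale1r [X in _ + X - _]mxE addrAC subrr add0r.
exact: esym (mulrA _ _ _).
Qed.

End Direction.

Lemma sum3_perturb (F A B C : 'I_n.+1 -> 'M[R]_m) (K : R) :
  (forall k j h, `|B k j h - C k j h| <= K) ->
  \sum_k \sum_j \sum_h F k j h * (A k j h - C k j h) <=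
  \sum_k \sum_j \sum_h F k j h * (A k j h - B k j h) +
  (\sum_k \sum_j \sum_h `|F k j h|) * K.
Proof.
move=> BC; rewrite mulr_suml -big_split; apply: ler_sum => k _.
rewrite mulr_suml -big_split; apply: ler_sum => j _.
rewrite mulr_suml -big_split; apply: ler_sum => h _ /=.
rewrite -lerBlDl -mulrBr opprB addrC subrKA -opprB mulrN -mulNr.
rewrite (le_trans (ler_norm _))// normrM normrN distrC ler_wpM2l// distrC.
Qed.

(* [first_order] evaluates the gradient at the displaced point [Q + r dQ]; it differs
   from the gradient at [Q] by [O(r)], so let [r] tend to [0]. *)
Lemma stationary_Q_ge0 (dQ : 'I_n.+1 -> 'M[R]_m) : Qsym dQ ->
  (forall k j h, ~~ E j h -> dQ k j h = 0) ->
  0 <= \sum_k \sum_j \sum_h dQ k j h * (Rk k j h - Bmom p Q k j h).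
Proof.
move=> dQs dQ0; have [r0 r00 h] := variational (dp := fun=> 0) erefl dQs dQ0.
have hi := min_pospair; have [_ Qs pp QQ] := hi.
have [_ _ _ qs] := hint.
pose P : R := \sum_k `|p k|; pose D : R := \sum_k \sum_j \sum_h `|dQ k j h|.
have P0 : 0 <= P by apply: sumr_ge0.
pose b : R := m%:R * ((m%:R * ((m%:R * s^-1) * D)) * (m%:R * s^-1)).
apply: (@ge0_of_lin _ _ (D * (P * b)) r0 r00) => r r_gt0 rr0.
have [] := h r r_gt0 rr0.
have -> : (fun k => 1 * p k + r * 0) = p by apply/funext => k; rewrite mul1r mulr0 addr0.
rewrite big1 ?add0r => [|k _]; last by rewrite mul0r.
set Qr := fun k => 1 *: Q k + r *: dQ k => hc hir hv.
have [_ Qrs _ QQr] := hir; have [_ _ _ qrs] := hc.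
apply: (le_trans hv).
have Qrt t : Qeval Qr t = Qeval Q t + r%:C *: Qeval dQ t.
  by apply: (etrans (Qeval_lin 1 r t Qs dQs)); apply: (f_equal2 +%R (scale1r _)).
have bB k j l : `|Bmom p Q k j l - Bmom p Qr k j l| <= r * (P * b).
  rewrite [X in `|X - _|]mxE [X in `|_ - X|]mxE.
  have ib S : pospair p S -> itg (fun t => complex.Re (expi (k%:R * t) * Phihat p S t j l)).
    by move=> hS; apply: itg_cts; case: (ctsCM (ctsC_expi R k) (ctsM_Phihat hS j l)).
  rewrite -ITB; [|exact: ib|exact: ib].
  apply: IT_norm_le; first by apply: itgB; exact: ib.
  move=> t; rewrite -cReB -mulrBr; apply: norm_Re_expi.
  have qs1 v : s * sqn v <= qf (Qeval Q t) v.
    by apply: le_trans (qs t v); rewrite ler_wpM2r ?sqn_ge0//; move: s0; lra.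
  rewrite (PhihatE hi) (PhihatE hir).
  have pP : pe p t <= P by exact: le_trans (ler_norm _) (pe_bound p t).
  have := inv_perturb j l (QQ t) (QQr t) s0 qs1 (qrs t) (mxbound_Qeval t dQs) (Qrt t)
    (ltW r_gt0) (ltW (pp t)) pP.
  exact.
apply: (le_trans (sum3_perturb dQ Rk bB)); rewrite -/D; apply: lerD; first exact: lexx.
by rewrite -mulrA (mulrC (P * b)).
Qed.

(** Same passage to the limit as for [Q]; the gradient is Lipschitz because ln and x^-2 are so on
    [s, +oo). *)
Lemma stationary_p_ge0 (dp : 'I_n.+1 -> R) : dp ord0 = 0 ->
  0 <= \sum_k dp k * (Amom lam p Q k - c k).
Proof.
move=> dp0.
have zs : Qsym ((fun=> 0) : 'I_n.+1 -> 'M[R]_m) by rewrite /Qsym trmx0.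
have z0 : forall (k : 'I_n.+1) j h, ~~ E j h -> ((fun=> 0) : 'I_n.+1 -> 'M[R]_m) k j h = 0.
  by move=> k j h _; rewrite mxE.
have [r0 r00 h] := variational dp0 zs z0.
have hi := min_pospair; have [_ Qs pp QQ] := hi; have [_ _ ps _] := hint.
pose D : R := \sum_k `|dp k|.
pose b : R := m%:R * (D / s) + lam * (D * (2 / s ^+ 3)).
apply: (@ge0_of_lin _ _ (D * b) r0 r00) => r r_gt0 rr0.
have [] := h r r_gt0 rr0.
have -> : (fun k => 1 *: Q k + r *: (0 : 'M[R]_m)) = Q.
  by apply/funext => k; rewrite scale1r scaler0 addr0.
rewrite [X in _ + X]big1 ?addr0 => [|k _]; last first.
  by rewrite big1// => j _; rewrite big1// => l _; rewrite mxE mul0r.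
set pr := fun k => 1 * p k + r * dp k => hc hir hv.
have [_ _ prs _] := hc; have [_ _ ppr _] := hir.
apply: (le_trans hv).
have ps1 t : s <= pe p t by apply: le_trans (ps t); move: s0; lra.
have dpe t : `|pe pr t - pe p t| <= r * D.
  rewrite /pr pe_lin mul1r addrAC subrr add0r normrM gtr0_norm// ler_pM2l//.
  exact: pe_bound.
have bA k : `|Amom lam pr Q k - Amom lam p Q k| <= r * b.
  have ia S : pospair S Q -> itg (fun t => cos (k%:R * t) * (lnPhi S Q t - lam * (pe S t) ^- 2)).
    move=> hS; apply: itg_cts => t; apply: cvgM; first exact: continuous_cosk.
    apply: cvgB; first exact: (continuous_lnPhi hS).
    by apply: cvgM; [exact: cvg_cst|exact: (continuous_pV2 hS)].
  rewrite /Amom -ITB; [|exact: ia|exact: ia].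
  apply: IT_norm_le; first by apply: itgB; exact: ia.
  move=> t; rewrite -mulrBr normrM.
  apply: (@le_trans _ _ (1 * `|(lnPhi pr Q t - lam * pe pr t ^- 2) - (lnPhi p Q t - lam * pe p t ^- 2)|)).
    by apply: ler_wpM2r => //; exact: cos_max.
  rewrite mul1r (lnPhiE t hir) (lnPhiE t hi).
  have h1 := ln_lipschitz s0 (prs t) (ps1 t).
  have h2 := invsq_lipschitz s0 (prs t) (ps1 t).
  have h3 := dpe t.
  move: (ln (complex.Re _)) (ln (pe pr t)) (ln (pe p t)) (pe pr t ^- 2) (pe p t ^- 2) h1 h2.
  move=> w x y u v h1 h2.
  rewrite (_ : _ - _ = m%:R * (x - y) - lam * (u - v)); last by ring.
  rewrite (le_trans (ler_normB _ _))// !normrM (ger0_norm (ler0n _ _)) (gtr0_norm lam0).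
  rewrite /b mulrDr lerD//.
    rewrite [leRHS]mulrCA ler_wpM2l//; apply: (le_trans h1).
    by rewrite [leRHS]mulrA ler_wpM2r// invr_ge0 ltW.
  rewrite [leRHS]mulrCA ler_wpM2l ?(ltW lam0)//; apply: (le_trans h2).
  by rewrite [leRHS]mulrA ler_wpM2r// divr_ge0// exprn_ge0// ltW.
have e : \sum_k dp k * (Amom lam pr Q k - c k) = \sum_k dp k * (Amom lam p Q k - c k) +
    \sum_k dp k * (Amom lam pr Q k - Amom lam p Q k).
  by rewrite -big_split; apply: eq_bigr => k _ /=; ring.
rewrite e lerD2l; apply: (@le_trans _ _ (D * (r * b))).
  rewrite /D mulr_suml; apply: ler_sum => k _.
  by rewrite (le_trans (ler_norm _))// normrM ler_wpM2l.
by rewrite le_eqVlt; apply/orP; left; apply/eqP; ring.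
Qed.

(** For k > 0 both signs of the k-th direction are admissible, only the constant coefficient being
    frozen. *)
Lemma moment_A (k : 'I_n.+1) : (0 < k)%N -> Amom lam p Q k = c k.
Proof.
move=> k0; have kn0 : (ord0 == k) = false by apply/negbTE; rewrite -val_eqE /= neq_ltn k0.
have h (a : R) : 0 <= a * (Amom lam p Q k - c k).
  have := @stationary_p_ge0 (fun i => a * (i == k)%:R); rewrite kn0 mulr0 => /(_ erefl).
  under eq_bigr do rewrite -mulrA.
  by rewrite -mulr_sumr sum_delta.
have := h 1; have := h (-1); rewrite mul1r mulN1r; lra.
Qed.

Lemma stationary_Q (dQ : 'I_n.+1 -> 'M[R]_m) : Qsym dQ ->
  (forall k j h, ~~ E j h -> dQ k j h = 0) ->
  \sum_k \sum_j \sum_h dQ k j h * (Rk k j h - Bmom p Q k j h) = 0.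
Proof.
move=> dQs dQ0; apply/eqP; rewrite eq_le stationary_Q_ge0// andbT.
have := @stationary_Q_ge0 (fun k => - dQ k); rewrite /Qsym linearN /= dQs => /(_ erefl).
have -> : \sum_k \sum_j \sum_h (- dQ k) j h * (Rk k j h - Bmom p Q k j h) =
    - \sum_k \sum_j \sum_h dQ k j h * (Rk k j h - Bmom p Q k j h).
  rewrite -sumrN; apply: eq_bigr => k _; rewrite -sumrN; apply: eq_bigr => j _.
  by rewrite -sumrN; apply: eq_bigr => h _; rewrite mxE mulNr.
rewrite oppr_ge0; apply => k j h nE.
by rewrite mxE dQ0// oppr0.
Qed.

Lemma sum_at (k : 'I_n.+1) (j h : 'I_m) (F : 'I_n.+1 -> 'I_m -> 'I_m -> R) :
  \sum_a \sum_b \sum_d ((a == k) && (b == j) && (d == h))%:R * F a b d = F k j h.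
Proof.
rewrite (bigD1 k)//= (bigD1 j)//= (bigD1 h)//= !eqxx mul1r.
rewrite big1 ?addr0 => [|d /negPf ->]; last by rewrite mul0r.
rewrite big1 ?addr0 => [|b /negPf ->]; last by rewrite big1// => d _; rewrite mul0r.
rewrite big1 ?addr0// => a /negPf ->.
by rewrite big1// => b _; rewrite big1// => d _; rewrite mul0r.
Qed.

(** For k > 0 a single entry may be varied. For k = 0 the direction must be symmetric, so only the
    sum of the gradient entries (j, h) and (h, j) is killed; these agree because [Rk ord0] is
    symmetric and the density hermitian. *)
Lemma moment_B (k : 'I_n.+1) (j h : 'I_m) : E j h -> Bmom p Q k j h = Rk k j h.
Proof.
move=> Ejh; have hi := min_pospair.
pose F a b d := Rk a b d - Bmom p Q a b d.
suff : F k j h = 0 by rewrite /F; lra.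
have [k0|k0] := posnP k; last first.
  pose dQ (a : 'I_n.+1) : 'M[R]_m := \matrix_(b, d) ((a == k) && (b == j) && (d == h))%:R.
  have kn0 : (ord0 == k) = false by apply/negbTE; rewrite -val_eqE /= neq_ltn k0.
  have dQs : Qsym dQ by apply/matrixP => b d; rewrite !mxE kn0.
  have dQ0 a b d : ~~ E b d -> dQ a b d = 0.
    rewrite mxE; apply: contraNeq.
    by rewrite pnatr_eq0 eqb0 negbK => /andP[/andP[_ /eqP->] /eqP->].
  have e := stationary_Q dQs dQ0.
  rewrite -(sum_at k j h F) -[RHS]e; do 3 (apply: eq_bigr => ? _).
  by rewrite [X in _ = X * _]mxE.
have {k0} -> : k = ord0 by apply: val_inj.
pose dQ (a : 'I_n.+1) : 'M[R]_m := \matrix_(b, d) (((a == ord0) && (b == j) && (d == h))%:R +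
  ((a == ord0) && (b == h) && (d == j))%:R).
have dQs : Qsym dQ.
  apply/matrixP => b d; rewrite !mxE eqxx /= addrC.
  by congr ((_ : bool)%:R + (_ : bool)%:R); rewrite andbC.
have Fs : F ord0 h j = F ord0 j h.
  rewrite /F -{1}hR0 mxE; congr (_ - _); rewrite !mxE; apply: eq_IT => t _.
  rewrite mul0r expi0 !mul1r -{1}(Phihat_herm hi t) adjCE.
  by case: (Phihat p Q t j h).
have dQ0 a b d : ~~ E b d -> dQ a b d = 0.
  rewrite mxE; apply: contraNeq => /eqP e.
  have [/andP[/andP[_ /eqP->] /eqP->]//|n1] := boolP ((a == ord0) && (b == j) && (d == h)).
  have [/andP[/andP[_ /eqP->] /eqP->]|n2] := boolP ((a == ord0) && (b == h) && (d == j)).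
    by rewrite Esym.
  by exfalso; apply: e; rewrite (negPf n1) (negPf n2) addr0.
have e := stationary_Q dQs dQ0.
have : F ord0 j h + F ord0 h j = 0.
  rewrite -(sum_at ord0 j h F) -(sum_at ord0 h j F) -[RHS]e -big_split.
  apply: eq_bigr => a _; rewrite -big_split; apply: eq_bigr => b _.
  rewrite -big_split; apply: eq_bigr => d _ /=.
  by rewrite [X in _ = X * _]mxE mulrDl.
rewrite Fs; lra.
Qed.

End Stationarity.

(** * Global minimality and uniqueness *)

Section Closure.
Variables (R : realType) (n m : nat) (E : rel 'I_m).
Local Notation mu := (@lebesgue_measure R).
Implicit Types (p : 'I_n.+1 -> R) (Q : 'I_n.+1 -> 'M[R]_m).

(** Each closed condition is written as nonnegativity of a quantity that an r-close point of the
    open set makes at least a multiple of -r; [ge0_of_lin] concludes. *)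
Lemma Bo_clP p : Bo_cl p -> p ord0 = 1 /\ forall t, Tset t -> 0 <= pe p t.
Proof.
move=> hp; have p0 : p ord0 = 1.
  apply/eqP; rewrite eq_sym -subr_eq0 -normr_le0 -oppr_ge0.
  apply: (@ge0_of_lin _ _ 1 1) => // r r0 _; have [p' [[p'0 _] h]] := hp r r0.
  have e := h ord0; rewrite p'0 in e; rewrite mul1r [leRHS]addrC subr_ge0; exact: ltW.
split=> // t /TsetP Tt; apply: (@ge0_of_lin _ _ n.+1%:R 1) => // r r0 _.
have [p' [[p'0 pos] h]] := hp r r0.
have := pos t Tt; rewrite peval_pe// => h1.
have := pe_bound (fun k => 1 * p' k + (-1) * p k) t.
rewrite pe_lin mul1r mulN1r ler_norml => /andP[_ h2].
have h3 : \sum_k `|1 * p' k + (-1) * p k| <= n.+1%:R * r.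
  rewrite mulr_natl -[X in _ *+ X](card_ord n.+1) -sumr_const; apply: ler_sum => k _.
  by rewrite mul1r mulN1r ltW.
lra.
Qed.

Lemma closure_lower (x y z d e r : R) : 0 <= z -> 0 <= x -> `|1 * x + (-1) * y| <= d * z ->
  d <= e * r -> 0 <= y + e * z * r.
Proof.
move=> z0 x0; rewrite ler_norml => /andP[_ h2] /(ler_wpM2r z0); rewrite mulrAC; lra.
Qed.

Lemma Bm_clP Q : Bm_cl E Q -> [/\ Qsym Q, forall k j h, ~~ E j h -> Q k j h = 0,
  forall t, Tset t -> psdC (Qeval Q t) & exists2 t0 : R, Tset t0 & \det (Qeval Q t0) != 0].
Proof.
move=> [hQ hdet].
have Qs : Qsym Q.
  apply/matrixP => j h; rewrite mxE; apply/eqP; rewrite -subr_eq0 -normr_le0 -oppr_ge0.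
  apply: (@ge0_of_lin _ _ 2 1) => // r r0 _; have [Q' [[Q's _ _] e]] := hQ r r0.
  have e1 := e ord0 j h; have e2 := e ord0 h j.
  have q : Q' ord0 h j = Q' ord0 j h by rewrite -[in RHS]Q's mxE.
  rewrite q in e2; move: e1 e2; rewrite !ltr_norml => /andP[a1 a2] /andP[b1 b2].
  rewrite [leRHS]addrC subr_ge0 ler_norml; apply/andP; split; lra.
split=> //.
- move=> k j h nE; apply/eqP; rewrite -normr_le0 -oppr_ge0.
  apply: (@ge0_of_lin _ _ 1 1) => // r r0 _; have [Q' [[_ Q'0 _] e]] := hQ r r0.
  have e1 := e k j h; rewrite Q'0// sub0r normrN in e1.
  rewrite mul1r [leRHS]addrC subr_ge0; exact: ltW.
- move=> t /TsetP Tt; apply/psdCE; split; first exact: Qeval_herm.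
  move=> v; apply: (@ge0_of_lin _ _ ((\sum_(k < n.+1) \sum_(j < m) \sum_(h < m) 1) * sqn v) 1) => //.
  move=> r r0 _; have [Q' [[Q's _ pos] e]] := hQ r r0.
  have /posdefC_psdC/psdCE[_ /(_ v) h1] := pos t Tt.
  have h2 := qf_bound t v (Qsym_lin 1 (-1) Q's Qs).
  rewrite (qf_lin 1 (-1) t v Q's Qs) in h2.
  have h3 : \sum_k \sum_j \sum_h `|(1 *: Q' k + (-1) *: Q k) j h| <=
      (\sum_(k < n.+1) \sum_(j < m) \sum_(h < m) 1) * r.
    rewrite mulr_suml; apply: ler_sum => k _; rewrite mulr_suml; apply: ler_sum => j _.
    rewrite mulr_suml; apply: ler_sum => h _.
    by rewrite !mxE !mul1r mulN1r ltW.
  exact: closure_lower (sqn_ge0 v) h1 h2 h3.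
- apply: contrapT => hn; apply: hdet => t /TsetP Tt; apply/eqP/negPn/negP => h.
  by apply: hn; exists t.
Qed.

Lemma interior_Bo p (Q : 'I_n.+1 -> 'M[R]_m) : pospair p Q -> Bo p.
Proof. by move=> [p0 _ pp _]; split=> // t _; rewrite peval_pe. Qed.

Lemma interior_Bm p Q : pospair p Q -> (forall k j h, ~~ E j h -> Q k j h = 0) -> Bm E Q.
Proof. by move=> [_ Qs _ QQ] Q0; split. Qed.

Lemma Bo_closure p : Bo p -> Bo_cl p.
Proof. by move=> hp e e0; exists p; split=> // k; rewrite subrr normr0. Qed.

Lemma Bm_closure Q : Bm E Q -> Bm_cl E Q.
Proof.
move=> hQ; split=> [e e0|h]; first by exists Q; split=> // k j l; rewrite subrr normr0.
have T0 : 0 <= (0 : R) < 2 * pi by rewrite lexx pi2_gt0.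
have [_ _ /(_ 0 T0)/posdef_det[]] := hQ.
by rewrite (h 0 T0) ltxx.
Qed.

End Closure.

(** * The tangent as a lower bound on the closure *)

Section DualGap.
Variables (R : realType) (n m : nat).
Local Notation mu := (@lebesgue_measure R).
Variables (Rk : 'I_n.+1 -> 'M[R]_m) (c : 'I_n.+1 -> R) (lam : R).
Hypothesis lam0 : 0 < lam.
Implicit Types (p : 'I_n.+1 -> R) (Q : 'I_n.+1 -> 'M[R]_m).

Lemma herm_det_real k (A : 'M[R[i]]_k) : adjC A = A -> \det A = (complex.Re (\det A))%:C.
Proof.
move=> /spectral_herm[U [d [U1 U2 AE]]].
by rewrite (det_spectral U2 AE).
Qed.

(* Also holds for singular [A]: then [invmx A = A] and both sides are [0]. *)
Lemma det_scaled_inv k (a : R) (A : 'M[R[i]]_k) : adjC A = A ->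
  complex.Re (\det (a%:C *: invmx A)) = a ^+ k * (complex.Re (\det A))^-1.
Proof.
move=> hA; rewrite detZ det_inv (herm_det_real hA) -fmorphV -rmorphXn -rmorphM /=.
by [].
Qed.

(** At boundary points the integrand need not be continuous; writing it with [ln], inversion and the
    determinant keeps it measurable. *)
Lemma measurable_Jint p Q : Qsym Q -> measurable_fun Tset (Jint p Q).
Proof.
move=> Qs.
have mp : measurable_fun Tset (pe p) by apply: measurable_continuous; exact: pe_cts.
have md : measurable_fun Tset (fun t => complex.Re (\det (Qeval Q t))).
  by apply: measurable_continuous; case: (ctsM_det (ctsM_Qeval Qs)).
have -> : Jint p Q = fun t => pe p t * ln (pe p t ^+ m * (complex.Re (\det (Qeval Q t)))^-1) -
    m%:R * pe p t.
  by apply/funext => t; rewrite /Jint (det_scaled_inv _ (Qeval_herm t Qs)).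
apply: measurable_funB; last by apply: measurable_funM => //; exact: measurable_cst.
apply: measurable_funM => //.
apply: (measurableT_comp (@measurable_ln R)).
apply: measurable_funM; first exact: measurable_funX.
exact: (measurableT_comp (@measurable_invr R)).
Qed.

Lemma tr_pairQ Q : \sum_(k < n.+1) \tr ((Q k)^T *m Rk k) = pairQ Q Rk.
Proof.
apply: eq_bigr => k _; rewrite /mxtrace exchange_big /=; apply: eq_bigr => j _.
by rewrite mxE; apply: eq_bigr => h _; rewrite mxE.
Qed.

Lemma JtildeE p Q : p ord0 = 1 -> Jtilde Rk c lam p Q =
  (intT (fun t => (Jint p Q t)%:E) + (pairQ Q Rk)%:E - (\sum_k p k * c k)%:E +
   lam%:E * intT (fun t => ((pe p t)^-1)%:E))%E.
Proof.
move=> p0; rewrite /Jtilde /Jdual /glam tr_pairQ.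
have -> : peval p = pe p by apply/funext => t; rewrite peval_pe.
by [].
Qed.

Lemma Jtilde_real p Q : p ord0 = 1 -> itg (Jint p Q) -> itg (fun t => (pe p t)^-1) ->
  Jtilde Rk c lam p Q = (Jreal lam Rk c p Q)%:E.
Proof.
move=> p0 h1 h2; rewrite JtildeE// !intT_itg//.
apply: (@etrans _ _ (IT (Jint p Q) + pairQ Q Rk - \sum_k p k * c k +
  lam * IT (fun t => (pe p t)^-1))%:E); first by [].
by congr EFin; rewrite /Jreal; ring.
Qed.

Lemma Jtilde_pospair p Q : pospair p Q -> Jtilde Rk c lam p Q = (Jreal lam Rk c p Q)%:E.
Proof.
move=> hi; have [p0 _ _ _] := hi; apply: Jtilde_real => //; first exact: itg_Jint.
by apply: itg_cts; exact: (continuous_pV hi).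
Qed.

Section Gap.
Variables (ph : 'I_n.+1 -> R) (Qh : 'I_n.+1 -> 'M[R]_m).
Hypothesis hph : pospair ph Qh.
Variables (p : 'I_n.+1 -> R) (Q : 'I_n.+1 -> 'M[R]_m).
Hypotheses (p0 : p ord0 = 1) (pp : forall t, Tset t -> 0 <= pe p t).
Hypotheses (Qs : Qsym Q) (Qpsd : forall t, Tset t -> psdC (Qeval Q t)).
Hypothesis Qdet : exists2 t0 : R, Tset t0 & \det (Qeval Q t0) != 0.

Lemma ae_positive : {ae mu, forall t, Tset t -> 0 < pe p t /\ posdefC (Qeval Q t)}.
Proof.
apply: ae_imp (ae_and (ae_pe_neq0 p0) (ae_det_neq0 Qs Qdet)) => t [h1 h2] Tt.
split; first by rewrite lt_neqAle eq_sym h1// pp.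
exact: (psd_posdef (Qpsd Tt) (h2 Tt)).
Qed.

Lemma ae_eq_coef : {ae mu, forall t, Tset t -> pe p t = pe ph t /\ Qeval Q t = Qeval Qh t} ->
  p = ph /\ Q = Qh.
Proof.
have [_ Qhs _ _] := hph; move=> h.
have Tt (t : R) : 0 < t < 2 * pi -> Tset t by case/andP => a b; apply/TsetP; rewrite ltW.
split; apply/funext => k.
  apply/eqP; rewrite -subr_eq0 -[X in X - _]mul1r -mulN1r; apply/eqP.
  apply: (@ae_pe0 _ _ (fun k => 1 * p k + (-1) * ph k) 0 (2 * pi) (lexx _) (pi2_gt0 R) (lexx _)).
  by apply: ae_imp h => t ht /Tt/ht[e _]; rewrite pe_lin e mul1r mulN1r subrr.
apply/matrixP => j l.
have : (1 *: Q k + (-1) *: Qh k) j l = 0.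
  apply: (@ae_Qeval0 _ _ _ (fun k => 1 *: Q k + (-1) *: Qh k) 0 (2 * pi) _ (lexx _) (pi2_gt0 R) (lexx _)).
    exact: (Qsym_lin 1 (-1) Qs Qhs).
  apply: ae_imp h => t ht /Tt/ht[_ e].
  apply: (etrans (Qeval_lin 1 (-1) t Qs Qhs)); rewrite e.
  by rewrite -scalerDl -rmorphD subrr scale0r.
by rewrite !mxE mul1r mulN1r => /eqP; rewrite subr_eq0 => /eqP.
Qed.

(** If both integrals converge, the pointwise tangent inequality is integrated together with its
    equality case. Otherwise one is [+oo] and the other is not [-oo], so the functional is [+oo] and
    cannot equal the finite tangent. *)
Lemma closure_gap : ((Gaff lam Rk c ph Qh p Q)%:E <= Jtilde Rk c lam p Q)%E /\
  (Jtilde Rk c lam p Q = (Gaff lam Rk c ph Qh p Q)%:E -> p = ph /\ Q = Qh).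
Proof.
have mJ := measurable_Jint p Qs.
have mV : measurable_fun Tset (fun t => (pe p t)^-1).
  apply: (measurableT_comp (@measurable_invr R)).
  by apply: measurable_continuous; exact: pe_cts.
(* Taking [lam] equal to 0 gives the [ln det] integrand an integrable minorant of its own,
   independent of whether 1/p is integrable. *)
have [gJ _] := itg_Gint 0 Rk c p hph Qs.
have leJ : {ae mu, forall t, Tset t -> Gint 0 ph Qh p Q t <= Jint p Q t}.
  apply: ae_imp ae_positive => t h /h[a b].
  by have := Gint_le (lexx 0) hph a b; rewrite mul0r addr0.
have leV : {ae mu, forall t, Tset t -> 0 <= (pe p t)^-1}.
  by apply: ae_imp ae_positive => t h /h[a _]; rewrite invr_ge0 ltW.
have i1 (a b d : R) : (a%:E + b%:E - d%:E + +oo)%E = +oo%E :> \bar R by [].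
have i2 (b d e : R) : (+oo + b%:E - d%:E + e%:E)%E = +oo%E :> \bar R by [].
have i3 (b d : R) : (+oo + b%:E - d%:E + +oo)%E = +oo%E :> \bar R by [].
have [iJ|iJ] := intT_dichotomy mJ gJ leJ; have [iV|iV] := intT_dichotomy mV (itg_cst 0) leV.
- rewrite Jtilde_real// lee_fin.
  have [gG gE] := itg_Gint lam Rk c p hph Qs.
  have iF := itgD iJ (itgZ lam iV).
  have leF : {ae mu, forall t, Tset t -> Gint lam ph Qh p Q t <= Jint p Q t + lam * (pe p t)^-1}.
    by apply: ae_imp ae_positive => t h /h[a b]; exact: Gint_le (ltW lam0) hph a b.
  have [h1 h2] := IT_ae_le iF gG leF.
  have iE : IT (fun t => Jint p Q t + lam * (pe p t)^-1) =
      IT (Jint p Q) + lam * IT (fun t => (pe p t)^-1).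
    by rewrite ITD ?ITZ//; exact: itgZ.
  rewrite iE in h1 h2; rewrite -gE /Jreal; split; first by rewrite !lerD2r.
  case=> e; apply: ae_eq_coef.
  have e2 : IT (Gint lam ph Qh p Q) = IT (Jint p Q) + lam * IT (fun t => (pe p t)^-1).
    by move: e => /addIr/addIr.
  apply: ae_imp (ae_and (h2 e2) ae_positive) => t [h3 h4] Tt; have [a b] := h4 Tt.
  exact: Gint_eq lam0 hph a b (esym (h3 Tt)).
- by rewrite JtildeE// iV intT_itg// gt0_muley ?lte_fin// i1 leey.
- by rewrite JtildeE// iJ intT_itg// -EFinM i2 leey.
- by rewrite JtildeE// iJ iV gt0_muley ?lte_fin// i3 leey.
Qed.

End Gap.

End DualGap.

(** * Complex moments and bounds of the optimal density *)

Section Moments.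
Variables (R : realType) (n m : nat).
Variables (p : 'I_n.+1 -> R) (Q : 'I_n.+1 -> 'M[R]_m).
Hypothesis hi : pospair p Q.

Lemma Im_conjc (z : R[i]) : complex.Im (conjc z) = - complex.Im z.
Proof. by case: z. Qed.

(** The real part is [Bmom] by construction; t -> 2 pi - t conjugates the integrand, so its
    imaginary part is odd. *)
Lemma intTC_cov (k : 'I_n.+1) (j h : 'I_m) :
  intTC (fun t => expi (k%:R * t) * Phihat p Q t j h) = ((Bmom p Q k j h)%:E, 0%:E).
Proof.
have [cR cI] := ctsCM (ctsC_expi R k) (ctsM_Phihat hi j h).
rewrite /intTC !intT_itg; [|exact: itg_cts|exact: itg_cts].
congr (_, _%:E); first by rewrite [in RHS]mxE.
apply: IT_odd => // t.
apply: (etrans (f_equal2 (fun a (M : ('M[R[i]]_m)) => complex.Im (a * fun_of_matrix M j h))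
  (expi_2pi k t) (Phihat_2pi hi t))).
by rewrite mxE -[conjc _ * _](rmorphM (@conjc R)) Im_conjc.
Qed.

Lemma intTC_expi_even (f : R -> R) (k : nat) : continuous f ->
  (forall t, f (2 * pi - t) = f t) ->
  intTC (fun t => expi (k%:R * t) * (f t)%:C) = ((IT (fun t => cos (k%:R * t) * f t))%:E, 0%:E).
Proof.
move=> cf fe; have [cR cI] := ctsCM (ctsC_expi R k) (ctsC_real cf).
rewrite /intTC !intT_itg; [|exact: itg_cts|exact: itg_cts].
congr (_%:E, _%:E).
  by apply: eq_IT => t _; rewrite cReM /= mulr0 subr0.
apply: IT_odd => // t.
rewrite expi_2pi fe.
have -> : conjc (expi (k%:R * t)) * (f t)%:C = conjc (expi (k%:R * t) * (f t)%:C).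
  by rewrite rmorphM /= oppr0.
exact: Im_conjc.
Qed.

Lemma intTC_cep (lam a : R) (k : 'I_n.+1) : Amom lam p Q k = a ->
  intTC (fun t => expi (k%:R * t) * (ln (complex.Re (\det (Phihat p Q t))))%:C) =
  ((a%:E + lam%:E * (intTC (fun t => (expi (k%:R * t) * ((peval p t) ^- 2)%:C)%R)).1)%E,
   (lam%:E * (intTC (fun t => (expi (k%:R * t) * ((peval p t) ^- 2)%:C)%R)).2)%E).
Proof.
move=> ha; have [p0 _ _ _] := hi.
have -> : peval p = pe p by apply/funext => t; rewrite peval_pe.
rewrite (intTC_expi_even k (continuous_lnPhi hi)); last exact: (lnPhi_2pi hi).
rewrite (intTC_expi_even k (continuous_pV2 hi)); last by move=> t; rewrite pe_2pi.
rewrite -EFinM -EFinD mule0; congr (_%:E, _).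
have i1 : itg (fun t => cos (k%:R * t) * lnPhi p Q t).
  apply: itg_cts => t; apply: cvgM; first exact: continuous_cosk.
  exact: (continuous_lnPhi hi).
have i2 : itg (fun t => cos (k%:R * t) * (pe p t) ^- 2).
  apply: itg_cts => t; apply: cvgM; first exact: continuous_cosk.
  exact: (continuous_pV2 hi).
have : IT (fun t => cos (k%:R * t) * lnPhi p Q t - lam * (cos (k%:R * t) * (pe p t) ^- 2)) = a.
  by rewrite -ha; apply: eq_IT => t _; rewrite mulrBr mulrCA.
rewrite ITB ?ITZ//; first by move=> <-; rewrite subrK.
exact: itgZ.
Qed.

Lemma Phihat_bounds (s : R) : 0 < s -> (forall t, s <= pe p t) ->
  (forall t v, s * sqn v <= qf (Qeval Q t) v) ->
  exists a b : R, 0 < a /\ forall t : R, 0 <= t < 2 * pi ->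
    psdC (Phihat p Q t - (a%:C)%:M) /\ psdC ((b%:C)%:M - Phihat p Q t).
Proof.
move=> s0 ps qs; have [_ Qs pp QQ] := hi.
pose P : R := \sum_k `|p k|.
pose D : R := \sum_k \sum_j \sum_h `|Q k j h| + 1.
have D0 : 0 < D by rewrite ltr_wpDl// /D; do 3 (apply: sumr_ge0 => ? _).
have qD t v : qf (Qeval Q t) v <= D * sqn v.
  apply: (le_trans (ler_norm _)); apply: (le_trans (qf_bound t v Qs)).
  by rewrite ler_wpM2r ?sqn_ge0// /D lerDl.
(* From [s <= p <= P] and [s I <= Q <= D I]. *)
exists (s / D), (P / s); split; first by rewrite divr_gt0.
move=> t _; have Ph := Phihat_herm hi t.
have qP v : qf (Phihat p Q t) v = pe p t * qf (invmx (Qeval Q t)) v.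
  by rewrite (PhihatE hi) qfZ.
split; apply/psdCE; split.
- by rewrite adjCB adjC_scalar Ph.
- move=> v; rewrite qfD qfN qf_scalar qP subr_ge0 -mulrA ler_pM ?(ltW s0)//.
    by rewrite mulr_ge0 ?sqn_ge0// invr_ge0 ltW.
  by rewrite mulrC; exact: (qf_inv_ge (QQ t) D0 (qD t v)).
- by rewrite adjCB adjC_scalar Ph.
- move=> v; rewrite qfD qfN qf_scalar qP subr_ge0 -mulrA ler_pM ?(ltW (pp t))//.
  + by have /posdefC_psdC/psdCE[_] := posdef_inv (QQ t); apply.
  + exact: le_trans (ler_norm _) (pe_bound p t).
  + by rewrite mulrC; exact: (qf_inv_le v (QQ t) s0 (qs t)).
Qed.

End Moments.

(** Along a feasible difference the gradient vanishes on [E], the difference of the [Q] parts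
    vanishes off [E], and the constant coefficients of the [p] parts agree. *)
Lemma Gaff_stationary (R : realType) (n m : nat) (E : rel 'I_m)
    (Rk : 'I_n.+1 -> 'M[R]_m) (c : 'I_n.+1 -> R) (lam : R)
    (ph : 'I_n.+1 -> R) (Qh : 'I_n.+1 -> 'M[R]_m) (p : 'I_n.+1 -> R) (Q : 'I_n.+1 -> 'M[R]_m) :
  pospair ph Qh -> p ord0 = 1 ->
  (forall k : 'I_n.+1, (0 < k)%N -> Amom lam ph Qh k = c k) ->
  (forall k j h, E j h -> Bmom ph Qh k j h = Rk k j h) ->
  (forall k j h, ~~ E j h -> Q k j h = 0) -> (forall k j h, ~~ E j h -> Qh k j h = 0) ->
  Gaff lam Rk c ph Qh p Q = Jreal lam Rk c ph Qh.
Proof.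
move=> hi p0 hA hB Q0 Qh0; have [ph0 _ _ _] := hi.
rewrite -(Gaff_refl lam Rk c hi); apply/eqP; rewrite -subr_eq0 Gaff_diff.
rewrite big1 ?add0r => [|k _]; last first.
  have [k0|k0] := posnP k; last by rewrite hA// subrr mulr0.
  have -> : k = ord0 by apply: val_inj.
  by rewrite p0 ph0 subrr mul0r.
apply/eqP; apply: big1 => k _; apply: big1 => j _; apply: big1 => h _.
have [Ejh|nE] := boolP (E j h).
  by rewrite hB// subrr mulr0.
by rewrite Q0// Qh0// subrr mul0r.
Qed.

Theorem theorem1 (R : realType) (m n : nat) (hm : (0 < m)%N) (hn : (0 < n)%N)
  (E : rel 'I_m) (Esym : forall j h : 'I_m, E j h = E h j) (Erefl : forall j : 'I_m, E j j)
  (Rk : 'I_n.+1 -> 'M[R]_m) (hR0 : (Rk ord0)^T = Rk ord0) (c : 'I_n.+1 -> R)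
  (lam : R) (hlam : 0 < lam)
  (hPhibar : exists Phibar : R -> 'M[R[i]]_m,
     [/\ forall t : R, 0 <= t < 2 * pi -> psdC (Phibar t),
         forall j h : 'I_m, integrableTC (fun t => Phibar t j h),
         exists a b : R, [/\ 0 <= a, a < b, b <= 2 * pi &
                            forall t : R, a < t < b -> posdefC (Phibar t)] &
         forall (k : 'I_n.+1) (j h : 'I_m), E j h ->
           intTC (fun t => Phibar t j h * expi (k%:R * t)) = ((Rk k j h)%:E, 0%:E)]) :
  exists (ph : 'I_n.+1 -> R) (Qh : 'I_n.+1 -> 'M[R]_m),
  [/\ (* (ph, Qh) is a minimizer over the feasible set *)
      Bo_cl ph /\ Bm_cl E Qh,
      (forall (p : 'I_n.+1 -> R) (Q : 'I_n.+1 -> 'M[R]_m), Bo_cl p -> Bm_cl E Q ->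
         (Jtilde Rk c lam ph Qh <= Jtilde Rk c lam p Q)%E),
      (* it is the unique minimizer *)
      (forall (p : 'I_n.+1 -> R) (Q : 'I_n.+1 -> 'M[R]_m), Bo_cl p -> Bm_cl E Q ->
         (forall (p' : 'I_n.+1 -> R) (Q' : 'I_n.+1 -> 'M[R]_m), Bo_cl p' -> Bm_cl E Q' ->
            (Jtilde Rk c lam p Q <= Jtilde Rk c lam p' Q')%E) ->
         p = ph /\ Q = Qh),
      (* it lies in the interior *)
      Bo ph /\ Bm E Qh &
      [/\ (* Phihat is bounded and coercive on T *)
          exists a b : R, 0 < a /\
            forall t : R, 0 <= t < 2 * pi ->
              psdC (Phihat ph Qh t - (a%:C)%:M) /\ psdC ((b%:C)%:M - Phihat ph Qh t),
          (* covariance matching *)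
          forall (k : 'I_n.+1) (j h : 'I_m), E j h ->
            intTC (fun t => expi (k%:R * t) * Phihat ph Qh t j h) = ((Rk k j h)%:E, 0%:E) &
          (* cepstral moments, with eps_k = lam \int_T e^{i t k} ph^{-2} *)
          forall k : 'I_n.+1, (0 < k)%N ->
            intTC (fun t => expi (k%:R * t) * (ln (complex.Re (\det (Phihat ph Qh t))))%:C) =
            (((c k)%:E + lam%:E * (intTC (fun t => (expi (k%:R * t) * ((peval ph t) ^- 2)%:C)%R)).1)%E,
             (lam%:E * (intTC (fun t => (expi (k%:R * t) * ((peval ph t) ^- 2)%:C)%R)).2)%E)]].
Proof.
have [Phi [Phi_psd Phi_int Phi_pd Phi_mom]] := hPhibar.
have coer l (l0 : 0 <= l) := Jreal_coercive Erefl Phi_psd Phi_int Phi_pd Phi_mom c l0.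
have bnd := cone_bound Phi_psd Phi_int Phi_pd Phi_mom.
have pos p Q (h : cone E 0 p Q) : 0 <= pairQ Q Rk.
  by have [] := cone_pos Phi_psd Phi_int Phi_pd Phi_mom h.
have [s [ph [Qh [s0 hmin hint]]]] := exists_interior_min Erefl hlam coer bnd pos.
have hi := min_pospair s0 hmin; have [ph0 Qhs _ _] := hi.
have s20 : 0 < 2 * s by rewrite mulr_gt0.
have [_ Qh0 ps qs] := hint.
have mA := moment_A hlam s0 hmin hint.
have mB := moment_B Esym hR0 hlam s0 hmin hint.
have hBo := interior_Bo hi; have hBm := interior_Bm hi Qh0.
have gap p Q : Bo_cl p -> Bm_cl E Q -> (Jtilde Rk c lam ph Qh <= Jtilde Rk c lam p Q)%E /\
    (Jtilde Rk c lam p Q = Jtilde Rk c lam ph Qh -> p = ph /\ Q = Qh).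
  move=> /Bo_clP[p0 pp] /Bm_clP[Qs Q0 Qpsd Qdet].
  rewrite [X in (X <= _)%E](Jtilde_pospair Rk c lam hi) [X in _ = X -> _](Jtilde_pospair Rk c lam hi).
  (* The minimal value is replaced by the tangent at the arbitrary feasible pair, which is the form
     that [closure_gap] compares with the functional. *)
  rewrite -(Gaff_stationary hi p0 mA mB Q0 Qh0).
  exact: closure_gap.
exists ph, Qh; split.
- by split; [exact: Bo_closure|exact: Bm_closure].
- by move=> p Q hp hQ; have [] := gap p Q hp hQ.
- move=> p Q hp hQ h; have [h1 h2] := gap p Q hp hQ; apply: h2.
  apply: le_anti; apply/andP; split; last exact: h1.
  exact: h _ _ (Bo_closure hBo) (Bm_closure hBm).
- by split.
split.
- exact: (Phihat_bounds hi s20 ps qs).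
- by move=> k j h Ejh; rewrite (intTC_cov hi) mB.
- by move=> k k0; apply: (intTC_cep hi); exact: mA.
Qed.
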